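(* Assume that $F:\Omega\times X\to\mathbb{R}^m$ is continuous, of class $C^1$ with respect to the second variable, that $F(\Omega\times X_1)$ is bounded in $\mathbb{R}^m$ for every bounded set $X_1\subset X$, and that: (a) $F(\omega,\psi)-F(\omega,\phi)\geq B\,(\psi(0)-\phi(0))$ whenever $\phi\leq_B\psi$ and $\omega\in\Omega$; (b) $F(\omega,\lambda\psi)\ge\lambda F(\omega,\psi)$ whenever $\psi\ge_B0$, $\lambda\in[0,1]$ and $\omega\in\Omega$; (c) there exists a pair $(\omega_0,\phi_0)\in\Omega\times\operatorname{Int}\widetilde K_B$ with bounded semitrajectory $\{(\omega_0\cdot t,y_t(\omega_0,\phi_0))\mid t\ge0\}$ and such that $y_t(\omega_0,\phi_0)\ge_B\psi_0$ for some $\psi_0\gg_B0$ and each $t\ge0$; (d) there exist a point $\omega_1\in\Omega$ and a time $t_1>0$ such that $y_{t_1}(\omega_1,\lambda\psi)\gg_B\lambda\,y_{t_1}(\omega_1,\psi)$ whenever $\psi\gg_B0$ and $\lambda\in(0,1)$. Then there exists a unique strongly positive minimal set $M\gg_B0$, which is a copy of the base, that is, $M=\{(\omega,b(\omega))\mid\omega\in\Omega\}$ for a continuous map $b:\Omega\to\operatorname{Int}\widetilde K_B$, and $$\lim_{t\to\infty}\|y_t(\omega,\phi)-b(\omega\cdot t)\|_L=0\quad\text{whenever }\omega\in\Omega\text{ and }\phi\gg_B0.$$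
   Context: $\Omega$ is a compact metric space with a continuous minimal flow $\mathbb{R}\times\Omega\to\Omega$, $(t,\omega)\mapsto\omega\cdot t$. Fix $r>0$, $m\ge 1$. $X=C([-r,0],\mathbb{R}^m)$ with the sup-norm $\|\varphi\|_\infty=\sup_{s\in[-r,0]}\|\varphi(s)\|$, where $\|\cdot\|$ is the maximum norm on $\mathbb{R}^m$. For a continuous $y:[-r,\infty)\to\mathbb{R}^m$ and $t\ge0$, $y_t\in X$ is $y_t(s)=y(t+s)$, $s\in[-r,0]$. For $y\in\mathbb{R}^m$, $y\ge0$ (resp. $y\gg0$) means all components are nonnegative (resp. positive); for $\phi\in X$, $\phi\ge0$ (resp. $\phi\gg0$) means $\phi(s)\ge0$ (resp. $\phi(s)\gg0$) for all $s\in[-r,0]$. $B=[b_{ij}]$ is a fixed real $m\times m$ quasipositive matrix ($b_{ij}\ge0$ for $i\ne j$). The exponential ordering is given by the cone $K_B=\{\phi\in X\mid \phi\ge0,\ \phi(t)\ge e^{B(t-s)}\phi(s)\text{ for } -r\le s\le t\le0\}$: $\phi\le_B\psi$ iff $\psi-\phi\in K_B$. $X_L\subset X$ is the Banach space of Lipschitz functions with norm $\|\phi\|_L=\|\phi\|_\infty+\sup\{\|\phi(t)-\phi(s)\|/|t-s| : s\ne t\in[-r,0]\}$; $\widetilde K_B=K_B\cap X_L$, whose interior in $X_L$ is $\operatorname{Int}\widetilde K_B=\{\phi\in X_L\mid \phi\gg0 \text{ and, for some }\varepsilon>0,\ \phi'-B\phi\ge(\varepsilon,\dots,\varepsilon)\text{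 a.e. on }[-r,0]\}$ (with the topology of $X_L$). We write $\phi\ll_B\psi$ (or $\psi\gg_B\phi$) iff $\psi-\phi\in\operatorname{Int}\widetilde K_B$. For $\omega\in\Omega$, $\varphi\in X$, $y(t,\omega,\varphi)$ denotes the unique solution of $y'(t)=F(\omega\cdot t,y_t)$, $t\ge0$, with $y(s,\omega,\varphi)=\varphi(s)$ for $s\in[-r,0]$, and $y_t(\omega,\varphi)(s)=y(t+s,\omega,\varphi)$. The induced skew-product semiflow is $\tau_t(\omega,\varphi)=\tau(t,\omega,\varphi)=(\omega\cdot t,y_t(\omega,\varphi))$ (under the hypotheses of the claim it is globally defined on $\Omega\times K_B$). A compact set $M\subset\Omega\times X_L$ is strongly positive, written $M\gg_B0$, if $M\subset\Omega\times\operatorname{Int}\widetilde K_B$. A minimal set is a nonempty compact invariant set ($\tau_t(M)=M$ for $t\ge0$) containing no proper nonempty compact invariant subset. *)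

(* Defs.v *)
From HB Require Import structures.
From mathcomp Require Import all_boot all_order all_algebra.
From mathcomp Require Import mathcomp_extra boolp classical_sets functions.
From mathcomp Require Import reals ereal interval_inference topology normedtype.
From mathcomp Require Import sequences derive realfun.

Set Implicit Arguments.
Unset Strict Implicit.
Unset Printing Implicit Defensive.
Import Order.TTheory GRing.Theory Num.Theory.
Import numFieldNormedType.Exports.

Local Open Scope classical_set_scope.
Local Open Scope ring_scope.

Section sup_norm.
Variables (R : realType) (T : Type) (V : normedModType R) (D : set T).
Implicit Types (f g : T -> V) (M : R).

Definition supnorm f : R := sup [set `|f x| | x in D].

Let bnd f := exists M, forall x, D x -> `|f x| <= M.

Lemma supnorm_ub f x : bnd f -> D x -> `|f x| <= supnorm f.
Proof.
move=> [M fM] Dx; apply: ub_le_sup; last by exists x.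
by exists M => _ [y Dy <-]; exact: fM.
Qed.

Lemma supnorm_le f M : 0 <= M -> (forall x, D x -> `|f x| <= M) ->
  supnorm f <= M.
Proof.
move=> M0 fM; rewrite /supnorm.
have [->|ne] := eqVneq [set `|f x| | x in D] set0; first by rewrite sup0.
by apply: ge_sup => [|_ [y Dy <-]]; [exact/set0P|exact: fM].
Qed.

Lemma supnorm_ge0 f : bnd f -> 0 <= supnorm f.
Proof.
move=> bf; have [[x Dx]|/forallNP ne] := pselect (exists x, D x).
  exact: le_trans (supnorm_ub bf Dx).
rewrite /supnorm (_ : [set _ | _ in _] = set0) ?sup0//.
by rewrite -subset0 => z [x Dx _]; exact: (ne x).
Qed.

Lemma supnormD f g h : bnd f -> bnd g -> (forall x, D x -> h x = f x + g x) ->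
  supnorm h <= supnorm f + supnorm g.
Proof.
move=> bf bg hE; apply: supnorm_le; first by rewrite addr_ge0// supnorm_ge0.
move=> x Dx; rewrite hE//; apply: le_trans (ler_normD _ _) _.
by rewrite lerD// supnorm_ub.
Qed.

Lemma supnormZ f h (l : R) : bnd f -> (forall x, D x -> h x = l *: f x) ->
  supnorm h = `|l| * supnorm f.
Proof.
move=> bf hE.
have bh : bnd h.
  by case: bf => M fM; exists (`|l| * M) => x Dx; rewrite hE// normrZ ler_wpM2l// fM.
apply/eqP; rewrite eq_le; apply/andP; split.
  apply: supnorm_le => [|x Dx]; first by rewrite mulr_ge0// supnorm_ge0.
  by rewrite hE// normrZ ler_wpM2l// supnorm_ub.
have [->|l0] := eqVneq l 0; first by rewrite normr0 mul0r supnorm_ge0.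
rewrite mulrC -ler_pdivlMr ?normr_gt0//.
apply: supnorm_le => [|x Dx]; first by rewrite divr_ge0// supnorm_ge0.
by rewrite ler_pdivlMr ?normr_gt0// mulrC -normrZ -hE// supnorm_ub.
Qed.

End sup_norm.

(* Componentwise order; the norm on 'cV[R]_m is the maximum norm. *)
Definition cvle (R : realType) (m : nat) (u v : 'cV[R]_m) : Prop :=
  forall i, u i 0 <= v i 0.

Definition expmx (R : realType) (m : nat) (A : 'M[R]_m) : 'M[R]_m :=
  limn (series (fun k : nat => (k`!%:R)^-1 *: A ^+ k)).

(* An element of C([-r, 0], R^m) is represented by its extension by 0 to R, so
   that equality of functions on [-r, 0] is Leibniz equality. *)
Definition hist_pred (R : realType) (r : R) (m : nat) : {pred R -> 'cV[R]_m} :=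
  [pred f : R -> 'cV[R]_m | `[< {within `[- r, 0], continuous f} /\
                (forall s : R, s \notin `[- r, 0] -> f s = 0) >]].
Arguments hist_pred {R} r m.

Record hist (R : realType) (r : R) (m : nat) := Hist {
  hist_val :> R -> 'cV[R]_m ;
  _ : hist_val \in hist_pred r m }.

Section hist_structure.
Variables (R : realType) (r : R) (m : nat).

HB.instance Definition _ := [isSub for @hist_val R r m].
HB.instance Definition _ := [Choice of hist r m by <:].

Lemma hist_predP (f : R -> 'cV[R]_m) : reflect
  ({within `[- r, 0], continuous f} /\
   (forall s : R, s \notin `[- r, 0] -> f s = 0))
  (f \in hist_pred r m).
Proof. exact: asboolP. Qed.

Lemma hist_submod_closed : submod_closed (hist_pred r m).
Proof.
split.
  by apply/hist_predP; split=> // x; exact: cst_continuous.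
move=> a f g /hist_predP[cf zf] /hist_predP[cg zg].
apply/hist_predP; split=> [x|s sI]; last first.
  by rewrite !fctE zf// zg// scaler0 addr0.
apply: (@continuousD _ _ _ (a *: f : subspace _ -> _)); last exact: cg.
by apply: (@continuousZr _ _ _ (f : subspace _ -> _)); exact: cf.
Qed.

HB.instance Definition _ :=
  GRing.isSubmodClosed.Build _ _ (hist_pred r m) hist_submod_closed.
HB.instance Definition _ := [SubChoice_isSubLmodule of hist r m by <:].

Implicit Types f g : hist r m.

Lemma hist_continuous f : {within `[- r, 0], continuous f}.
Proof. by case: f => f /= /hist_predP[]. Qed.

Lemma hist_out f (s : R) : s \notin `[- r, 0] -> f s = 0.
Proof. by case: f => f /= /hist_predP[_]; apply. Qed.

Lemma hist_bounded f : exists M : R, forall s, s \in `[- r, 0] -> `|f s| <= M.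
Proof.
have := continuous_compact (@hist_continuous f) (@segment_compact _ (- r) 0).
move=> /compact_bounded[M [_ fM]]; exists (M + 1) => s sI.
by apply: (fM (M + 1)); [rewrite ltrDl|exists s].
Qed.

Lemma hist_addE f g s : (f + g) s = f s + g s. Proof. by []. Qed.

Lemma hist_scaleE (l : R) f s : (l *: f) s = l *: f s. Proof. by []. Qed.

Definition hist_norm f : R := supnorm `[- r, 0] f.

Lemma hist_normD f g : hist_norm (f + g) <= hist_norm f + hist_norm g.
Proof. by apply: supnormD => //; exact: hist_bounded. Qed.

Lemma hist_normZ (l : R) f : hist_norm (l *: f) = `|l| * hist_norm f.
Proof. by apply: supnormZ => //; exact: hist_bounded. Qed.

Lemma hist_norm0_eq0 f : hist_norm f = 0 -> f = 0.
Proof.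
move=> f0; apply/val_inj/funext => s /=.
have [sI|/hist_out//] := boolP (s \in `[- r, 0]).
apply/eqP; rewrite -normr_le0 -f0; apply: supnorm_ub => //.
exact: hist_bounded.
Qed.

HB.instance Definition _ := @Lmodule_isNormed.Build R (hist r m)
  hist_norm hist_normD hist_normZ hist_norm0_eq0.

End hist_structure.

Definition lip_pred (R : realType) (r : R) (m : nat) : {pred hist r m} :=
  [pred f : hist r m | `[< [lipschitz f s | s in `[- r, 0] ] >]].
Arguments lip_pred {R} r m.

Record lip (R : realType) (r : R) (m : nat) := Lip {
  lip_val :> hist r m ;
  _ : lip_val \in lip_pred r m }.

Section lip_structure.
Variables (R : realType) (r : R) (m : nat).

HB.instance Definition _ := [isSub for @lip_val R r m].
HB.instance Definition _ := [Choice of lip r m by <:].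

Let pairs : set (R * R) :=
  [set p | [/\ p.1 \in `[- r, 0], p.2 \in `[- r, 0] & p.1 != p.2]].

Definition slope (f : hist r m) (p : R * R) : 'cV[R]_m :=
  (p.1 - p.2)^-1 *: (f p.1 - f p.2).

Let slopeE f p : p.1 != p.2 -> `|slope f p| = `|f p.1 - f p.2| / `|p.1 - p.2|.
Proof. by move=> ?; rewrite normrZ normfV mulrC. Qed.

Lemma lip_predP (f : hist r m) :
  f \in lip_pred r m <-> exists M : R, forall p, pairs p -> `|slope f p| <= M.
Proof.
split.
  move=> /asboolP[M [_ fM]]; exists (M + 1) => p [p1 p2 p12].
  rewrite slopeE// ler_pdivrMr ?normr_gt0 ?subr_eq0//.
  by apply: (fM (M + 1) _ p); [rewrite ltrDl|split].
move=> [M fM]; apply/asboolP; exists M; split=> [|k Mk]; first exact: num_real.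
move=> p [p1 p2] /=.
have [->|p12] := eqVneq p.1 p.2; first by rewrite !subrr !normr0 mulr0.
rewrite -ler_pdivrMr ?normr_gt0 ?subr_eq0// -slopeE//.
by apply: le_trans (ltW Mk); exact: fM.
Qed.

Let slopeD f g p : slope (f + g) p = slope f p + slope g p.
Proof. by rewrite /slope -scalerDr !hist_addE opprD addrACA. Qed.

Let slopeZ l f p : slope (l *: f) p = l *: slope f p.
Proof. by rewrite /slope !hist_scaleE -scalerBr !scalerA mulrC. Qed.

Lemma lip_submod_closed : submod_closed (lip_pred r m).
Proof.
split.
  apply/lip_predP; exists 0 => p _.
  by rewrite /slope subrr scaler0 normr0.
move=> a f g /lip_predP[M fM] /lip_predP[N gN].
apply/lip_predP; exists (`|a| * M + N) => p Dp.
rewrite slopeD slopeZ (le_trans (ler_normD _ _))// lerD ?gN//.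
by rewrite normrZ ler_wpM2l// fM.
Qed.

HB.instance Definition _ :=
  GRing.isSubmodClosed.Build _ _ (lip_pred r m) lip_submod_closed.
HB.instance Definition _ := [SubChoice_isSubLmodule of lip r m by <:].

Implicit Types f g : lip r m.

Definition lip_norm f : R := `|f : hist r m| +
  sup [set `|f p.1 - f p.2| / `|p.1 - p.2| | p in pairs].

Let lip_normE f : lip_norm f = `|f : hist r m| + supnorm pairs (slope f).
Proof.
congr (_ + sup _); apply: eq_imagel => p [_ _ p12]; by rewrite slopeE.
Qed.

Let lip_bounded f : exists M : R, forall p, pairs p -> `|slope f p| <= M.
Proof. by case: f => f lf /=; exact/lip_predP. Qed.

Lemma lip_normD f g : lip_norm (f + g) <= lip_norm f + lip_norm g.
Proof.
rewrite !lip_normE addrACA; apply: lerD; first exact: ler_normD.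
by apply: supnormD => // p _; exact: slopeD.
Qed.

Lemma lip_normZ (l : R) f : lip_norm (l *: f) = `|l| * lip_norm f.
Proof.
rewrite !lip_normE mulrDr; congr (_ + _); first exact: normrZ.
by apply: supnormZ => // p _; exact: slopeZ.
Qed.

Lemma lip_norm0_eq0 f : lip_norm f = 0 -> f = 0.
Proof.
move=> f0; apply/val_inj/eqP; rewrite /= -normr_le0 -f0 lip_normE lerDl.
exact: supnorm_ge0.
Qed.

HB.instance Definition _ := @Lmodule_isNormed.Build R (lip r m)
  lip_norm lip_normD lip_normZ lip_norm0_eq0.

End lip_structure.

Section exponential_order.
Variables (R : realType) (r : R) (m : nat) (B : 'M[R]_m).

Definition quasipositive : Prop := forall i j, i != j -> 0 <= B i j.

Definition Kcone : set (hist r m) := [set phi |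
  (forall s, s \in `[- r, 0] -> cvle 0 (phi s)) /\
  (forall s t, - r <= s -> s <= t -> t <= 0 ->
    cvle (expmx ((t - s) *: B) *m phi s) (phi t))].

Definition Bcone_le (phi psi : hist r m) : Prop := Kcone (psi - phi).

Definition Kcone_lip : set (lip r m) := [set phi | Kcone phi].

(* The interior is taken in the norm topology of lip r m, i.e. in X_L, not in
   the sup-norm topology, for which Kcone has empty interior. *)
Definition Bcone_ll (phi psi : hist r m) : Prop :=
  exists2 eta : lip r m, interior Kcone_lip eta & lip_val eta = psi - phi.

End exponential_order.

Definition minimal_set (T : topologicalType) (inv : set T -> Prop)
    (M : set T) : Prop :=
  [/\ M !=set0, compact M, inv M &
      forall K, K !=set0 -> compact K -> inv K -> K `<=` M -> K = M].

Section flow.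
Variables (R : realType) (Omega : metricType R) (theta : R -> Omega -> Omega).

Definition continuous_flow : Prop :=
  [/\ continuous (fun p : R * Omega => theta p.1 p.2),
      forall w, theta 0 w = w &
      forall s t w, theta (s + t) w = theta s (theta t w)].

Definition flow_invariant (K : set Omega) : Prop :=
  forall t, theta t @` K = K.

End flow.

(* y_t; the default value 0 is taken only if y is discontinuous on
   [t - r, t]. *)
Definition segment (R : realType) (r : R) (m : nat) (y : R -> 'cV[R]_m)
    (t : R) : hist r m :=
  insubd 0 (fun s : R => if s \in `[- r, 0] then y (t + s) else 0).

Section delay_equation.
Variables (R : realType) (r : R) (m : nat) (Omega : metricType R).
Variables (theta : R -> Omega -> Omega) (F : Omega -> hist r m -> 'cV[R]_m).

Definition C1_snd : Prop :=
  (forall w phi, differentiable (F w) phi) /\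
  (* continuity of (w, phi) |-> 'd (F w) phi in operator norm *)
  (forall (w : Omega) (phi : hist r m) (e : R), 0 < e ->
    \forall w' \near w & psi \near phi, forall h : hist r m,
      `|'d (F w') psi h - 'd (F w) phi h| <= e * `|h|).

Definition solves (w : Omega) (phi : hist r m) (y : R -> 'cV[R]_m) : Prop :=
  [/\ {within `[- r, +oo[, continuous y},
      forall s, s \in `[- r, 0] -> y s = phi s,
      h^-1 *: (y h - y 0) @[h --> 0^'+] --> F (theta 0 w) (segment r y 0) &
      forall t : R, 0 < t -> is_derive t 1 y (F (theta t w) (segment r y t))].

(* Solutions are unique on [-r, +oo[ only; the values on ]-oo, -r[ depend on
   the choice but never enter a segment. *)
Definition solution (w : Omega) (phi : hist r m) : R -> 'cV[R]_m :=
  xget (fun=> 0) (solves w phi).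

Definition sol_segment (t : R) (w : Omega) (phi : hist r m) : hist r m :=
  segment r (solution w phi) t.

Definition semiflow (t : R) (p : Omega * hist r m) : Omega * hist r m :=
  (theta t p.1, sol_segment t p.1 p.2).

Definition lip_incl (p : Omega * lip r m) : Omega * hist r m :=
  (p.1, lip_val p.2).

(* Compactness of M refers to the topology of Omega x X_L, whereas the semiflow
   acts on Omega x X. *)
Definition semiflow_invariant (M : set (Omega * lip r m)) : Prop :=
  forall t, 0 <= t -> semiflow t @` (lip_incl @` M) = lip_incl @` M.

Definition strongly_positive (B : 'M[R]_m) (M : set (Omega * lip r m)) : Prop :=
  M `<=` [set p | interior (@Kcone_lip R r m B) p.2].

End delay_equation.

(* Main.v *)
(* The semiflow is monotone for the exponential order: if z' >= Bz and the initial history of z lies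
   in the cone, then e^{B(T-u)} z(u) is nondecreasing, so all later histories of z lie in the cone.
   Adding a small multiple of e^{kt} to a solution makes the inequality strict and gives comparison
   with sub- and supersolutions, hence uniqueness, monotonicity and sublinearity.

   Limits of equi-Lipschitz families of solutions along an ultrafilter exist pointwise, are again
   solutions, and are limits in the Lipschitz norm. Translating the bounded orbit of (c) gives, over
   every base point, an entire orbit that is bounded and bounded below by an interior point of the
   cone. Such an entire orbit is unique. Indeed, for two of them y and z, let l be the largest number
   with l y <= z at all times. If l < 1, translate backwards along times s with w.s -> w1. By (d) the
   limit orbits satisfy z >> l y at time t1, so with some d > 0 one has z >= (l + d) y at arbitrarily
   early times, and then at all times, against the choice of l.

   The map b sends w to the time 0 history of this orbit. By uniqueness every ultrafilter limit of
   translates of bounded, bounded below orbits is an orbit through b. This gives both the continuity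
   of b and the convergence to b of all orbits starting in the interior of the cone. *)

Require Import Defs.
From mathcomp Require Import all_boot all_order all_algebra.
From mathcomp Require Import mathcomp_extra boolp classical_sets functions.
From mathcomp Require Import reals ereal interval_inference topology normedtype.
From mathcomp Require Import sequences derive realfun exp.
From mathcomp Require Import ring lra.
Set Implicit Arguments.
Unset Strict Implicit.
Unset Printing Implicit Defensive.
Import Order.TTheory GRing.Theory Num.Theory.
Import numFieldNormedType.Exports.
Local Open Scope classical_set_scope.
Local Open Scope ring_scope.

(** * Matrix calculus and the matrix exponential *)

Section matrix_calculus.
Variable R : realType.

(** Solutions are not given: [solution] is a choice that falls back on the zero function, so
    existence has to be derived wherever [sol_segment] is evaluated. Apart from the orbit in (c), it
    is wanted only for Lipschitz histories between 0 and a multiple of a known bounded orbit, where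
    order bounds exclude blow-up. Uniform constants take the place of Arzela-Ascoli: F is bounded on
    bounded sets, so a bound on an orbit and a Lipschitz constant of its initial history give one
    Lipschitz constant for all later times. Along an ultrafilter the limits at all real times exist
    at once, with no diagonal extraction. The Lipschitz constant makes them uniform on a window of
    length r, continuity of F makes the derivatives converge uniformly there, and this gives
    convergence in X_L. That topology cannot be weakened to X, because the interior of the cone acts
    through absorption: subtracting a small multiple of a history bounded in X_L from an interior
    point stays in the cone. *)

Lemma mx_norm_leP m n (x : 'M[R]_(m, n)) (e : R) : 0 <= e ->
  (`|x| <= e) <-> (forall i j, `|x i j| <= e).
Proof.
move=> e0; rewrite {1}/Num.Def.normr/= mx_normrE; split=> [xe i j|xe].
  by apply: le_trans xe; exact: (le_bigmax _ _ (i, j)).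
by rewrite (bigmax_le _ e0).
Qed.

Lemma coord_le_norm m n (x : 'M[R]_(m, n)) i j : `|x i j| <= `|x|.
Proof. exact: ((mx_norm_leP x (normr_ge0 x)).1 (lexx _)). Qed.

Lemma cvg_mx (T : Type) (F : set_system T) (FF : Filter F) m n
    (f : T -> 'M[R]_(m, n)) (l : 'M[R]_(m, n)) :
  (forall i j, f x i j @[x --> F] --> l i j) -> f @ F --> l.
Proof.
move=> fl; apply/cvgrPdist_le => e e0.
have h : \forall x \near F, forall ij : 'I_m * 'I_n,
    `|l ij.1 ij.2 - f x ij.1 ij.2| <= e.
  apply: filter_forall => -[i j] /=.
  by move/cvgrPdist_le : (fl i j); apply.
near=> x; apply/mx_norm_leP; first exact: ltW.
suff H : forall ij : 'I_m * 'I_n, `|l ij.1 ij.2 - f x ij.1 ij.2| <= e.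
  by move=> i j; rewrite !mxE; exact: (H (i, j)).
by near: x.
Unshelve. all: by end_near. Qed.

Lemma is_derive_mxP m n (M : R -> 'M[R]_(m, n)) (M' : 'M[R]_(m, n)) (t : R) :
  is_derive t 1 M M' <->
  (forall i j, is_derive t 1 (fun u => M u i j) (M' i j)).
Proof.
split=> [dM i j|dM].
  have /derivable_mxP/(_ i j) dij := @ex_derive _ _ _ _ _ _ _ dM.
  apply: DeriveDef; first exact: dij.
  by rewrite -(@derive_val _ _ _ _ _ _ _ dM) derive_mx ?mxE//; exact: ex_derive.
have dvM : derivable M t 1 by apply/derivable_mxP => i j; exact: ex_derive.
by apply: DeriveDef => //; rewrite derive_mx//; apply/matrixP => i j; rewrite mxE derive_val.
Qed.

Lemma is_derive_mulmx m n p (M : R -> 'M[R]_(m, n)) (N : R -> 'M[R]_(n, p))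
    (M' : 'M[R]_(m, n)) (N' : 'M[R]_(n, p)) (t : R) :
  is_derive t 1 M M' -> is_derive t 1 N N' ->
  is_derive t 1 (fun u => M u *m N u) (M' *m N t + M t *m N').
Proof.
move=> /is_derive_mxP dM /is_derive_mxP dN; apply/is_derive_mxP => i j.
have -> : (fun u => (M u *m N u) i j) =
    \sum_k ((fun u => M u i k) * (fun u => N u k j)).
  by apply/funext => u; rewrite mxE fct_sumE.
apply: is_derive_eq.
rewrite !mxE -big_split /=; apply: eq_bigr => k _.
by rewrite addrC; congr (_ + _); exact: mulrC.
Qed.

End matrix_calculus.

Section matrix_exponential.
Variable R : realType.
Variable m : nat.
Implicit Types A : 'M[R]_m.

(** Coefficients of the power series in t of the entry (i, j) of A^p e^{tA}. The index p counts
    derivatives: [pseries_diffs] raises it by one. *)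
Let coef A p i j (k : nat) : R := (k`!%:R)^-1 * (A ^+ (k + p)) i j.

(** The maximum norm of matrices is not submultiplicative; the sum of m terms in a product costs the
    factor m in the constant. *)
Lemma expr_mx_bound A : exists2 K : R, 0 <= K & forall k i j, `|(A ^+ k) i j| <= K ^+ k.
Proof.
exists (m%:R * `|A|); first by rewrite mulr_ge0.
elim=> [|k IH] i j; first by rewrite !expr0 mxE; case: eqP; rewrite ?normr1 ?normr0.
rewrite exprS mxE; apply: le_trans (ler_norm_sum _ _ _) _.
apply: (@le_trans _ _ (\sum_(l < m) `|A| * (m%:R * `|A|) ^+ k)).
  by apply: ler_sum => l _; rewrite normrM ler_pM// coord_le_norm.
by rewrite sumr_const card_ord -[leLHS]mulr_natl mulrA -exprS.
Qed.

Lemma exprZ_mx A (t : R) k : (t *: A) ^+ k = t ^+ k *: A ^+ k.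
Proof.
elim: k => [|k IH]; first by rewrite !expr0 scale1r.
by rewrite !exprS IH -[LHS]/(_ *m _) -scalemxAl -scalemxAr scalerA.
Qed.

Let coef_cvg A p i j x : cvgn (pseries (coef A p i j) x).
Proof.
have [K K0 AK] := expr_mx_bound A.
apply: normed_cvg; rewrite /normed_series_of /=.
apply: (@series_le_cvg _ _ (fun k => K ^+ p * exp_coeff (K * `|x|) k)) => [k|k|k|] //=.
- by rewrite mulr_ge0 ?exprn_ge0// exp_coeff_ge0// mulr_ge0.
- rewrite /coef /exp_coeff /= !normrM normfV !normrX.
  rewrite [`|k`!%:R|]ger0_norm ?ler0n// exprMn.
  rewrite [X in X <= _](_ : _ = (`|(A ^+ (k + p)) i j|) * (`|x| ^+ k / k`!%:R)); last by ring.
  rewrite [X in _ <= X](_ : _ = K ^+ (k + p) * (`|x| ^+ k / k`!%:R)); last by rewrite exprD; ring.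
  by rewrite ler_wpM2r// mulr_ge0// exprn_ge0.
- exact: (@is_cvg_seriesZ _ (exp_coeff (K * `|x|)) (K ^+ p) (is_cvg_series_exp_coeff _)).
Qed.

Let coef_diffs A p i j : pseries_diffs (coef A p i j) = coef A p.+1 i j.
Proof.
apply/funext => k; rewrite /pseries_diffs /coef mulrA factS natrM.
by rewrite invfM mulrA divff ?pnatr_eq0// mul1r addSnnS.
Qed.

Lemma expmxE A t i j : expmx (t *: A) i j = limn (pseries (coef A 0 i j) t).
Proof.
rewrite /expmx; set s := series _.
have -> : limn s = \matrix_(i, j) limn (pseries (coef A 0 i j) t).
  apply/cvg_lim; first exact: norm_hausdorff.
  apply: cvg_mx => k l; rewrite mxE.
  rewrite [X in X @ _ --> _](_ : _ = pseries (coef A 0 k l) t); first exact: coef_cvg.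
  apply/funext => n; rewrite /s /pseries /series /= summxE.
  apply: eq_bigr => q _; rewrite exprZ_mx !mxE /coef addn0.
  by rewrite mulrCA mulrC.
by rewrite mxE.
Qed.

Lemma expmx_ge0 A (t : R) i j : 0 <= t -> (forall k l, 0 <= A k l) -> 0 <= expmx (t *: A) i j.
Proof.
move=> t0 A0; rewrite expmxE.
have Ak k : forall i j, 0 <= (A ^+ k) i j.
  elim: k => [|k IH] a b; first by rewrite expr0 mxE ler0n.
  by rewrite exprS mxE sumr_ge0// => l _; rewrite mulr_ge0.
apply: limr_ge; first exact: coef_cvg.
near=> n; rewrite /pseries/series/= sumr_ge0// => k _.
by rewrite mulr_ge0 ?exprn_ge0// mulr_ge0.
Unshelve. all: by end_near. Qed.

Lemma expmx0 : expmx (0 : 'M[R]_m) = 1%:M.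
Proof.
rewrite -(scale0r 0); apply/matrixP => i j; rewrite expmxE.
apply: cvg_lim; first exact: Rhausdorff.
apply: cvg_near_cst; near=> n.
have n0 : (0 < n)%N by near: n; exact: nbhs_infty_gt.
rewrite /pseries/series /= -(prednK n0) big_nat_recl//= big1 ?addr0 => [|k _].
  by rewrite /coef !expr0 mulr1 fact0 invr1 mul1r.
by rewrite exprS mul0r mulr0.
Unshelve. all: by end_near. Qed.

Let lim_coef1 A t i j : limn (pseries (coef A 1 i j) t) =
  \sum_k A i k * limn (pseries (coef A 0 k j) t).
Proof.
apply: cvg_lim; first exact: Rhausdorff.
rewrite [X in X @ _ --> _](_ : _ = fun n => \sum_k A i k * pseries (coef A 0 k j) t n).
  apply: cvg_big => [|k _]; [exact: add_continuous|apply: cvgM; first exact: cvg_cst].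
  exact: coef_cvg.
apply/funext => n; rewrite /pseries/series/=.
under [RHS]eq_bigr do rewrite mulr_sumr.
rewrite exchange_big; apply: eq_bigr => q _ /=.
rewrite /coef addn1 addn0 exprS mxE mulr_sumr mulr_suml; apply: eq_bigr => l _.
by rewrite !mulrA; congr (_ * _ * _); rewrite mulrC.
Qed.

Let lim_coef1r A t i j : limn (pseries (coef A 1 i j) t) =
  \sum_k limn (pseries (coef A 0 i k) t) * A k j.
Proof.
apply: cvg_lim; first exact: Rhausdorff.
rewrite [X in X @ _ --> _](_ : _ = fun n => \sum_k pseries (coef A 0 i k) t n * A k j).
  apply: cvg_big => [|k _]; [exact: add_continuous|apply: cvgM; last exact: cvg_cst].
  exact: coef_cvg.
apply/funext => n; rewrite /pseries/series/=.
under [RHS]eq_bigr do rewrite mulr_suml.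
rewrite exchange_big; apply: eq_bigr => q _ /=.
rewrite /coef addn1 addn0 exprSr mxE mulr_sumr mulr_suml; apply: eq_bigr => l _.
by rewrite !mulrA mulrAC.
Qed.

Let expmx_derive_entry A (t : R) i j :
  is_derive t 1 (fun u => expmx (u *: A) i j) (limn (pseries (coef A 1 i j) t)).
Proof.
have -> : (fun u => expmx (u *: A) i j) = (fun u => limn (pseries (coef A 0 i j) u)).
  by apply/funext => u; rewrite expmxE.
rewrite -coef_diffs.
(* Termwise differentiation at t asks for convergence of the series and of its first two formal
   derivatives at a point of larger modulus. *)
apply: (@pseries_snd_diffs _ _ (`|t| + 1)); rewrite ?coef_diffs.
- exact: coef_cvg.
- exact: coef_cvg.
- exact: coef_cvg.
by rewrite [ltRHS]ger0_norm ?ltrDl// addr_ge0.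
Qed.

Lemma is_derive_expmx A (t : R) :
  is_derive t 1 (fun u => expmx (u *: A)) (A *m expmx (t *: A)).
Proof.
apply/is_derive_mxP => i j.
rewrite (_ : (A *m _) i j = limn (pseries (coef A 1 i j) t)).
  exact: expmx_derive_entry.
by rewrite lim_coef1 mxE; apply: eq_bigr => k _; rewrite expmxE.
Qed.

(** Both products are the series of the powers A^{k+1}, split as A A^k on one side and as A^k A on
    the other. *)
Lemma expmx_comm A t : A *m expmx (t *: A) = expmx (t *: A) *m A.
Proof.
apply/matrixP => i j.
transitivity (limn (pseries (coef A 1 i j) t)).
  by rewrite lim_coef1 mxE; apply: eq_bigr => k _; rewrite expmxE.
by rewrite lim_coef1r mxE; apply: eq_bigr => k _; rewrite expmxE.
Qed.

Lemma is_derive_expmx_sub A (T t : R) :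
  is_derive t 1 (fun u => expmx ((T - u) *: A)) (- (expmx ((T - t) *: A) *m A)).
Proof.
apply/is_derive_mxP => i j; rewrite -expmx_comm.
have /is_derive_mxP/(_ i j) d1 := is_derive_expmx A (T - t).
have d2 : is_derive t 1 (fun u : R => T - u) (-1).
  by rewrite -sub0r; exact: (is_deriveB (is_derive_cst T t 1) (is_derive_id t 1)).
have := @is_derive1_comp _ (fun u => expmx (u *: A) i j) (fun u => T - u) t _ _ d1 d2.
rewrite mulrN1 => d.
rewrite (_ : (- (A *m _)) i j = - (A *m expmx ((T - t) *: A)) i j) //.
by rewrite [LHS]mxE.
Qed.

Lemma is_derive_cst_eq (f : R -> R) a b : a <= b ->
  (forall x, is_derive (x : R) 1 f 0) -> f a = f b.
Proof.
move=> ab df; apply/eqP; rewrite eq_sym -subr_eq0.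
have [|c _ ->] := @MVT_segment _ f (fun=> 0) a b ab (fun x _ => df x).
  apply: continuous_subspaceT => x.
  by apply: differentiable_continuous; apply/derivable1_diffP; exact: ex_derive.
by rewrite mul0r.
Qed.

(** The product e^{(s+t-u)A} e^{uA} has zero derivative in u, so its values at u = 0 and u = t
    agree. The sign of t orders these two endpoints. *)
Lemma expmxD A (s t : R) : 0 <= t -> expmx (s *: A) *m expmx (t *: A) = expmx ((s + t) *: A).
Proof.
move=> t0.
pose H (u : R) := expmx ((s + t - u) *: A) *m expmx (u *: A).
have dH (u : R) : is_derive u 1 H 0.
  have := is_derive_mulmx (is_derive_expmx_sub A (s + t) u) (is_derive_expmx A u).
  by rewrite mulNmx mulmxA addNr.
have : H 0 = H t.
  apply/matrixP => i j; apply: (@is_derive_cst_eq (fun u => H u i j)) => // u.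
  have /is_derive_mxP/(_ i j) := dH u.
  by rewrite mxE.
by rewrite /H subr0 scale0r expmx0 mulmx1 addrK => ->.
Qed.

(* [e^{tA} = e^{-ct} e^{t(A + cI)}], and [A + cI] has nonnegative entries for large [c]. *)
Lemma quasipositive_expmx_ge0 A (t : R) i j : quasipositive A -> 0 <= t -> 0 <= expmx (t *: A) i j.
Proof.
move=> qA t0; pose c := `|A|; pose C := A + c%:M.
have C0 k l : 0 <= C k l.
  rewrite !mxE; case: eqVneq => [->|kl]; last by rewrite mulr0n addr0 qA.
  have := coord_le_norm A l l; rewrite ler_norml mulr1n => /andP[+ _].
  by rewrite -subr_ge0 opprK.
(* H is constant and interpolates between e^{tA} at u = 0 and e^{-ct} e^{tC} at u = t; the series of
   the latter has nonnegative terms. *)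
pose H (u : R) := expmx ((t - u) *: A) *m (expR (- c * u) *: expmx (u *: C)).
have dH (u : R) : is_derive u 1 H 0.
  have : is_derive u 1 (fun u => expR (- c * u) *: expmx (u *: C))
      (expR (- c * u) *: (A *m expmx (u *: C))).
    apply/is_derive_mxP => k l.
    have /is_derive_mxP/(_ k l) d1 := is_derive_expmx C u.
    have d2 : is_derive u 1 (fun u => expR (- c * u)) (expR (- c * u) * (- c)).
      have d : is_derive u 1 (fun u : R => - c * u) (- c).
        by rewrite -[X in is_derive _ _ _ X]mulr1; exact: (is_deriveZ (- c) (is_derive_id u 1)).
      exact: (is_derive1_comp (is_derive_expR _) d).
    have -> : (fun u => (expR (- c * u) *: expmx (u *: C)) k l) =
       (fun u => expR (- c * u)) * (fun u => expmx (u *: C) k l).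
      by apply/funext => v; rewrite mxE.
    apply: is_derive_eq.
    rewrite /C mulmxDl mul_scalar_mx !mxE /GRing.scale/=.
    ring.
  move=> /(is_derive_mulmx (is_derive_expmx_sub A t u)).
  by rewrite mulNmx -!scalemxAr mulmxA addNr.
have : H 0 = H t.
  apply/matrixP => k l; apply: (@is_derive_cst_eq (fun u => H u k l)) => // u.
  have /is_derive_mxP/(_ k l) := dH u.
  by rewrite mxE.
rewrite /H subr0 mulr0 expR0 scale1r subrr !scale0r expmx0 mulmx1 mul1mx => ->.
by rewrite mxE mulr_ge0 ?expR_ge0// expmx_ge0.
Qed.

End matrix_exponential.

(** * Histories and the exponential cone *)

Section histories.
Variables (R : realType) (r : R) (m : nat).
Hypothesis hr : 0 < r.
Implicit Types (f g : hist r m) (y z : R -> 'cV[R]_m).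

Lemma hist_ext f g : (forall s, - r <= s <= 0 -> f s = g s) -> f = g.
Proof.
move=> fg; apply/val_inj/funext => s /=.
have [sI|sI] := boolP (s \in `[- r, 0]); last by rewrite !hist_out.
by apply: fg; rewrite in_itv in sI.
Qed.

Lemma hist_norm_le f (C : R) : 0 <= C ->
  (forall s, - r <= s <= 0 -> `|f s| <= C) -> `|f| <= C.
Proof.
by move=> C0 fC; apply: supnorm_le => // s /=; rewrite in_itv/=; exact: fC.
Qed.

Lemma hist_eval_le f s : `|f s| <= `|f|.
Proof.
have [sI|sI] := boolP (s \in `[- r, 0]); last by rewrite hist_out// normr0.
by apply: supnorm_ub => //; exact: hist_bounded.
Qed.

Lemma lip_lipschitz (f : lip r m) s t : - r <= s <= 0 -> - r <= t <= 0 ->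
  `|f s - f t| <= `|f| * `|s - t|.
Proof.
move=> sI tI; have [->|st] := eqVneq s t; first by rewrite !subrr !normr0 mulr0.
rewrite -ler_pdivrMr ?normr_gt0 ?subr_eq0//.
rewrite [leRHS]/Num.Def.normr/= /lip_norm.
apply: ler_wpDl => //; apply: ub_le_sup; last first.
  by exists (s, t) => //; split; rewrite ?in_itv.
have /lip_predP[M fM] := valP f.
exists M => _ [p [p1 p2 p12] <-]; apply: le_trans (fM p _); last by split.
by rewrite /slope normrZ normfV mulrC.
Qed.

Lemma lip_sup_le (f : lip r m) : `|lip_val f| <= `|f|.
Proof.
rewrite [leRHS]/Num.Def.normr/= /lip_norm lerDl.
apply: (@le_trans _ _ (`|f (- r) - f 0| / `|- r - 0|)); first by rewrite divr_ge0.
apply: ub_le_sup; last first.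
  by exists (- r, 0) => //; split; rewrite /= ?in_itv/= ?lexx ?oppr_le0 ?ltW// oppr_eq0 gt_eqF.
have /lip_predP[M fM] := valP f.
exists M => _ [p [p1 p2 p12] <-]; apply: le_trans (fM p _); last by split.
by rewrite /slope normrZ normfV mulrC.
Qed.

Lemma lip_norm_le (f : lip r m) (C D : R) : 0 <= D ->
  `|lip_val f| <= C ->
  (forall s t, - r <= s <= 0 -> - r <= t <= 0 -> `|f s - f t| <= D * `|s - t|) ->
  `|f| <= C + D.
Proof.
move=> D0 fC fD; rewrite [leLHS]/Num.Def.normr/= /lip_norm; apply: lerD => //.
set S := (X in sup X); have [->|/set0P S0] := eqVneq S set0; first by rewrite sup0.
apply: ge_sup => // _ [p [p1 p2 p12] <-].
rewrite ler_pdivrMr ?normr_gt0 ?subr_eq0//; apply: fD.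
  by move: p1; rewrite in_itv.
by move: p2; rewrite in_itv.
Qed.

(** Both the constant and the interval are explicit: orbits are functions on all of R that are
    controlled only from their initial history on, and limits need one constant for a whole
    family. *)
Definition lipschitz_itv (L a b : R) y : Prop :=
  forall s t, a <= s <= b -> a <= t <= b -> `|y s - y t| <= L * `|s - t|.

Lemma lipschitz_itvW L L' a b a' b' y : L <= L' -> a <= a' -> b' <= b ->
  lipschitz_itv L a b y -> lipschitz_itv L' a' b' y.
Proof.
move=> LL aa bb h s t /andP[s1 s2] /andP[t1 t2].
apply: (@le_trans _ _ (L * `|s - t|)).
  by apply: h; apply/andP; split; lra.
by rewrite ler_wpM2r.
Qed.

Lemma lipschitz_itv_continuous L a b y : lipschitz_itv L a b y ->
  {within `[a, b], continuous y}.
Proof.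
move=> hy; apply/subspace_continuousP => x /=; rewrite in_itv/= => xI.
apply/cvgrPdist_le => e e0; rewrite near_withinE.
have c0 : 0 < `|L| + 1 by rewrite ltr_wpDl.
apply/nbhs_ballP; exists ((`|L| + 1)^-1 * e); first by rewrite /= mulr_gt0// invr_gt0.
move=> t; rewrite -ball_normE /ball_ /= in_itv/= => /ltW xt tI.
apply: le_trans (hy _ _ xI tI) _.
apply: (@le_trans _ _ ((`|L| + 1) * `|x - t|)).
  by rewrite ler_wpM2r// (le_trans (ler_norm L))// lerDl.
by rewrite -ler_pdivlMl.
Qed.

Lemma lipschitz_itv_shift L a b y c : lipschitz_itv L a b y ->
  lipschitz_itv L (a - c) (b - c) (fun t => y (c + t)).
Proof.
move=> h s t /andP[s1 s2] /andP[t1 t2].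
have -> : s - t = (c + s) - (c + t) by ring.
by apply: h; apply/andP; split; lra.
Qed.

Lemma lipschitz_itv_lin L L' a b y z (c d : R) :
  lipschitz_itv L a b y -> lipschitz_itv L' a b z ->
  lipschitz_itv (`|c| * L + `|d| * L') a b (fun t => c *: y t + d *: z t).
Proof.
move=> hy hz s t sI tI.
have -> : c *: y s + d *: z s - (c *: y t + d *: z t) =
   c *: (y s - y t) + d *: (z s - z t) by rewrite !scalerBr opprD addrACA.
apply: le_trans (ler_normD _ _) _; rewrite mulrDl !normrZ -!mulrA.
by apply: lerD; rewrite ler_wpM2l//; [exact: hy|exact: hz].
Qed.

Lemma lipschitz_itvZ L (a b c : R) y :
  lipschitz_itv L a b y -> lipschitz_itv (`|c| * L) a b (fun t => c *: y t).
Proof.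
move=> hy s t sI tI; rewrite -scalerBr normrZ -mulrA.
by apply: ler_wpM2l => //; exact: hy.
Qed.

(** [segment] falls back on 0 when y is discontinuous on the window, so its values are known only
    together with a regularity bound that reaches back by r from t. *)
Lemma segmentE_val L (a b : R) y (t : R) : lipschitz_itv L a b y -> a + r <= t <= b ->
  hist_val (segment r y t) = (fun s : R => if s \in `[- r, 0] then y (t + s) else 0).
Proof.
move=> hy /andP[at_ tb]; rewrite /segment; apply: (@insubdK _ _ (hist r m)).
apply/hist_predP; split=> [|s /negbTE ->//].
have h : {within `[- r, 0], continuous (fun s : R => y (t + s))}.
  apply: (@lipschitz_itv_continuous L); move=> u v /andP[u1 u2] /andP[v1 v2].
  have -> : u - v = (t + u) - (t + v) by ring.
  by apply: hy; apply/andP; split; lra.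
apply: (subspace_eq_continuous _ h) => u; rewrite inE/= => uI.
by rewrite /from_subspace uI.
Qed.

Lemma segmentE L (a b : R) y (t s : R) : lipschitz_itv L a b y -> a + r <= t <= b ->
  - r <= s <= 0 -> segment r y t s = y (t + s).
Proof. by move=> hy tI sI; rewrite (segmentE_val hy tI) in_itv/= sI. Qed.

Lemma segment0 L (a b : R) y (t : R) : lipschitz_itv L a b y -> a + r <= t <= b ->
  segment r y t 0 = y t.
Proof.
by move=> hy tI; rewrite (segmentE hy tI) ?addr0// lexx andbT oppr_le0 ltW.
Qed.

(** Holds for every y, since the default value of [segment] has norm 0. *)
Lemma segment_norm_le y t (C : R) : 0 <= C ->
  (forall s, t - r <= s <= t -> `|y s| <= C) -> `|segment r y t| <= C.
Proof.
move=> C0 yC; rewrite /segment /insubd; case: insubP => /= [f _ fE|_]; last by rewrite normr0.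
apply: hist_norm_le => // s sI; rewrite fE in_itv/= sI; apply: yC.
by move: sI => /andP[? ?]; apply/andP; split; lra.
Qed.

Lemma segment_eq y z t : (forall s, t - r <= s <= t -> y s = z s) ->
  segment r y t = segment r z t.
Proof.
move=> yz; rewrite /segment; congr insubd; apply/funext => s.
case: ifPn => //; rewrite in_itv/= => /andP[? ?]; apply: yz.
by apply/andP; split; lra.
Qed.

Lemma segment_shift y c t : segment r (fun u => y (c + u)) t = segment r y (c + t).
Proof.
rewrite /segment; congr insubd; apply/funext => s.
by case: ifPn => // _; rewrite addrA.
Qed.

Lemma segment_lipschitz L (a b : R) y (t t' : R) : lipschitz_itv L a b y ->
  a + r <= t <= b -> a + r <= t' <= b ->
  `|segment r y t - segment r y t'| <= L * `|t - t'|.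
Proof.
move=> hy tI tI'.
have h s : - r <= s <= 0 ->
    `|(segment r y t - segment r y t') s| <= L * `|t - t'|.
  move=> sI; rewrite hist_addE (_ : (- segment r y t') s = - (segment r y t' s))//.
  rewrite !(segmentE hy)//; have -> : t - t' = (t + s) - (t' + s) by ring.
  by apply: hy; move: tI tI' sI => /andP[? ?] /andP[? ?] /andP[? ?];
    apply/andP; split; lra.
apply: hist_norm_le => //; apply: le_trans (h 0 _); first exact: normr_ge0.
by rewrite lexx andbT oppr_le0 ltW.
Qed.

Lemma segment_lin L L' a b y z (t c d : R) :
  lipschitz_itv L a b y -> lipschitz_itv L' a b z -> a + r <= t <= b ->
  segment r (fun u => c *: y u + d *: z u) t = c *: segment r y t + d *: segment r z t.
Proof.
move=> hy hz tI; apply: hist_ext => s sI.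
rewrite hist_addE !hist_scaleE (segmentE hy)// (segmentE hz)//.
by rewrite (segmentE (lipschitz_itv_lin c d hy hz)).
Qed.

Lemma segmentZ L (a b : R) y (t c : R) : lipschitz_itv L a b y -> a + r <= t <= b ->
  segment r (fun u => c *: y u) t = c *: segment r y t.
Proof.
move=> hy tI; apply: hist_ext => s sI.
by rewrite hist_scaleE (segmentE hy tI sI) (segmentE (lipschitz_itvZ c hy) tI sI).
Qed.

Lemma segment_in_lip L (a b : R) y (t : R) : lipschitz_itv L a b y -> a + r <= t <= b ->
  segment r y t \in lip_pred r m.
Proof.
move=> hy tI; apply/lip_predP; exists L => -[s s'] /= [sI s'I ss'].
rewrite /slope /= normrZ normfV mulrC ler_pdivrMr ?normr_gt0 ?subr_eq0//.
rewrite !in_itv/= in sI s'I; rewrite !(segmentE hy)//.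
have -> : s - s' = (t + s) - (t + s') by ring.
by apply: hy; move: tI sI s'I => /andP[? ?] /andP[? ?] /andP[? ?];
    apply/andP; split; lra.
Qed.

Definition lip_segment y t : lip r m := insubd 0 (segment r y t).

Lemma lip_segmentE L (a b : R) y (t : R) : lipschitz_itv L a b y -> a + r <= t <= b ->
  lip_val (lip_segment y t) = segment r y t.
Proof. by move=> hy tI; apply: insubdK; exact: segment_in_lip hy tI. Qed.

Lemma lip_segment_norm_le L a b y t (C : R) : lipschitz_itv L a b y -> a + r <= t <= b ->
  0 <= L -> 0 <= C -> (forall s, t - r <= s <= t -> `|y s| <= C) ->
  `|lip_segment y t| <= C + L.
Proof.
move=> hy tI L0 C0 yC; apply: lip_norm_le => //.
  by rewrite (lip_segmentE hy tI); exact: segment_norm_le.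
move=> s s' sI s'I; rewrite (lip_segmentE hy tI) !(segmentE hy)//.
have -> : s - s' = (t + s) - (t + s') by ring.
by apply: hy; move: tI sI s'I => /andP[? ?] /andP[? ?] /andP[? ?];
    apply/andP; split; lra.
Qed.

End histories.

Section cone.
Variables (R : realType) (r : R) (m : nat) (B : 'M[R]_m).
Hypothesis hr : 0 < r.
Implicit Types (f g : hist r m).
Local Notation K := (@Kcone R r m B).

Lemma Kcone0 : K 0.
Proof.
split=> [s _ i|s t _ _ _ i]; first by rewrite !mxE.
by rewrite (_ : (0 : hist r m) s = 0)// (_ : (0 : hist r m) t = 0)// mulmx0.
Qed.

Lemma KconeD f g : K f -> K g -> K (f + g).
Proof.
move=> [f1 f2] [g1 g2]; split=> [s sI i|s t rs st t0 i].
  by rewrite !mxE addr_ge0//; [have := f1 s sI i|have := g1 s sI i]; rewrite mxE.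
by rewrite !hist_addE mulmxDr !(mxE, lerD)//; [have := f2 s t rs st t0 i|have := g2 s t rs st t0 i]; rewrite mxE.
Qed.

Lemma KconeZ (l : R) f : 0 <= l -> K f -> K (l *: f).
Proof.
move=> l0 [f1 f2]; split=> [s sI i|s t rs st t0 i].
  by rewrite hist_scaleE !mxE mulr_ge0//; have := f1 s sI i; rewrite mxE.
rewrite !hist_scaleE -scalemxAr [X in X <= _]mxE [X in _ <= X]mxE ler_wpM2l//.
exact: f2.
Qed.

Lemma Kcone_closed f :
  (forall e : R, 0 < e -> exists2 g, K g & `|f - g| <= e) -> K f.
Proof.
move=> fK; have fg g s i : `|f s i 0 - g s i 0| <= `|f - g|.
  have -> : f s i 0 - g s i 0 = (f - g) s i 0.
    by rewrite hist_addE (_ : (- g) s = - (g s))// !mxE.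
  by apply: le_trans (coord_le_norm _ _ _) _; exact: hist_eval_le.
split=> [s sI i|s t rs st t0 i].
  rewrite mxE; apply/ler_addgt0Pr => e e0; have [g [g1 _] ge] := fK _ e0.
  have := g1 s sI i; rewrite mxE => gi; have := fg g s i; rewrite ler_norml => /andP[? _]; lra.
set E := expmx _; apply/ler_addgt0Pr => e e0.
(* Replacing f by a g within e/c costs at most e/c times the absolute row sum of E on the left and
   e/c on the right, in total e. *)
pose c := \sum_j `|E i j| + 1.
have c0 : 0 < c by rewrite ltr_wpDl// sumr_ge0.
have [|g [_ g2] ge] := fK (e / c); first by rewrite divr_gt0.
have := g2 s t rs st t0 i; rewrite -/E => gi.
have := fg g t i; rewrite ler_norml => /andP[ft _].
have : (E *m f s) i 0 - (E *m g s) i 0 <= \sum_j `|E i j| * (e / c).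
  rewrite !mxE -sumrB; apply: ler_sum => j _; rewrite -mulrBr.
  apply: le_trans (ler_norm _) _; rewrite normrM ler_wpM2l//.
  exact: le_trans (fg _ _ _) ge.
rewrite -mulr_suml; have : (\sum_j `|E i j|) * (e / c) + e / c = e.
  by rewrite -[X in _ + X]mul1r -mulrDl mulrCA divff ?mulr1// gt_eqF.
lra.
Qed.

Lemma Kcone_anti f : K f -> K (- f) -> f = 0.
Proof.
move=> [f1 _] [f2 _]; apply: hist_ext => s sI; apply/colP => i.
have sI' : s \in `[- r, 0] by rewrite in_itv.
have := f1 s sI' i; have := f2 s sI' i.
rewrite (_ : (- f) s = - (f s))// !mxE => h1 h2.
by apply/eqP; rewrite eq_le h2 andbT -oppr_ge0.
Qed.

(** The maximum norm is monotone on nonnegative vectors. This turns order bounds into a priori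
    bounds on solutions. *)
Lemma Kcone_normal f g : K f -> K (g - f) -> `|f| <= `|g|.
Proof.
move=> [f1 _] [f2 _]; apply: hist_norm_le => // s sI.
apply: (le_trans _ (hist_eval_le g s)).
apply/mx_norm_leP => // i j; rewrite (ord1 j); apply: le_trans (coord_le_norm _ i 0).
have sI' : s \in `[- r, 0] by rewrite in_itv.
have := f1 s sI' i; have := f2 s sI' i.
rewrite hist_addE (_ : (- f) s = - (f s))// !mxE subr_ge0 => h1 h2.
by rewrite !ger0_norm//; exact: le_trans h1.
Qed.

Lemma int_Kcone (x : lip r m) : interior (@Kcone_lip R r m B) x ->
  exists2 e : R, 0 < e & forall u : lip r m, `|u| <= e -> K (lip_val x + lip_val u).
Proof.
move=> /nbhs_ballP[e /= e0 eK]; exists (e / 2); first by rewrite divr_gt0.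
move=> u ue; have := eK (x + u); apply.
rewrite -ball_normE /ball_ /= opprD addNKr normrN; apply: le_lt_trans ue _; lra.
Qed.

Lemma Kcone_int (x : lip r m) (e : R) : 0 < e ->
  (forall u : lip r m, `|u| <= e -> K (lip_val x + lip_val u)) ->
  interior (@Kcone_lip R r m B) x.
Proof.
move=> e0 xK; apply/nbhs_ballP; exists e => // z.
rewrite -ball_normE /ball_ /= => xz; rewrite /Kcone_lip/=.
have -> : lip_val z = lip_val x + lip_val (z - x).
  by rewrite -[LHS]/(lip_val z) -{1}(subrK x z) addrC.
by apply: xK; rewrite distrC ltW.
Qed.

Lemma int_KconeW (x : lip r m) : interior (@Kcone_lip R r m B) x -> K (lip_val x).
Proof. exact: interior_subset. Qed.

Lemma int_KconeD (x z : lip r m) : interior (@Kcone_lip R r m B) x ->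
  K (lip_val z - lip_val x) -> interior (@Kcone_lip R r m B) z.
Proof.
move=> /int_Kcone[e e0 xe] zx; apply: (Kcone_int e0) => u ue.
have -> : lip_val z + lip_val u = (lip_val z - lip_val x) + (lip_val x + lip_val u).
  by rewrite addrA subrK.
by apply: KconeD => //; exact: xe.
Qed.

Lemma int_KconeZ (x : lip r m) (l : R) : 0 < l -> interior (@Kcone_lip R r m B) x ->
  interior (@Kcone_lip R r m B) (l *: x).
Proof.
move=> l0 /int_Kcone[e e0 xe]; apply: (@Kcone_int _ (l * e)); first by rewrite mulr_gt0.
move=> u ue; have -> : lip_val (l *: x) + lip_val u = l *: (lip_val x + lip_val (l^-1 *: u)).
  rewrite scalerDr; congr (_ + _).
  by rewrite -[RHS]/(lip_val (l *: (l^-1 *: u))) scalerA divff ?scale1r// gt_eqF.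
apply: KconeZ; first exact: ltW.
by apply: xe; rewrite normrZ gtr0_norm ?invr_gt0// ler_pdivrMl.
Qed.

(** One factor l serves a whole ball of X_L. Applied to all histories of a bounded orbit at once, it
    supplies the multiples with which comparisons start. *)
Lemma int_absorb (x : lip r m) (C : R) : interior (@Kcone_lip R r m B) x ->
  exists2 l : R, 0 < l & forall u : lip r m, `|u| <= C ->
    forall l' : R, 0 <= l' <= l -> K (lip_val x - l' *: lip_val u).
Proof.
move=> /int_Kcone[e e0 xe]; pose D := `|C| + 1.
have D0 : 0 < D by rewrite ltr_wpDl.
exists (e / D); first by rewrite divr_gt0.
move=> u uC l' /andP[l0 l'l]; rewrite -[X in _ - X]/(lip_val (l' *: u)).
apply: (xe (- (l' *: u))); rewrite normrN normrZ ger0_norm//.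
have uD : `|u| <= D by rewrite (le_trans uC)// (le_trans (ler_norm _))// lerDl.
apply: (@le_trans _ _ ((e / D) * D)); first by rewrite ler_pM.
by rewrite divfK ?gt_eqF.
Qed.

Lemma Bcone_ll0E f : Bcone_ll B 0 f <->
  exists2 x : lip r m, interior (@Kcone_lip R r m B) x & lip_val x = f.
Proof. by rewrite /Bcone_ll subr0. Qed.

End cone.

(** * Invariance of the cone *)

Section mean_value.
Variables (R : realType) (m : nat).
Implicit Types (y f : R -> 'cV[R]_m).

Lemma coord_within_continuous y (a b : R) i : {within `[a, b], continuous y} ->
  {within `[a, b], continuous (fun t => y t i 0)}.
Proof.
move=> cy x; apply: (@continuous_comp (subspace `[a, b]) _ _ y (fun M : 'cV[R]_m => M i 0)).
  exact: cy.
exact: coord_continuous.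
Qed.

Lemma MVT_coord y f (a b : R) i : a < b -> {within `[a, b], continuous y} ->
  (forall t : R, a < t < b -> is_derive t 1 y (f t)) ->
  exists2 c, a < c < b & y b i 0 - y a i 0 = f c i 0 * (b - a).
Proof.
move=> ab cy dy.
have [|c cab E] := @MVT _ (fun t => y t i 0) (fun t => f t i 0) a b ab _ (coord_within_continuous (i := i) cy).
  by move=> t; rewrite in_itv/= => /dy /is_derive_mxP; apply.
by exists c => //; rewrite in_itv/= in cab.
Qed.

(** A vector function has no common intermediate point, but each coordinate has its own, and the
    maximum norm looks at one coordinate at a time. *)
Lemma mean_value y f (a b : R) (c : 'cV[R]_m) (e : R) : a <= b ->
  {within `[a, b], continuous y} ->
  (forall t : R, a < t < b -> is_derive t 1 y (f t)) ->
  (forall t, a < t < b -> `|f t - c| <= e) ->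
  `|y b - y a - (b - a) *: c| <= e * (b - a).
Proof.
rewrite le_eqVlt => /predU1P[<- _ _ _|ab cy dy fc].
  by rewrite !subrr scale0r subr0 normr0 mulr0.
have e0 : 0 <= e.
  by apply: le_trans (fc ((a + b) / 2) _); [exact: normr_ge0|apply/andP; split; lra].
apply/mx_norm_leP; first by rewrite mulr_ge0// subr_ge0 ltW.
move=> i j; rewrite (ord1 j); have [t tab E] := MVT_coord i ab cy dy.
rewrite !mxE E mulrC -mulrBr normrM gtr0_norm ?subr_gt0// mulrC ler_wpM2r//; first by rewrite subr_ge0 ltW.
by apply: le_trans (fc _ tab); have := coord_le_norm (f t - c) i 0; rewrite !mxE.
Qed.

Lemma derive_lipschitz y f (L a b : R) : 0 <= L ->
  {within `[a, b], continuous y} ->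
  (forall t : R, a < t < b -> is_derive t 1 y (f t)) ->
  (forall t, a < t < b -> `|f t| <= L) -> lipschitz_itv L a b y.
Proof.
move=> L0 cy dy fL s t.
wlog st : s t / t <= s.
  move=> wl sI tI; have [ts|/ltW st] := leP t s; first exact: wl.
  by rewrite distrC [`|s - t|]distrC; exact: wl.
move=> /andP[as_ sb] /andP[at_ tb].
have sub : {subset `[t, s] <= `[a, b]}.
  by move=> u; rewrite !in_itv/= => /andP[? ?]; apply/andP; split; lra.
have := @mean_value y f t s 0 L st.
rewrite scaler0 subr0 [`|s - t|]ger0_norm ?subr_ge0//; apply.
- exact: (continuous_subspaceW _ cy).
- by move=> u /andP[? ?]; apply: dy; apply/andP; split; lra.
- by move=> u /andP[? ?]; rewrite subr0; apply: fL; apply/andP; split; lra.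
Qed.

End mean_value.

(** The supremum of the times up to which P holds is reached by the limit clause and, if it is below
    b, passed by the extension clause. *)
Lemma real_induction (R : realType) (P : R -> Prop) (a b : R) : P a ->
  (forall t, a <= t < b -> (forall u, a <= u <= t -> P u) ->
    exists2 h, 0 < h & forall u, t < u < t + h -> u <= b -> P u) ->
  (forall t, a < t <= b -> (forall u, a <= u < t -> P u) -> P t) ->
  forall t, a <= t <= b -> P t.
Proof.
move=> Pa Pext Plim t /andP[at_ tb].
pose A := [set s | a <= s <= b /\ forall u, a <= u <= s -> P u].
have Aa : A a.
  split; first by rewrite lexx (le_trans at_ tb).
  by move=> u /andP[? ?]; rewrite (_ : u = a)//; lra.
have Ab : has_ubound A by exists b => s [/andP[]].
have aS : a <= sup A by exact: ub_le_sup.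
have Sb : sup A <= b by apply: ge_sup; [exists a|move=> s [/andP[]]].
have PS u : a <= u < sup A -> P u.
  move=> /andP[au uS]; have [|s [sI As] us] := @sup_gt _ A u _ uS; first by exists a.
  by apply: As; rewrite au/= ltW.
have PS' : P (sup A).
  move: aS; rewrite le_eqVlt => /predU1P[<-//|aS].
  by apply: Plim => //; rewrite aS Sb.
have AS u : a <= u <= sup A -> P u.
  by move=> /andP[au]; rewrite le_eqVlt => /predU1P[->//|uS]; apply: PS; rewrite au.
move: Sb; rewrite le_eqVlt => /predU1P[Sb|Sb].
  by apply: AS; rewrite at_ Sb.
have [||h h0 Ph] := Pext (sup A); rewrite ?aS//.
have : A (Num.min b (sup A + h / 2)).
  split.
    by rewrite le_min ge_min lexx (le_trans at_ tb)/= andbT; lra.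
  move=> u /andP[au]; rewrite le_min => /andP[ub uh].
  have [uS|uS] := leP u (sup A); first by apply: AS; rewrite au.
  by apply: Ph => //; rewrite uS/=; lra.
move=> /(ub_le_sup Ab); rewrite ge_min => /orP[]; lra.
Qed.

Section exponential_cone.
Variables (R : realType) (r : R) (m : nat) (B : 'M[R]_m).
Hypothesis hr : 0 < r.
Hypothesis hB : quasipositive B.
Implicit Types (z d : R -> 'cV[R]_m).
Local Notation K := (@Kcone R r m B).

Lemma expmx_mul_le (u v : 'cV[R]_m) (t : R) : 0 <= t -> cvle u v ->
  cvle (expmx (t *: B) *m u) (expmx (t *: B) *m v).
Proof.
move=> t0 uv i; rewrite !mxE; apply: ler_sum => j _.
by rewrite ler_wpM2l// quasipositive_expmx_ge0.
Qed.

Lemma expmx_flow_le z d (s t : R) : s <= t -> {within `[s, t], continuous z} ->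
  (forall u : R, s < u < t -> is_derive u 1 z (d u)) ->
  (forall u, s < u < t -> cvle (B *m z u) (d u)) ->
  cvle (expmx ((t - s) *: B) *m z s) (z t).
Proof.
rewrite le_eqVlt => /predU1P[-> _ _ _|st cz dz Bd] i.
  by rewrite subrr scale0r expmx0 mul1mx.
pose g u := expmx ((t - u) *: B) *m z u.
have dg (u : R) : s < u < t ->
    is_derive u 1 g (expmx ((t - u) *: B) *m (d u - B *m z u)).
  move=> /dz; move=> /(is_derive_mulmx (is_derive_expmx_sub B t u)).
  by rewrite mulmxBr mulmxA mulNmx addrC.
have cg : {within `[s, t], continuous g}.
  apply/subspace_continuousP => x xI; apply: cvg_mx => k l; rewrite /g.
  rewrite [X in X @ _ --> _](_ : _ = fun u => \sum_j expmx ((t - u) *: B) k j * z u j l); last first.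
    by apply/funext => u; rewrite mxE.
  rewrite [X in _ --> X](_ : _ = \sum_j expmx ((t - x) *: B) k j * z x j l); last by rewrite mxE.
  apply: cvg_big => [|j _]; first exact: add_continuous.
  apply: cvgM.
    apply: cvg_within_filter.
    have /is_derive_mxP/(_ k j) h := is_derive_expmx_sub B t x.
    apply: (@differentiable_continuous _ _ _ x (fun u => expmx ((t - u) *: B) k j)).
    by apply/derivable1_diffP; exact: ex_derive.
  rewrite (ord1 l); have /subspace_continuousP := coord_within_continuous (i := j) cz.
  by apply.
have [c cst E] := MVT_coord i st cg dg.
rewrite -subr_ge0; move: E; rewrite {1}/g subrr scale0r expmx0 mul1mx => ->.
apply: mulr_ge0; last by rewrite subr_ge0 ltW.
have := @expmx_mul_le 0 (d c - B *m z c) (t - c); rewrite mulmx0 => /(_ _ _ i).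
rewrite (_ : (0 : 'cV[R]_m) i 0 = 0); last by rewrite mxE.
apply; first by case/andP: cst; lra.
by move=> j; have := Bd c cst j; rewrite !mxE subr_ge0.
Qed.

Lemma Kcone_extend z d (L a b : R) : lipschitz_itv L (a - r) b z ->
  (forall u : R, a < u < b -> is_derive u 1 z (d u)) ->
  (forall u, a < u < b -> cvle (B *m z u) (d u)) ->
  K (segment r z a) -> forall u, a <= u <= b -> K (segment r z u).
Proof.
have r0 := hr; move=> hz dz Bd [Ka1 Ka2] u /andP[au ub].
have ab : a <= b by exact: le_trans ub.
have seg (t s : R) : a <= t <= b -> - r <= s <= 0 -> segment r z t s = z (t + s).
  by move=> tI sI; rewrite (segmentE hz) ?subrK.
have past (s t : R) : a - r <= s -> s <= t -> t <= a ->
    cvle (expmx ((t - s) *: B) *m z s) (z t).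
  move=> h1 h2 h3; have := Ka2 (s - a) (t - a).
  rewrite !seg ?lexx//=; [|apply/andP; split; lra..].
  by rewrite opprB addrA subrK [a + _]addrC subrK [a + _]addrC subrK; apply; lra.
have fut (s t : R) : a <= s -> s <= t -> t <= b ->
    cvle (expmx ((t - s) *: B) *m z s) (z t).
  move=> h1 h2 h3; apply: (@expmx_flow_le z d) => //.
  - apply: (@lipschitz_itv_continuous _ _ L); apply: lipschitz_itvW hz => //; lra.
  - by move=> v /andP[? ?]; apply: dz; apply/andP; split; lra.
  - by move=> v /andP[? ?]; apply: Bd; apply/andP; split; lra.
have pos0 (s : R) : a - r <= s <= a -> cvle 0 (z s).
  move=> /andP[h1 h2]; have := Ka1 (s - a); rewrite seg ?lexx//=.
    by rewrite [a + _]addrC subrK; apply; rewrite in_itv/=; apply/andP; split; lra.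
  by apply/andP; split; lra.
have all (s t : R) : a - r <= s -> s <= t -> t <= b ->
    cvle (expmx ((t - s) *: B) *m z s) (z t).
  move=> h1 h2 h3; have [ta|ta] := leP t a; first exact: past.
  have [sa|sa] := leP a s; first exact: fut.
  (* A pair that straddles a is split there: the exponential is monotone, so it carries the
     inequality at a on to time t, where the semigroup law recombines the two factors. *)
  have -> : t - s = (t - a) + (a - s) by ring.
  rewrite -expmxD; last by lra.
  rewrite -mulmxA => i.
  apply: (le_trans (y := (expmx ((t - a) *: B) *m z a) i 0)).
    by apply: expmx_mul_le; [lra|apply: past; lra].
  by apply: fut; lra.
have pos (s : R) : a - r <= s <= b -> cvle 0 (z s).
  move=> /andP[h1 h2]; have [sa|sa] := leP s a; first by apply: pos0; rewrite h1.
  move=> i; apply: le_trans (fut a s (lexx _) _ h2 i); last by rewrite ltW.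
  have := @expmx_mul_le 0 (z a) (s - a); rewrite mulmx0; apply; first by lra.
  by apply: pos0; rewrite lexx andbT; lra.
split=> [s|s t rs st t0].
  rewrite in_itv/= => sI; rewrite seg ?au//; apply: pos.
  by case/andP: sI => ? ?; apply/andP; split; lra.
rewrite !seg ?au//; [|by apply/andP; split; lra..].
have -> : t - s = (u + t) - (u + s) by ring.
by apply: all; lra.
Qed.

(** The differential inequality is asked only for a short time after each t at which the history is
    in the cone, so it may itself be derived from (a). Real induction makes it global:
    [Kcone_extend] gives the extension clause, closedness of the cone the limit clause. *)
Lemma Kcone_invariance z d (L a b : R) : lipschitz_itv L (a - r) b z ->
  (forall u : R, a < u < b -> is_derive u 1 z (d u)) ->
  (forall t, a <= t < b -> K (segment r z t) ->
     exists2 h, 0 < h & forall u, t < u < t + h -> u < b -> cvle (B *m z u) (d u)) ->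
  K (segment r z a) -> forall u, a <= u <= b -> K (segment r z u).
Proof.
have r0 := hr; move=> hz dz Bd Ka; apply: real_induction => // [t /andP[at_ tb] Kt|t /andP[at_ tb] Kt].
  have tab : a <= t < b by rewrite at_.
  have tat : a <= t <= t by rewrite at_ lexx.
  have [h h0 hBd] := Bd t tab (Kt t tat).
  exists h => // u /andP[tu uh] ub.
  apply: (@Kcone_extend z d L t u); last by rewrite lexx ltW.
  - apply: lipschitz_itvW hz => //; lra.
  - by move=> v /andP[? ?]; apply: dz; apply/andP; split; lra.
  - by move=> v /andP[? ?]; apply: hBd; [apply/andP; split|]; lra.
  - by apply: Kt; rewrite at_ lexx.
apply: Kcone_closed => e e0.
(* Going back by h stays after a and moves the history by at most |L| h, hence by at most e. *)
pose h := Num.min ((t - a) / 2) (e / (`|L| + 1)).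
have L0 : 0 < `|L| + 1 by rewrite ltr_wpDl.
have h0 : 0 < h by rewrite lt_min !divr_gt0//; lra.
have h1 : h <= (t - a) / 2 by rewrite ge_min lexx.
have h2 : h <= e / (`|L| + 1) by rewrite ge_min lexx orbT.
exists (segment r z (t - h)); first by apply: Kt; apply/andP; split; lra.
apply: le_trans (segment_lipschitz hr hz _ _) _; try by apply/andP; split; lra.
have -> : t - (t - h) = h by ring.
rewrite gtr0_norm//; apply: (@le_trans _ _ ((`|L| + 1) * h)).
  by apply: ler_wpM2r; [exact: ltW|rewrite (le_trans (ler_norm L))// lerDl].
by rewrite -ler_pdivlMl// mulrC.
Qed.

End exponential_cone.

(** * Comparison of solutions *)

Section delay_system.
Variables (R : realType) (r : R) (m : nat) (Omega : metricType R).
Variables (theta : R -> Omega -> Omega) (F : Omega -> hist r m -> 'cV[R]_m).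
Hypothesis hr : 0 < r.
Hypothesis theta_flow : continuous_flow theta.
Hypothesis Fcont : continuous (fun p : Omega * hist r m => F p.1 p.2).
Implicit Types (y v : R -> 'cV[R]_m) (w : Omega).

Definition delay_rhs w y (t : R) : 'cV[R]_m := F (theta t w) (segment r y t).
Local Notation rhs := delay_rhs.

Lemma F_near w (phi : hist r m) (e : R) : 0 < e ->
  exists2 A : set Omega, nbhs w A & exists2 d : R, 0 < d &
    forall w' psi, A w' -> `|psi - phi| <= d -> `|F w' psi - F w phi| <= e.
Proof.
move=> e0; have /cvgrPdist_le/(_ _ e0) := @Fcont (w, phi).
move=> [[A D] /= [Aw /nbhs_ballP[d /= d0 dD]] AD].
exists A => //; exists (d / 2); first by rewrite divr_gt0.
move=> w' psi Aw' psid; rewrite distrC; apply: (AD (w', psi)); split => //=.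
by apply: dD; rewrite -ball_normE /ball_ /= distrC; lra.
Qed.

Lemma theta_near w (t : R) (A : set Omega) : nbhs (theta t w) A ->
  \forall u \near t & w' \near w, A (theta u w').
Proof. by case: theta_flow => cth _ _ Aw; exact: (cth (t, w) A Aw). Qed.

(** Continuity relative to [a, b], because y is controlled on [a - r, b] only. At the left endpoint
    it yields the right derivative required by [solves]. *)
Lemma rhs_near w y (L a b t e : R) : lipschitz_itv L (a - r) b y -> a <= t <= b -> 0 < e ->
  \forall u \near t, a <= u <= b -> `|rhs w y u - rhs w y t| <= e.
Proof.
move=> hy tI e0; have [A Aw [d d0 Ad]] := F_near (theta t w) (segment r y t) e0.
have c0 : 0 < `|L| + 1 by rewrite ltr_wpDl.
have near1 : \forall u \near t, A (theta u w).
  have [[U W] /= [Ut Ww] UW] := theta_near Aw.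
  by apply: filterS Ut => u Uu; apply: (UW (u, w)); split => //; exact: nbhs_singleton.
have near2 : \forall u \near t, `|t - u| <= d / (`|L| + 1).
  apply/nbhs_ballP; exists (d / (`|L| + 1)); first by rewrite /= divr_gt0.
  by move=> u; rewrite -ball_normE /ball_ /= => /ltW.
near=> u => uI; apply: Ad; first by near: u.
apply: le_trans (segment_lipschitz hr hy _ _) _; rewrite ?subrK// distrC.
apply: (@le_trans _ _ ((`|L| + 1) * `|t - u|)).
  by apply: ler_wpM2r => //; rewrite (le_trans (ler_norm L))// lerDl.
by rewrite -ler_pdivlMl// mulrC; near: u.
Unshelve. all: by end_near. Qed.

Hypothesis F_C1 : C1_snd F.

(** By continuity of the derivative in operator norm, near (w, phi) it stays within distance 1 of
    one bounded operator; the mean value inequality on the segment from psi2 to psi1 gives the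
    constant C + 1. *)
Lemma C1_locally_lipschitz w (phi : hist r m) :
  exists2 A : set Omega, nbhs w A & exists2 L : R, 0 <= L & exists2 d : R, 0 < d &
    forall w' psi1 psi2, A w' -> `|psi1 - phi| <= d -> `|psi2 - phi| <= d ->
    `|F w' psi1 - F w' psi2| <= L * `|psi1 - psi2|.
Proof.
case: F_C1 => dF cF.
have [[A D] /= [Aw /nbhs_ballP[d /= d0 dD]] AD] := cF w phi 1 ltr01.
have cd : continuous ('d (F w) phi) by exact: diff_continuous (dF w phi).
have [C C0 hC] : exists2 C, 0 <= C & forall h, `|'d (F w) phi h| <= C * `|h|.
  have /linear_bounded_continuous/linear_boundedP hb := cd.
  near +oo_R => C; exists C; first by near: C; exact: nbhs_pinfty_ge.
  by near: C.
exists A => //; exists (C + 1); first by rewrite addr_ge0.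
exists (d / 2); first by rewrite divr_gt0.
move=> w' psi1 psi2 Aw' h1 h2.
pose hh := psi1 - psi2; pose g (s : R) := F w' (psi2 + s *: hh).
have dg (s : R) : is_derive s 1 g ('d (F w') (psi2 + s *: hh) hh).
  have dd : derivable (F w') (psi2 + s *: hh) hh by exact: diff_derivable.
  have E : (fun k : R => k^-1 *: (g (k *: 1 + s) - g s)) =
     (fun k : R => k^-1 *: (F w' (k *: hh + (psi2 + s *: hh)) - F w' (psi2 + s *: hh))).
    apply/funext => k; rewrite /g; congr (_ *: (F w' _ - _)).
    by rewrite scalerDl [_ *: 1]mulr1 addrCA.
  apply: DeriveDef; first by move: dd; rewrite /derivable E.
  transitivity ('D_hh (F w') (psi2 + s *: hh)); last exact: deriveE (dF _ _).
  by rewrite /derive E.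
have cg : {within `[0, 1], continuous g}.
  apply: continuous_subspaceT => s; apply: differentiable_continuous.
  by apply/derivable1_diffP; exact: ex_derive.
have := @mean_value _ _ g (fun s => 'd (F w') (psi2 + s *: hh) hh) 0 1 0
  ((C + 1) * `|hh|) ler01 cg (fun s _ => dg s).
rewrite /g scale0r addr0 scale1r [psi2 + hh]addrC subrK scaler0 !subr0 mulr1; apply.
move=> s /andP[s0 s1]; rewrite subr0.
have psD : D (psi2 + s *: hh).
  apply: dD; rewrite -ball_normE /ball_ /= distrC.
  have -> : psi2 + s *: hh - phi = (1 - s) *: (psi2 - phi) + s *: (psi1 - phi).
    have -> : hh = (psi1 - phi) - (psi2 - phi) by rewrite opprB addrA subrK.
    by rewrite addrAC scalerBr scalerBl scale1r addrA [RHS]addrAC.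
  apply: le_lt_trans (ler_normD _ _) _; rewrite !normrZ !gtr0_norm ?subr_gt0//.
  have e1 : (1 - s) * `|psi2 - phi| <= (1 - s) * (d / 2).
    by apply: ler_wpM2l => //; rewrite subr_ge0 ltW.
  have e2 : s * `|psi1 - phi| <= s * (d / 2).
    by apply: ler_wpM2l; [exact: ltW|exact: h1].
  apply: le_lt_trans (lerD e1 e2) _.
  by rewrite -mulrDl subrK mul1r ltr_pdivrMr// ltr_pMr// ltr1n.
have := AD (w', psi2 + s *: hh) (conj Aw' psD) hh; rewrite /= mul1r => h3.
rewrite -[X in `|X|](subrK ('d (F w) phi hh)) mulrDl mul1r addrC.
apply: le_trans (ler_normD _ _) _; apply: lerD; [exact: hC|exact: h3].
Unshelve. all: by end_near. Qed.

Lemma C1_lipschitz_along w y (L a b : R) : lipschitz_itv L (a - r) b y ->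
  exists2 M : R, 0 <= M & exists2 d : R, 0 < d & forall (u : R) psi, a <= u <= b ->
    `|psi - segment r y u| <= d ->
    `|F (theta u w) psi - rhs w y u| <= M * `|psi - segment r y u|.
Proof.
move=> hy.
(* One index n is both the Lipschitz constant and, as 1/(n+1), the radius. Being monotone in n, the
   two local choices merge into a single n by compactness of [a, b], which gives a tube around the
   curve of histories of y. *)
pose P (n : nat) (u : R) := forall psi, `|psi - segment r y u| <= n.+1%:R^-1 ->
    `|F (theta u w) psi - rhs w y u| <= n%:R * `|psi - segment r y u|.
have /near_covering_withinP cov : near_covering [set u : R | u \in `[a, b]].
  exact/compact_near_coveringP/segment_compact.
have : \forall n \near \oo, [set u : R | u \in `[a, b]] `<=` P n.
  apply: cov => t /=; rewrite in_itv/= => tI.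
  have [A Aw [M M0 [d d0 AM]]] := C1_locally_lipschitz (theta t w) (segment r y t).
  have near1 : \forall u \near t, A (theta u w).
    have [[U W] /= [Ut Ww] UW] := theta_near Aw.
    by apply: filterS Ut => u Uu; apply: (UW (u, w)); split => //; exact: nbhs_singleton.
  have c0 : 0 < `|L| + 1 by rewrite ltr_wpDl.
  have near2 : \forall u \near t, `|t - u| <= d / 2 / (`|L| + 1).
    apply/nbhs_ballP; exists (d / 2 / (`|L| + 1)); first by rewrite /= !divr_gt0.
    by move=> u; rewrite -ball_normE /ball_ /= => /ltW.
  have near3 : \forall n \near \oo, M <= n%:R :> R by exact: nbhs_infty_ger.
  have near4 : \forall n \near \oo, n.+1%:R^-1 <= d / 2 :> R.
    have := @near_infty_natSinv_lt R (PosNum (divr_gt0 d0 (ltr0n _ 2))).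
    by apply: filterS => n /= /ltW.
  have hd : d / 2 <= d by rewrite ler_pdivrMr// ler_pMr// ler1n.
  near=> u n.
  have f1 : A (theta u w) by near: u.
  have f2 : `|t - u| <= d / 2 / (`|L| + 1) by near: u.
  have f3 : M <= n%:R by near: n.
  have f4 : n.+1%:R^-1 <= d / 2 by near: n.
  rewrite in_itv/= => uI psi psin.
  have sd : `|segment r y u - segment r y t| <= d / 2.
    apply: le_trans (segment_lipschitz hr hy _ _) _; rewrite ?subrK// distrC.
    apply: (@le_trans _ _ ((`|L| + 1) * `|t - u|)).
      by apply: ler_wpM2r => //; rewrite (le_trans (ler_norm L))// lerDl.
    by rewrite -ler_pdivlMl// mulrC.
  have pd : `|psi - segment r y u| <= d / 2.
    exact: le_trans psin f4.
  apply: (@le_trans _ _ (M * `|psi - segment r y u|)).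
    apply: AM => //; last exact: le_trans sd hd.
    rewrite -[psi](subrK (segment r y u)) -addrA (splitr d).
    by apply: le_trans (ler_normD _ _) _; exact: lerD.
  exact: ler_wpM2r.
move=> [n _ Pn]; exists n%:R => //; exists n.+1%:R^-1; first by rewrite invr_gt0.
by move=> u psi uI; apply: (Pn n) => //=; rewrite in_itv.
Unshelve. all: by end_near. Qed.

End delay_system.

Section comparison.
Variables (R : realType) (r : R) (m : nat) (Omega : metricType R).
Variables (theta : R -> Omega -> Omega) (F : Omega -> hist r m -> 'cV[R]_m).
Variable B : 'M[R]_m.
Hypothesis hr : 0 < r.
Hypothesis theta_flow : continuous_flow theta.
Hypothesis Fcont : continuous (fun p : Omega * hist r m => F p.1 p.2).
Hypothesis F_C1 : C1_snd F.
Hypothesis hB : quasipositive B.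
Hypothesis ha : forall w phi psi, Bcone_le B phi psi ->
    cvle (B *m (psi 0 - phi 0)) (F w psi - F w phi).
Implicit Types (y v : R -> 'cV[R]_m) (w : Omega).
Local Notation K := (@Kcone R r m B).
Local Notation rhs := (delay_rhs theta F).

(* Adding a small multiple of [bump] to a solution makes it a strict supersolution. *)
Let bump (k a : R) (t : R) : 'cV[R]_m := expR (k * (t - a)) *: const_mx 1.

Let bump_le (k a t b : R) : 0 <= k -> t <= b -> `|bump k a t| <= expR (k * (b - a)).
Proof.
move=> k0 tb; apply/mx_norm_leP; first exact: expR_ge0.
move=> i j; rewrite !mxE mulr1 ger0_norm ?expR_ge0// ler_expR.
by apply: ler_wpM2l => //; lra.
Qed.

Let is_derive_bump (k a t : R) : is_derive t 1 (bump k a) (k *: bump k a t).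
Proof.
apply/is_derive_mxP => i j.
have d : is_derive t 1 (fun u : R => k * (u - a)) k.
  rewrite -[X in is_derive _ _ _ X]mulr1 -[X in _ * X]subr0.
  exact: (is_deriveZ k (is_deriveB (is_derive_id t 1) (is_derive_cst a t 1))).
have := @is_derive1_comp _ expR (fun u : R => k * (u - a)) t _ _ (is_derive_expR (k * (t - a))) d.
rewrite [X in is_derive _ _ X _ -> _](_ : _ = (fun u => bump k a u i j)); last first.
  by apply/funext => u; rewrite !mxE mulr1.
by rewrite !mxE mulr1 mulrC.
Qed.

Let bump_lipschitz (k a c b : R) : 0 <= k -> lipschitz_itv (k * expR (k * (b - a))) c b (bump k a).
Proof.
move=> k0; apply: (@derive_lipschitz _ _ _ (fun t => k *: bump k a t)).
- by rewrite mulr_ge0 ?expR_ge0.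
- apply: continuous_subspaceT => s; apply: differentiable_continuous.
  by apply/derivable1_diffP; exact: (@ex_derive _ _ _ _ _ _ _ (is_derive_bump k a s)).
- by move=> t _; exact: is_derive_bump.
- move=> t /andP[_ tb]; rewrite normrZ ger0_norm//.
  by apply: ler_wpM2l => //; apply: bump_le => //; exact: ltW.
Qed.

(** As k dominates the absolute row sums of B, the nonnegative function [bump] satisfies z' = kz >=
    Bz. *)
Let bump_Kcone (k a : R) : 0 <= k -> (forall i, \sum_j `|B i j| <= k) -> K (segment r (bump k a) a).
Proof.
move=> k0 Bk.
have h : lipschitz_itv (k * expR (k * (a - a))) (a - r) a (bump k a).
  exact: bump_lipschitz.
have Bb t : cvle (B *m bump k a t) (k *: bump k a t).
  move=> i; rewrite -scalemxAr !mxE mulr1 mulrC.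
  apply: ler_wpM2r; first exact: expR_ge0.
  apply: le_trans (Bk i); apply: ler_sum => j _; rewrite mxE mulr1; exact: ler_norm.
have aI : a - r + r <= a <= a by rewrite subrK lexx.
split=> [s|s t rs st t0].
  rewrite in_itv/= => sI; rewrite (segmentE h)// => i; rewrite !mxE mulr1.
  exact: expR_ge0.
rewrite !(segmentE h)//; [|by apply/andP; split; lra..].
have -> : t - s = (a + t) - (a + s) by ring.
apply: (@expmx_flow_le _ _ _ hB _ (fun t => k *: bump k a t)).
- by lra.
- apply: (@lipschitz_itv_continuous _ _ (k * expR (k * (a - a)))).
  by apply: lipschitz_itvW h => //; lra.
- by move=> u _; exact: is_derive_bump.
- by move=> u _; exact: Bb.
Qed.

(* With [sigma = 1] this compares a subsolution [v] with a solution [y] above it, and with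
   [sigma = -1] a supersolution with a solution below it. *)
Let comparison (sigma : R) w y v (dv : R -> 'cV[R]_m) (Ly Lv a b : R) : sigma = 1 \/ sigma = -1 ->
  lipschitz_itv Ly (a - r) b y -> lipschitz_itv Lv (a - r) b v ->
  (forall t : R, a < t < b -> is_derive t 1 y (rhs w y t)) ->
  (forall t : R, a < t < b -> is_derive t 1 v (dv t)) ->
  (forall t, a < t < b -> cvle (sigma *: dv t) (sigma *: rhs w v t)) ->
  K (sigma *: (segment r y a - segment r v a)) ->
  forall t, a <= t <= b -> K (sigma *: (segment r y t - segment r v t)).
Proof.
move=> sg hy hv dy ddv sub Ka t tI.
have subI (s : R) : a <= s <= b -> a - r <= s <= b.
  by move=> /andP[as_ ->]; rewrite andbT lerBlDr (le_trans as_)// lerDl ltW.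
have s1 : `|sigma| = 1 by case: sg => ->; rewrite ?normrN normr1.
have nsig (x : 'cV[R]_m) : `|sigma *: x| = `|x| by rewrite normrZ s1 mul1r.
have s2 : sigma * sigma = 1 by case: sg => ->; rewrite ?mulrNN mulr1.
have [M M0 [d d0 hM]] := C1_lipschitz_along hr theta_flow F_C1 w hy.
pose beta : R := \sum_i \sum_j `|B i j|.
have beta0 : 0 <= beta by apply: sumr_ge0 => i _; exact: sumr_ge0.
have Bbeta i : \sum_j `|B i j| <= beta.
  rewrite /beta [leRHS](bigD1 i)//= lerDl; apply: sumr_ge0 => k _; exact: sumr_ge0.
(* M pays for the Lipschitz error of F, 1 leaves a strict margin, and beta puts the initial history
   of [bump] in the cone. *)
pose k : R := M + 1 + beta.
have k0 : 0 <= k by rewrite !addr_ge0.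
pose E : R := expR (k * (b - a)); have E0 : 0 < E by exact: expR_gt0.
pose z (e u : R) := sigma *: (y u - v u) + e *: bump k a u.
pose zz (e u : R) := sigma *: y u + 1 *: ((- sigma) *: v u + e *: bump k a u).
have zE e : z e = zz e.
  by apply/funext => u; rewrite /z /zz scale1r scalerBr scaleNr addrA.
have hb : lipschitz_itv (k * E) (a - r) b (bump k a) by exact: bump_lipschitz.
have hvb e := lipschitz_itv_lin (- sigma) e hv hb.
have hz e := lipschitz_itv_lin sigma 1 hy (hvb e).
have segz e u : a <= u <= b -> segment r (z e) u =
    sigma *: (segment r y u - segment r v u) + e *: segment r (bump k a) u.
  move=> uI; rewrite zE (segment_lin sigma 1 hy (hvb e)) ?subrK//.
  by rewrite (segment_lin (- sigma) e hv hb) ?subrK// scale1r addrA scaleNr -scalerBr.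
have bE u : a <= u <= b -> `|segment r (bump k a) u| <= expR (k * (u - a)).
  move=> /andP[au ub]; apply: segment_norm_le; first exact: expR_ge0.
  by move=> s /andP[_ su]; exact: bump_le.
have bEE u : a <= u <= b -> `|segment r (bump k a) u| <= E.
  move=> uI; apply: le_trans (bE u uI) _; rewrite ler_expR; apply: ler_wpM2l => //.
  by case/andP: uI; lra.
(* The condition e E <= d keeps the perturbed history of y in the tube where F is Lipschitz with
   constant M. *)
have main (e : R) : 0 < e -> e * E <= d -> forall u, a <= u <= b -> K (segment r (z e) u).
  move=> e0 eE.
  pose D (u : R) := sigma *: (rhs w y u - dv u) + (e * k) *: bump k a u.
  apply: (@Kcone_invariance _ _ _ B hr hB (z e) D _ a b).
  - by rewrite zE; exact: hz.
  - move=> u uI; rewrite /D -(scalerA e k).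
    have d1 := is_deriveZ sigma (is_deriveB (dy u uI) (ddv u uI)).
    exact: (is_deriveD d1 (is_deriveZ e (is_derive_bump k a u))).
  - move=> u /andP[au ub] Kz.
    have uI : a <= u <= b by rewrite au ltW.
    (* H bounds D - Bz from below, by the inequality on [dv]. Nothing is known about continuity of
       [dv], whereas H is continuous, so a margin e at time u keeps H nonnegative for a short
       time. *)
    pose H (s : R) := sigma *: (rhs w y s - rhs w v s) + (e * k) *: bump k a s - B *m z e s.
    have Hu i : e <= H u i 0.
      (* psi absorbs the bump into the history of y, so that (a) applies to psi and v. Returning
         from psi to y costs at most M e e^{k(u-a)}. *)
      pose psi := segment r y u + (sigma * e) *: segment r (bump k a) u.
      have psiv : segment r (z e) u = sigma *: (psi - segment r v u).
        by rewrite segz// /psi [X in _ = _ *: X]addrAC [RHS]scalerDr [X in _ = _ + X]scalerA mulrA s2 mul1r.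
      have z0 : z e u = sigma *: (psi 0 - segment r v u 0).
        transitivity ((segment r (z e) u) 0); last by rewrite psiv.
        by rewrite zE; symmetry; apply: (segment0 hr (hz e)); rewrite subrK.
      have := @hM u psi uI; rewrite /psi addrAC subrr add0r normrZ normrM s1 mul1r gtr0_norm//.
      rewrite -/psi => hpsi'.
      have {hpsi'} hpsi := hpsi' (le_trans (ler_wpM2l (ltW e0) (bEE u uI)) eE).
      have hF : cvle (B *m z e u) (sigma *: (F (theta u w) psi - rhs w v u)).
        rewrite z0 -scalemxAr; move: Kz; rewrite psiv.
        case: sg => sE; rewrite sE ?scale1r.
          by move=> /ha; apply.
        rewrite !scaleN1r !opprB -mulmxN opprB => /ha; apply.
      have := hF i; rewrite /H !mxE => hFi.
      have hFy : sigma * (F (theta u w) psi i 0 - rhs w y u i 0) <= M * (e * expR (k * (u - a))).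
        apply: le_trans (ler_norm _) _; rewrite normrM s1 mul1r.
        apply: (@le_trans _ _ (`|F (theta u w) psi - rhs w y u|)).
          by have := coord_le_norm (F (theta u w) psi - rhs w y u) i 0; rewrite !mxE.
        apply: le_trans hpsi _; apply: ler_wpM2l => //; apply: ler_wpM2l; first exact: ltW.
        exact: bE.
      have x1 : 1 <= expR (k * (u - a)).
        by rewrite -expR0 ler_expR mulr_ge0// subr_ge0.
      have : e * (k - M) * 1 <= e * (k - M) * expR (k * (u - a)).
        apply: ler_wpM2l => //; apply: mulr_ge0; first exact: ltW.
        by rewrite /k; lra.
      have : e * 1 <= e * (k - M) by apply: ler_wpM2l; [exact: ltW|rewrite /k; lra].
      move: hFi hFy; rewrite !mulrBr mulrBl !mulr1.
      lra.
    have Hnear : \forall s \near u, a <= s <= b -> `|H s - H u| <= e.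
      have e4 : 0 < e / 4 by rewrite divr_gt0.
      have n1 := rhs_near hr theta_flow Fcont w hy uI e4.
      have n2 := rhs_near hr theta_flow Fcont w hv uI e4.
      pose c1 : R := k * E * (e * k) + 1.
      have c10 : 0 < c1 by rewrite ltr_wpDl// !mulr_ge0// ltW.
      have n3 : \forall s \near u, `|s - u| <= e / 4 / c1.
        apply/nbhs_ballP; exists (e / 4 / c1); first by rewrite /= !divr_gt0.
        by move=> s; rewrite -ball_normE /ball_ /= distrC => /ltW.
      pose c2 : R := beta * `|(`|sigma| * Ly + `|1| * (`|- sigma| * Lv + `|e| * (k * E)))| + 1.
      have c20 : 0 < c2 by rewrite ltr_wpDl// mulr_ge0.
      have n4 : \forall s \near u, `|s - u| <= e / 4 / c2.
        apply/nbhs_ballP; exists (e / 4 / c2); first by rewrite /= !divr_gt0.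
        by move=> s; rewrite -ball_normE /ball_ /= distrC => /ltW.
      near=> s => sI.
      have sI' := subI s sI; have uI' := subI u uI.
      have b1 : `|rhs w y s - rhs w y u| <= e / 4 by move: sI; near: s.
      have b2 : `|rhs w v s - rhs w v u| <= e / 4 by move: sI; near: s.
      have b3 : `|bump k a s - bump k a u| * (e * k) <= e / 4.
        apply: le_trans (_ : _ <= k * E * `|s - u| * (e * k)) _.
          by apply: ler_wpM2r; [rewrite mulr_ge0// ltW|exact: hb].
        rewrite mulrAC; apply: (@le_trans _ _ (c1 * `|s - u|)).
          by apply: ler_wpM2r => //; rewrite /c1 lerDl.
        by rewrite -ler_pdivlMl// mulrC; near: s.
      have b4 : `|B *m z e s - B *m z e u| <= e / 4.
        have hzz : `|z e s - z e u| <= `|(`|sigma| * Ly + `|1| * (`|- sigma| * Lv + `|e| * (k * E)))| * `|s - u|.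
          apply: le_trans (_ : _ <= (`|sigma| * Ly + `|1| * (`|- sigma| * Lv + `|e| * (k * E))) * `|s - u|) _.
            by rewrite zE; exact: hz.
          by apply: ler_wpM2r => //; exact: ler_norm.
        rewrite -mulmxBr; apply/mx_norm_leP; first exact: ltW.
        move=> i j; rewrite mxE; apply: le_trans (ler_norm_sum _ _ _) _.
        apply: (@le_trans _ _ (\sum_l `|B i l| * `|z e s - z e u|)).
          by apply: ler_sum => l _; rewrite normrM; apply: ler_wpM2l => //; exact: coord_le_norm.
        rewrite -mulr_suml; apply: (@le_trans _ _ (c2 * `|s - u|)).
          apply: (@le_trans _ _ (beta * `|z e s - z e u|)); first by apply: ler_wpM2r.
          apply: (@le_trans _ _ (beta * (`|(`|sigma| * Ly + `|1| * (`|- sigma| * Lv + `|e| * (k * E)))| * `|s - u|))).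
            by apply: ler_wpM2l.
          by rewrite mulrA; apply: ler_wpM2r => //; rewrite /c2 lerDl.
        by rewrite -ler_pdivlMl// mulrC; near: s.
      have -> : H s - H u = sigma *: (rhs w y s - rhs w y u) - sigma *: (rhs w v s - rhs w v u)
           + (e * k) *: (bump k a s - bump k a u) - (B *m z e s - B *m z e u).
        rewrite /H; move: (rhs w y s) (rhs w v s) (B *m z e s) (bump k a s).
        move: (rhs w y u) (rhs w v u) (B *m z e u) (bump k a u).
        by clear=> *; apply/matrixP => i j; rewrite !mxE; ring.
      apply: le_trans (ler_normB _ _) _; apply: le_trans (lerD (ler_normD _ _) (lexx _)) _.
      apply: le_trans (lerD (lerD (ler_normB _ _) (lexx _)) (lexx _)) _.
      have -> : `|(e * k) *: (bump k a s - bump k a u)| = `|bump k a s - bump k a u| * (e * k).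
        by rewrite normrZ mulrC ger0_norm// mulr_ge0// ltW.
      rewrite !nsig; clear -b1 b2 b3 b4; lra.
    have /nbhs_ballP[h /= h0 hH] := Hnear.
    exists h => // s /andP[us sh] sb i.
    have sI : a <= s <= b by rewrite (le_trans au (ltW us)) ltW.
    have sI2 : a < s < b by rewrite (le_lt_trans au us).
    have : `|H s - H u| <= e.
      by apply: hH => //; rewrite -ball_normE /ball_ /= distrC gtr0_norm ?subr_gt0// ltrBlDl.
    move=> Hsu; have := le_trans (coord_le_norm (H s - H u) i 0) Hsu.
    have := Hu i; rewrite [X in `|X|]mxE [X in `|_ + X|]mxE ler_norml => h1 /andP[h2 _].
    have := sub s sI2 i; move: h1 h2; rewrite /D /H.
    move: (rhs w y s) (rhs w v s) (dv s) (B *m z e s) (bump k a s) (H u) => X1 X2 X3 X4 X5 X6.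
    clear; rewrite !mxE !mulrBr; lra.
  - rewrite segz ?lexx//=; last by case/andP: tI => ? ?; lra.
    apply: KconeD => //; apply: KconeZ; first exact: ltW.
    apply: bump_Kcone => // i; apply: le_trans (Bbeta i) _; rewrite /k; lra.
apply: Kcone_closed => e e0.
pose e' : R := Num.min (d / E) (e / E).
have e'0 : 0 < e' by rewrite lt_min !divr_gt0.
exists (segment r (z e') t).
  apply: main => //; rewrite -ler_pdivlMr// /e' ge_min lexx//.
rewrite segz// opprD addNKr normrN normrZ gtr0_norm//.
apply: (@le_trans _ _ (e' * E)); first by apply: ler_wpM2l; [exact: ltW|exact: bEE].
by rewrite -ler_pdivlMr// /e' ge_min lexx orbT.
Unshelve. all: by end_near. Qed.

Lemma subsolution_le w y v (dv : R -> 'cV[R]_m) (Ly Lv a b : R) :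
  lipschitz_itv Ly (a - r) b y -> lipschitz_itv Lv (a - r) b v ->
  (forall t : R, a < t < b -> is_derive t 1 y (rhs w y t)) ->
  (forall t : R, a < t < b -> is_derive t 1 v (dv t)) ->
  (forall t, a < t < b -> cvle (dv t) (rhs w v t)) ->
  Bcone_le B (segment r v a) (segment r y a) ->
  forall t, a <= t <= b -> Bcone_le B (segment r v t) (segment r y t).
Proof.
move=> hy hv dy ddv sub Ka t tI; rewrite /Bcone_le -[X in K X]scale1r.
apply: (comparison (or_introl erefl) hy hv dy ddv _ _ tI).
  by move=> u /sub; rewrite !scale1r.
by rewrite scale1r.
Qed.

Lemma supersolution_ge w y v (dv : R -> 'cV[R]_m) (Ly Lv a b : R) :
  lipschitz_itv Ly (a - r) b y -> lipschitz_itv Lv (a - r) b v ->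
  (forall t : R, a < t < b -> is_derive t 1 y (rhs w y t)) ->
  (forall t : R, a < t < b -> is_derive t 1 v (dv t)) ->
  (forall t, a < t < b -> cvle (rhs w v t) (dv t)) ->
  Bcone_le B (segment r y a) (segment r v a) ->
  forall t, a <= t <= b -> Bcone_le B (segment r y t) (segment r v t).
Proof.
move=> hy hv dy ddv sup Ka t tI; rewrite /Bcone_le -opprB -scaleN1r.
apply: (comparison (or_intror erefl) hy hv dy ddv _ _ tI).
  by move=> u /sup h i; rewrite [leLHS]mxE [leRHS]mxE !mulN1r lerN2; exact: h.
by rewrite scaleN1r opprB.
Qed.

Lemma solution_unique w y v (Ly Lv a b : R) :
  lipschitz_itv Ly (a - r) b y -> lipschitz_itv Lv (a - r) b v ->
  (forall t : R, a < t < b -> is_derive t 1 y (rhs w y t)) ->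
  (forall t : R, a < t < b -> is_derive t 1 v (rhs w v t)) ->
  segment r y a = segment r v a ->
  forall t, a <= t <= b -> segment r y t = segment r v t.
Proof.
move=> hy hv dy ddv ya t tI; apply/eqP; rewrite -subr_eq0; apply/eqP.
apply: (@Kcone_anti _ _ _ B).
  apply: (subsolution_le hy hv dy ddv _ _ tI); first by move=> u _ i.
  by rewrite /Bcone_le ya subrr; exact: Kcone0.
rewrite opprB; apply: (supersolution_ge hy hv dy ddv _ _ tI); first by move=> u _ i.
by rewrite /Bcone_le ya subrr; exact: Kcone0.
Qed.

End comparison.

(** * Limits of solutions along ultrafilters *)

Section ultrafilters.

Lemma compact_ultra_cvg (I : Type) (U : set_system I) (UU : UltraFilter U)
    (T : topologicalType) (f : I -> T) (A : set T) :
  compact A -> (\forall i \near U, A (f i)) -> exists2 l, A l & f @ U --> l.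
Proof.
move=> cA fA; have PF : ProperFilter (f @ U) by exact: fmap_proper_filter.
have [l [Al cl]] := cA (f @ U) PF fA.
exists l => // V Vl; have [//|UV] := in_ultra_setVsetC (f @^-1` V) UU.
have [x [/= nVx Vx]] := cl (~` V) V UV Vl.
by case: nVx.
Qed.

(** If a neighbourhood V were missed, the trace of G on the indices outside the preimage of V would
    be proper, and an ultrafilter above it would contradict the assumption. This turns uniqueness of
    ultrafilter limits into convergence. *)
Lemma cvg_ultrafilters (I : Type) (G : set_system I) (GG : Filter G)
    (T : topologicalType) (f : I -> T) (l : T) :
  (forall U, UltraFilter U -> G `<=` U -> f @ U --> l) -> f @ G --> l.
Proof.
move=> h V Vl; apply: contrapT => nGV.
pose W := within (~` (f @^-1` V)) G.
have PW : ProperFilter W.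
  split; last exact: within_filter.
  move=> W0; apply: nGV; rewrite /fmap /=; move: W0; rewrite /W /within /=.
  by apply: filterS => i; apply: contra_notP.
have [U [UU WU]] := ultraFilterLemma PW.
have GU : G `<=` U by move=> A GA; apply: WU; apply: filterS GA.
have h1 : U (f @^-1` V) by exact: h.
have h2 : U (~` (f @^-1` V)) by apply: WU; exact: withinT.
by have [i [? ?]] := filter_ex (filterI h1 h2).
Qed.

Lemma cluster_ultra (I : Type) (G : set_system I) (GG : ProperFilter G)
    (T : topologicalType) (f : I -> T) (l : T) : cluster (f @ G) l ->
  exists U, [/\ UltraFilter U, G `<=` U & f @ U --> l].
Proof.
move=> cl; pose W := filter_from [set AV | G AV.1 /\ nbhs l AV.2]
  (fun AV : set I * set T => AV.1 `&` f @^-1` AV.2).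
have PW : ProperFilter W.
  apply: filter_from_proper; last first.
    move=> [A V] /= [GA Vl].
    have [_ [[i Ai <-] Vi]] : (f @` A) `&` V !=set0.
      have GfA : G (f @^-1` (f @` A)) by apply: filterS GA => x Ax; exists x.
      exact: cl GfA Vl.
    by exists i.
  apply: filter_from_filter; first by exists (setT, setT); split; exact: filterT.
  move=> [A1 V1] [A2 V2] /= [GA1 V1l] [GA2 V2l].
  by exists (A1 `&` A2, V1 `&` V2); [split; exact: filterI|move=> i /= [[? ?] [? ?]]].
have [U [UU WU]] := ultraFilterLemma PW.
exists U; split => //.
  move=> A GA; apply: WU; exists (A, setT); first by split => //; exact: filterT.
  by move=> i [].
move=> V Vl; apply: WU; exists (setT, V); first by split => //; exact: filterT.
by move=> i [].
Qed.

Lemma bounded_ultra_cvg (R : realType) (m : nat) (I : Type) (U : set_system I)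
    (UU : UltraFilter U) (f : I -> 'cV[R]_m) (C : R) :
  (\forall i \near U, `|f i| <= C) -> exists l : 'cV[R]_m, f @ U --> l.
Proof.
move=> fC.
have h (j : 'I_m) : exists l : R, f i j 0 @[i --> U] --> l.
  have [|l _ fl] := @compact_ultra_cvg I U UU R (fun i => f i j 0) `[- C, C] (@segment_compact _ _ _).
    apply: filterS fC => i fC; rewrite /= in_itv/= -ler_norml.
    exact: le_trans (coord_le_norm _ _ _) fC.
  by exists l.
have [l hl] := choice h.
exists (\col_j l j); apply: cvg_mx => i j; rewrite (ord1 j) mxE; exact: hl.
Qed.

End ultrafilters.

Section limits_of_solutions.
Variables (R : realType) (r : R) (m : nat) (Omega : metricType R).
Variables (theta : R -> Omega -> Omega) (F : Omega -> hist r m -> 'cV[R]_m).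
Hypothesis hr : 0 < r.
Hypothesis theta_flow : continuous_flow theta.
Hypothesis Fcont : continuous (fun p : Omega * hist r m => F p.1 p.2).
Implicit Types (y v : R -> 'cV[R]_m) (w : Omega).
Local Notation rhs := (delay_rhs theta F).

Lemma cvg_norm_le (I : Type) (U : set_system I) (PU : ProperFilter U)
    (f : I -> 'cV[R]_m) (l : 'cV[R]_m) (e : R) :
  f @ U --> l -> (\forall i \near U, `|f i| <= e) -> `|l| <= e.
Proof.
move=> fl fe; apply/ler_addgt0Pl => d d0.
have /cvgrPdist_le/(_ _ d0) h := fl.
near U => i.
rewrite -(subrK (f i) l); apply: le_trans (ler_normD _ _) _.
by apply: lerD; near: i.
Unshelve. all: by end_near. Qed.

(* The parameter [d] absorbs the step size of Euler polygons. For exact solutions [d = 0]. *)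
Definition approx_solution w (d a b : R) y : Prop :=
  forall (s s' e : R) c, a <= s -> s <= s' -> s' <= b ->
    (forall u, a <= u -> s - d <= u <= s' -> `|rhs w y u - c| <= e) ->
    `|y s' - y s - (s' - s) *: c| <= e * (s' - s).

Lemma solution_approx w y (L a b d : R) : 0 <= d -> lipschitz_itv L (a - r) b y ->
  (forall t : R, a < t < b -> is_derive t 1 y (rhs w y t)) ->
  approx_solution w d a b y.
Proof.
have r0 := hr; move=> d0 hy dy s s' e c as_ ss' s'b h.
apply: (@mean_value _ _ _ (rhs w y)) => //.
- apply: (@lipschitz_itv_continuous _ _ L); apply: lipschitz_itvW hy => //; lra.
- by move=> u /andP[? ?]; apply: dy; apply/andP; split; lra.
- by move=> u /andP[? ?]; apply: h; [lra|apply/andP; split; lra].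
Qed.

Section along_filter.
Variables (I : Type) (U : set_system I).
Hypothesis PU : ProperFilter U.
Variables (ws : I -> Omega) (w : Omega) (ys : I -> R -> 'cV[R]_m) (y : R -> 'cV[R]_m).
Variables (L a b : R).
Hypothesis L0 : 0 <= L.
Hypothesis wsw : ws @ U --> w.
Hypothesis hys : \forall i \near U, lipschitz_itv L (a - r) b (ys i).
Hypothesis ysy : forall t, a - r <= t <= b -> ys i t @[i --> U] --> y t.

Lemma limit_lipschitz : lipschitz_itv L (a - r) b y.
Proof.
move=> s t sI tI; apply: (@cvg_norm_le _ _ PU (fun i => ys i s - ys i t)).
  by apply: cvgB; exact: ysy.
by apply: filterS hys => i; exact.
Qed.

(** For an equi-Lipschitz family, pointwise convergence is uniform on the compact window
    [t - r, t]. *)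
Lemma limit_segment (t e : R) : a <= t <= b -> 0 < e ->
  \forall i \near U, `|segment r (ys i) t - segment r y t| <= e.
Proof.
move=> tI e0; have hy := limit_lipschitz.
have /near_covering_withinP cov : near_covering [set u : R | u \in `[t - r, t]].
  exact/compact_near_coveringP/segment_compact.
have c0 : 0 < L + 1 by rewrite ltr_wpDl.
have e3 : 0 < e / 3 by rewrite divr_gt0.
have sub (u : R) : u \in `[t - r, t] -> a - r <= u <= b.
  rewrite in_itv/= => /andP[? ?]; case/andP: tI => ? ?; apply/andP; split; lra.
have h : \forall i \near U, [set u : R | u \in `[t - r, t]] `<=` (fun u => `|ys i u - y u| <= e).
  apply: cov => u /= uI.
  have n1 : \forall s \near u, `|u - s| <= e / 3 / (L + 1).
    apply/nbhs_ballP; exists (e / 3 / (L + 1)); first by rewrite /= !divr_gt0.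
    by move=> s; rewrite -ball_normE /ball_ /= => /ltW.
  have n2 : \forall i \near U, `|y u - ys i u| <= e / 3.
    by have /cvgrPdist_le := ysy (sub _ uI); apply.
  near=> s i.
  have f1 : `|u - s| <= e / 3 / (L + 1) by near: s.
  have f2 : `|y u - ys i u| <= e / 3 by near: i.
  have f3 : lipschitz_itv L (a - r) b (ys i) by near: i.
  move=> /= sI.
  have Lus : L * `|u - s| <= e / 3.
    apply: (@le_trans _ _ ((L + 1) * `|u - s|)); first by apply: ler_wpM2r => //; rewrite lerDl.
    by rewrite -ler_pdivlMl// mulrC.
  have -> : ys i s - y s = (ys i s - ys i u) - (y u - ys i u) + (y u - y s).
    by apply/matrixP => k l; rewrite !mxE; ring.
  have h1 : `|ys i s - ys i u| <= e / 3.
    by rewrite distrC; apply: le_trans (f3 _ _ (sub _ uI) (sub _ sI)) Lus.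
  have h2 : `|y u - y s| <= e / 3 by apply: le_trans (hy _ _ (sub _ uI) (sub _ sI)) Lus.
  apply: le_trans (ler_normD _ _) _; apply: le_trans (lerD (ler_normB _ _) (lexx _)) _.
  by rewrite [leRHS](_ : _ = e / 3 + e / 3 + e / 3) ?lerD//; field.
apply: filterS2 h hys => i hi hyi; apply: hist_norm_le; first exact: ltW.
move=> s sI; rewrite hist_addE (_ : (- segment r y t) s = - (segment r y t s))//.
rewrite (segmentE hyi) ?subrK// (segmentE hy) ?subrK//; apply: hi.
by rewrite /= in_itv/=; case/andP: sI => ? ?; apply/andP; split; lra.
Unshelve. all: by end_near. Qed.

(** Joint in s and i: control on a whole neighbourhood of t, uniform in the index, is what both the
    derivative of the limit and the uniform convergence of derivatives rest on. *)
Lemma limit_rhs (t e : R) : a <= t <= b -> 0 < e ->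
  \forall s \near t & i \near U, a <= s <= b ->
    `|rhs (ws i) (ys i) s - rhs w y t| <= e.
Proof.
move=> tI e0; have [A Aw [d d0 Ad]] := F_near Fcont (theta t w) (segment r y t) e0.
have d2 : 0 < d / 2 by rewrite divr_gt0.
have c0 : 0 < L + 1 by rewrite ltr_wpDl.
have n0 := limit_segment tI d2.
have [[V W] /= [Vt Ww] VW] := theta_near theta_flow Aw.
have n1 : \forall i \near U, W (ws i) by exact: wsw.
have n2 : \forall s \near t, `|t - s| <= d / 2 / (L + 1).
  apply/nbhs_ballP; exists (d / 2 / (L + 1)); first by rewrite /= !divr_gt0.
  by move=> s; rewrite -ball_normE /ball_ /= => /ltW.
near=> s i.
have f0 : `|segment r (ys i) t - segment r y t| <= d / 2 by near: i.
have f1 : W (ws i) by near: i.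
have f2 : `|t - s| <= d / 2 / (L + 1) by near: s.
have f3 : V s by near: s.
have f4 : lipschitz_itv L (a - r) b (ys i) by near: i.
move=> /= sI; apply: Ad; first exact: (VW (s, ws i)).
rewrite -(subrK (segment r (ys i) t) (segment r (ys i) s)) -addrA (splitr d).
apply: le_trans (ler_normD _ _) _; apply: lerD => //.
apply: le_trans (segment_lipschitz hr f4 _ _) _; rewrite ?subrK// distrC.
apply: (@le_trans _ _ ((L + 1) * `|t - s|)).
  by apply: ler_wpM2r => //; rewrite lerDl.
by rewrite -ler_pdivlMl// mulrC.
Unshelve. all: by end_near. Qed.

Hypothesis approx : forall d : R, 0 < d ->
  \forall i \near U, approx_solution (ws i) d a b (ys i).

(** The conclusion of [approx_solution] involves y only through its values at two times, so it
    survives pointwise limits, which derivatives do not. Its premise holds near t by [limit_rhs],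
    with c the limit right-hand side. *)
Lemma limit_is_solution (t : R) : a < t < b -> is_derive t 1 y (rhs w y t).
Proof.
move=> /andP[at_ tb]; set c := rhs w y t.
have key (e : R) : 0 < e -> exists2 h : R, 0 < h &
    forall s s', s <= t -> t <= s' -> t - h <= s -> s' <= t + h ->
      `|y s' - y s - (s' - s) *: c| <= e * (s' - s).
  move=> e0; have tI : a <= t <= b by rewrite !ltW.
  have [[V W] /= [/nbhs_ballP[h /= h0 hV] UW] VW] := limit_rhs tI e0.
  (* With d = h/3 the window [s - d, s'] extends at most 2h/3 before t and h/3 after it, hence lies
     in the ball of radius h. *)
  pose h' := Num.min (h / 3) (Num.min (t - a) (b - t)).
  have h'0 : 0 < h' by rewrite !lt_min divr_gt0//= !subr_gt0 at_ tb.
  have h'1 : h' <= h / 3 by rewrite ge_min lexx.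
  have h'2 : h' <= t - a by rewrite !ge_min lexx orbT.
  have h'3 : h' <= b - t by rewrite !ge_min lexx !orbT.
  exists h' => // s s' st ts' hs hs'.
  apply: (@cvg_norm_le _ _ PU (fun i => ys i s' - ys i s - (s' - s) *: c)).
    apply: cvgB; last exact: cvg_cst.
    by apply: cvgB; apply: ysy; have r0 := hr; apply/andP; split; lra.
  have h3 : 0 < h / 3 by rewrite divr_gt0.
  have := approx h3; apply: filterS2 UW => i Wi hi.
  apply: hi; [lra|lra|lra|].
  move=> u au /andP[us us'].
  apply: (VW (u, i)); last by rewrite /=; apply/andP; split; lra.
  split => //=; apply: hV; rewrite -ball_normE /ball_ /= ltr_norml.
  by apply/andP; split; lra.
have lim : (fun h : R => h^-1 *: (y (h *: 1 + t) - y t)) @ 0^' --> c.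
  apply/cvgrPdist_le => e e0; have [h h0 hh] := key e e0.
  have n1 : \forall k \near (0 : R)^', `|k| <= h by exact: dnbhs0_le.
  have n2 : \forall k \near (0 : R)^', k != 0 by exact: nbhs_dnbhs_neq.
  apply: filterS2 n1 n2 => k kh k0.
  have kE : k *: (1 : R) + t = t + k by rewrite [k *: 1]mulr1 addrC.
  rewrite kE distrC -[X in `|_ - X|]scale1r -(mulVf k0) -scalerA -scalerBr normrZ normfV.
  rewrite ler_pdivrMl ?normr_gt0//.
  move: kh; rewrite ler_norml => /andP[k1 k2].
  have [kp|kn] := leP 0 k.
    have := hh t (t + k); rewrite [t + k]addrC addrK ger0_norm// mulrC; apply; lra.
  have := hh (t + k) t; rewrite opprD addrA subrr add0r => hk.
  rewrite distrC [`|k|]ltr0_norm// mulrC.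
  rewrite (_ : k *: c - _ = y t - y (t + k) - (- k) *: c); last first.
    by rewrite opprB scaleNr opprK addrC.
  by apply: hk; lra.
apply: DeriveDef; first by apply/cvg_ex; exists c.
by apply: cvg_lim => //; exact: norm_hausdorff.
Unshelve. all: by end_near. Qed.

End along_filter.

End limits_of_solutions.

(** * Orbits and existence of solutions *)

Section orbits.
Variables (R : realType) (r : R) (m : nat) (Omega : metricType R).
Variables (theta : R -> Omega -> Omega) (F : Omega -> hist r m -> 'cV[R]_m).
Hypothesis hr : 0 < r.
Hypothesis theta_flow : continuous_flow theta.
Hypothesis Fcont : continuous (fun p : Omega * hist r m => F p.1 p.2).
Implicit Types (y v : R -> 'cV[R]_m) (w : Omega).
Local Notation rhs := (delay_rhs theta F).

(** The Lipschitz seminorm of a difference of histories is at most the supremum of the difference of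
    derivatives, and the right-hand sides converge uniformly. The window has to begin after a, where
    the equation already holds. *)
Lemma limit_lip_segment (I : Type) (U : set_system I) (PU : ProperFilter U)
    (ws : I -> Omega) w (ys : I -> R -> 'cV[R]_m) y (L a b t : R) : 0 <= L ->
  ws @ U --> w ->
  (\forall i \near U, lipschitz_itv L (a - r) b (ys i)) ->
  (\forall i \near U, forall s : R, a < s < b -> is_derive s 1 (ys i) (rhs (ws i) (ys i) s)) ->
  (forall s, a - r <= s <= b -> ys i s @[i --> U] --> y s) ->
  a <= t - r -> t < b ->
  lip_segment r (ys i) t @[i --> U] --> lip_segment r y t.
Proof.
have r0 := hr; move=> L0 wsw hys dys ysy at_ tb.
have hy := limit_lipschitz PU hys ysy.
have dy (s : R) : a < s < b -> is_derive s 1 y (rhs w y s).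
  apply: (limit_is_solution hr theta_flow Fcont PU L0 wsw hys ysy) => d d0.
  by apply: filterS2 hys dys => i h1 h2; apply: (solution_approx hr _ h1 h2); exact: ltW.
have tI : a - r + r <= t <= b by apply/andP; split; lra.
have tI' : a <= t <= b by apply/andP; split; lra.
have near_rhs (e : R) : 0 < e -> \forall i \near U,
    [set u : R | u \in `[t - r, t]] `<=` (fun u => `|rhs (ws i) (ys i) u - rhs w y u| <= e).
  move=> e0; have e2 : 0 < e / 2 by rewrite divr_gt0.
  have /near_covering_withinP cov : near_covering [set u : R | u \in `[t - r, t]].
    exact/compact_near_coveringP/segment_compact.
  apply: cov => u /=; rewrite in_itv/= => uI.
  have uI' : a <= u <= b by case/andP: uI => ? ?; apply/andP; split; lra.
  have n1 := limit_rhs hr theta_flow Fcont PU L0 wsw hys ysy uI' e2.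
  have n2 := rhs_near hr theta_flow Fcont w hy uI' e2.
  have n2' : \forall s \near u & i \near U, a <= s <= b -> `|rhs w y s - rhs w y u| <= e / 2.
    by exists ((fun s => a <= s <= b -> `|rhs w y s - rhs w y u| <= e / 2), setT);
      [split => //; exact: filterT|move=> [s i] /= []].
  apply: filterS2 n1 n2' => -[s i] /= h1 h2; rewrite in_itv/= => sI.
  have sI' : a <= s <= b by case/andP: sI => ? ?; apply/andP; split; lra.
  rewrite -(subrKA (rhs w y u)) (splitr e); apply: le_trans (ler_normD _ _) _.
  by apply: lerD; [exact: h1|rewrite distrC; exact: h2].
apply/cvgrPdist_le => e e0; have e2 : 0 < e / 2 by rewrite divr_gt0.
have n1 := limit_segment PU L0 hys ysy tI' e2.
have n2 := near_rhs _ e2.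
near=> i.
have h1 : `|segment r (ys i) t - segment r y t| <= e / 2 by near: i.
have h2 : [set u : R | u \in `[t - r, t]] `<=` (fun u => `|rhs (ws i) (ys i) u - rhs w y u| <= e / 2) by near: i.
have h3 : lipschitz_itv L (a - r) b (ys i) by near: i.
have h4 : forall s : R, a < s < b -> is_derive s 1 (ys i) (rhs (ws i) (ys i) s) by near: i.
have hd : lipschitz_itv (e / 2) (t - r) t (fun u => 1 *: ys i u + (-1) *: y u).
  apply: (@derive_lipschitz _ _ _ (fun u => 1 *: rhs (ws i) (ys i) u + (-1) *: rhs w y u)).
  - exact: ltW.
  - apply: lipschitz_itv_continuous; apply: lipschitz_itvW (lipschitz_itv_lin 1 (-1) h3 hy) => //; lra.
  - move=> u /andP[? ?]; have uI : a < u < b by apply/andP; split; lra.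
    exact: (is_deriveD (is_deriveZ 1 (h4 u uI)) (is_deriveZ (-1) (dy u uI))).
  - move=> u /andP[? ?]; rewrite scale1r scaleN1r; apply: h2.
    by rewrite /= in_itv/=; apply/andP; split; lra.
rewrite distrC (splitr e); apply: lip_norm_le; first exact: ltW.
  have -> : lip_val (lip_segment r (ys i) t - lip_segment r y t) =
     lip_val (lip_segment r (ys i) t) - lip_val (lip_segment r y t) by [].
  by rewrite (lip_segmentE h3 tI) (lip_segmentE hy tI).
move=> s s' sI s'I.
have E q : - r <= q <= 0 -> (lip_segment r (ys i) t - lip_segment r y t) q =
    1 *: ys i (t + q) + (-1) *: y (t + q).
  move=> qI; transitivity (lip_val (lip_segment r (ys i) t) q - lip_val (lip_segment r y t) q) => //.
  by rewrite (lip_segmentE h3 tI) (lip_segmentE hy tI) (segmentE h3 tI qI) (segmentE hy tI qI) scale1r scaleN1r.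
rewrite !E//; have -> : s - s' = (t + s) - (t + s') by ring.
by apply: hd; move: sI s'I => /andP[? ?] /andP[? ?]; apply/andP; split; lra.
Unshelve. all: by end_near. Qed.

Definition orbit w (a : R) y (L C : R) : Prop :=
  [/\ forall b, lipschitz_itv L (a - r) b y,
      forall t : R, a < t -> is_derive t 1 y (rhs w y t) &
      forall t, a - r <= t -> `|y t| <= C].

Definition entire_orbit w y (L C : R) : Prop := forall a, orbit w a y L C.

Lemma orbit_shift w a y L C s : orbit w a y L C ->
  orbit (theta s w) (a - s) (fun t => y (s + t)) L C.
Proof.
case: theta_flow => _ _ th; move=> [h1 h2 h3]; split.
- move=> b; have := lipschitz_itv_shift (c := s) (h1 (b + s)).
  by rewrite addrK (_ : a - r - s = a - s - r)//; ring.
- move=> t ats.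
  have d1 : is_derive (s + t) 1 y (rhs w y (s + t)) by apply: h2; lra.
  have E : rhs (theta s w) (fun u => y (s + u)) t = rhs w y (s + t).
    by rewrite /delay_rhs segment_shift -th addrC.
  rewrite E; apply/is_derive_mxP => i j; have /is_derive_mxP/(_ i j) d2 := d1.
  have d3 : is_derive t 1 (fun u : R => s + u) 1.
    by rewrite -[X in is_derive _ _ _ X]add0r; exact: (is_deriveD (is_derive_cst s t 1) (is_derive_id t 1)).
  have := @is_derive1_comp _ (fun u => y u i j) (fun u => s + u) t _ _ d2 d3.
  by rewrite mulr1.
- by move=> t ht; apply: h3; lra.
Qed.

Lemma orbitW w a a' y L C : a <= a' -> orbit w a y L C -> orbit w a' y L C.
Proof.
move=> aa [h1 h2 h3]; split.
- by move=> b; apply: lipschitz_itvW (h1 b) => //; lra.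
- by move=> t ht; apply: h2; lra.
- by move=> t ht; apply: h3; lra.
Qed.

(** Each time a has to be covered only eventually. Translates of a forward orbit by s -> +oo satisfy
    this, and so their limit is defined and solves the equation on all of R. *)
Lemma orbit_limit (I : Type) (U : set_system I) (UU : UltraFilter U)
    (ws : I -> Omega) w (ys : I -> R -> 'cV[R]_m) (L C : R) : 0 <= L ->
  ws @ U --> w -> (forall a, \forall i \near U, orbit (ws i) a (ys i) L C) ->
  exists2 y, entire_orbit w y L C &
    forall t, lip_segment r (ys i) t @[i --> U] --> lip_segment r y t.
Proof.
have r0 := hr; move=> L0 wsw orb'.
have lim t : exists l : 'cV[R]_m, ys i t @[i --> U] --> l.
  apply: (@bounded_ultra_cvg _ _ _ _ UU _ C); apply: filterS (orb' t) => i [_ _]; apply; lra.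
have [y hy] := choice lim.
have hys (a b : R) : \forall i \near U, lipschitz_itv L (a - r) b (ys i).
  by apply: filterS (orb' a) => i [].
have dys (a b : R) : \forall i \near U, forall s : R, a < s < b -> is_derive s 1 (ys i) (rhs (ws i) (ys i) s).
  by apply: filterS (orb' a) => i [_ h _] s /andP[? _]; exact: h.
exists y.
  move=> a; split.
  - by move=> b; apply: limit_lipschitz (hys a b) _ => s _; exact: hy.
  - move=> t at_; apply: (limit_is_solution hr theta_flow Fcont _ L0 wsw (hys a (t + 1))).
    + by move=> s _; exact: hy.
    + move=> d d0; apply: filterS2 (hys a (t + 1)) (dys a (t + 1)) => i h1 h2.
      by apply: (solution_approx hr _ h1 h2); exact: ltW.
    + by apply/andP; split; lra.
  - move=> t at_; apply: cvg_norm_le (hy t) _; apply: filterS (orb' a) => i [_ _]; exact.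
move=> t; apply: (@limit_lip_segment _ U _ ws w ys y L (t - r) (t + 1)) => //; lra.
Qed.

Lemma lipschitz_itv_join (L a b c : R) y : 0 <= L ->
  lipschitz_itv L a b y -> lipschitz_itv L b c y -> lipschitz_itv L a c y.
Proof.
move=> L0 h1 h2 s t.
wlog st : s t / t <= s.
  move=> wl sI tI; have [ts|/ltW st] := leP t s; first exact: wl.
  by rewrite distrC [`|s - t|]distrC; exact: wl.
move=> /andP[as_ sc] /andP[at_ tc].
have [sb|sb] := leP s b; first by apply: h1; apply/andP; split; lra.
have [bt|bt] := leP b t; first by apply: h2; apply/andP; split; lra.
rewrite -(subrKA (y b)); apply: le_trans (ler_normD _ _) _.
rewrite (ger0_norm (_ : 0 <= s - t)) ?subr_ge0//.
have e1 : `|y s - y b| <= L * `|s - b| by apply: h2; apply/andP; split; lra.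
have e2 : `|y b - y t| <= L * `|b - t| by apply: h1; apply/andP; split; lra.
apply: le_trans (lerD e1 e2) _; rewrite -mulrDr !ger0_norm ?subr_ge0 ?(ltW sb) ?(ltW bt)//.
by rewrite addrA subrK.
Qed.

Lemma solves_lipschitz w (phi : hist r m) y (L C N T : R) : 0 <= C -> 0 <= N <= L -> 
  (forall w psi, `|psi| <= C -> `|F w psi| <= N) ->
  lipschitz_itv L (- r) 0 phi -> solves theta F w phi y ->
  (forall t, - r <= t <= T -> `|y t| <= C) -> lipschitz_itv L (- r) T y.
Proof.
have r0 := hr; move=> C0 /andP[N0 NL] FN hphi [cy yphi _ dy] yC.
have cy' : {within `[0, T], continuous y}.
  apply: continuous_subspaceW cy => t /=; rewrite !in_itv/= => /andP[? _].
  by rewrite andbT; lra.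
have h1 : lipschitz_itv L (- r) 0 y.
  by move=> s t sI tI; rewrite !yphi ?in_itv//; exact: hphi.
have h2 : lipschitz_itv L 0 T y.
  apply: (@derive_lipschitz _ _ _ (rhs w y)) => //.
  - exact: le_trans NL.
  - by move=> t /andP[t0 _]; exact: dy.
  - move=> t /andP[t0 tT]; apply: le_trans NL; apply: FN; apply: segment_norm_le => // s /andP[? ?].
    by apply: yC; apply/andP; split; lra.
by apply: lipschitz_itv_join h1 h2; exact: le_trans NL.
Qed.

Lemma solves_bounded w (phi : hist r m) y (T : R) : solves theta F w phi y ->
  exists2 C, 0 <= C & forall t, - r <= t <= T -> `|y t| <= C.
Proof.
move=> [cy _ _ _].
have cy' : {within `[- r, T], continuous y}.
  by apply: continuous_subspaceW cy => t /=; rewrite !in_itv/= => /andP[-> _].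
have := continuous_compact cy' (@segment_compact _ (- r) T).
move=> /compact_bounded[M [_ yM]]; exists (`|M| + 1); first by rewrite addr_ge0.
move=> t tI; apply: (yM (`|M| + 1)); last by exists t => //=; rewrite in_itv.
by apply: le_lt_trans (ler_norm M) _; rewrite ltrDl.
Qed.

Lemma lipschitz_solves w (phi : hist r m) y (L : R) :
  (forall b, lipschitz_itv L (- r) b y) ->
  (forall t, - r <= t <= 0 -> y t = phi t) ->
  (forall t : R, 0 < t -> is_derive t 1 y (rhs w y t)) ->
  solves theta F w phi y.
Proof.
have r0 := hr; move=> hy yphi dy; split => //.
- apply/subspace_continuousP => x /=; rewrite in_itv/= andbT => xI.
  apply/cvgrPdist_le => e e0; rewrite near_withinE.
  have c0 : 0 < `|L| + 1 by rewrite ltr_wpDl.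
  apply/nbhs_ballP; exists ((`|L| + 1)^-1 * e); first by rewrite /= mulr_gt0// invr_gt0.
  move=> t; rewrite -ball_normE /ball_ /= in_itv/= andbT => /ltW xt tI.
  have := hy (Num.max x t) x t; rewrite xI tI !le_max !lexx orbT => /(_ isT isT) h.
  apply: le_trans h _; apply: (@le_trans _ _ ((`|L| + 1) * `|x - t|)).
    by apply: ler_wpM2r => //; rewrite (le_trans (ler_norm L))// lerDl.
  by rewrite -ler_pdivlMl.
- apply/cvgrPdist_le => e e0.
  have hy1 : lipschitz_itv L (0 - r) 1 y by rewrite sub0r; exact: hy.
  have I01 : 0 <= (0 : R) <= 1 by rewrite lexx ler01.
  have /nbhs_ballP[d /= d0 hd] := rhs_near hr theta_flow Fcont w hy1 I01 e0.
  have n1 : \forall h \near (0 : R)^'+, 0 < h by exact: nbhs_right_gt.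
  have n2 : \forall h \near (0 : R)^'+, h < 1 by exact: nbhs_right_lt.
  have n3 : \forall h \near (0 : R)^'+, h < d by exact: nbhs_right_lt.
  near=> h.
  have h0 : 0 < h by near: h.
  have h1 : h < 1 by near: h.
  have h2 : h < d by near: h.
  have := @mean_value _ _ y (rhs w y) 0 h (rhs w y 0) e (ltW h0).
  rewrite subr0 -[F _ _]/(rhs w y 0) => mv.
  rewrite distrC -[X in `|_ - X|]scale1r -(mulVf (lt0r_neq0 h0)) -scalerA -scalerBr normrZ normfV.
  rewrite (gtr0_norm h0) ler_pdivrMl// mulrC; apply: mv.
  + by apply: (@lipschitz_itv_continuous _ _ L); apply: lipschitz_itvW (hy h) => //; lra.
  + by move=> t /andP[t0 _]; exact: dy.
  + move=> t /andP[t0 th]; apply: hd; last by apply/andP; split; lra.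
    by rewrite -ball_normE /ball_ /= sub0r normrN gtr0_norm//; exact: lt_trans h2.
Unshelve. all: by end_near. Qed.

(** * Euler polygons and existence for a bounded right-hand side *)

Fixpoint euler w (phi : hist r m) (d : R) (k : nat) : R -> 'cV[R]_m :=
  if k is k'.+1 then
    fun t => if t <= k'%:R * d then euler w phi d k' t
      else euler w phi d k' (k'%:R * d) + (t - k'%:R * d) *: rhs w (euler w phi d k') (k'%:R * d)
  else fun t => phi (Num.min t 0).

Section euler_polygons.
Variables (w : Omega) (phi : hist r m) (L : R).
Hypothesis FL : forall w psi, `|F w psi| <= L.
Hypothesis phiL : lipschitz_itv L (- r) 0 phi.

Let L0 : 0 <= L. Proof. by apply: le_trans (FL w 0). Qed.

Lemma euler_lipschitz d k b : 0 <= d -> lipschitz_itv L (- r) b (euler w phi d k).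
Proof.
have r0 := hr; move=> d0; elim: k b => [|k IH] b.
  move=> s t /andP[s1 s2] /andP[t1 t2] /=.
  apply: le_trans (phiL _ _) _; try by rewrite le_min ge_min lexx orbT andbT; apply/andP; split; lra.
  apply: ler_wpM2l => //.
  have [?|?] := leP s 0; have [?|?] := leP t 0; rewrite ?subrr ?normr0//.
  - by rewrite !ler0_norm; lra.
  - by rewrite !ger0_norm; lra.
have kd : 0 <= k%:R * d by rewrite mulr_ge0.
apply: (@lipschitz_itv_join L _ (k%:R * d)) => //.
  by move=> s t /andP[s1 s2] /andP[t1 t2] /=; rewrite s2 t2; apply: (IH (k%:R * d)); apply/andP.
move=> s t /andP[s1 s2] /andP[t1 t2].
have E u : k%:R * d <= u -> euler w phi d k.+1 u =
   euler w phi d k (k%:R * d) + (u - k%:R * d) *: rhs w (euler w phi d k) (k%:R * d).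
  move=> ku /=; case: ifPn => // uk; have -> : u = k%:R * d by apply/eqP; rewrite eq_le uk ku.
  by rewrite subrr scale0r addr0.
rewrite !E// opprD addrACA subrr add0r -scalerBl opprB addrA subrK normrZ mulrC.
by apply: ler_wpM2r => //; exact: FL.
Qed.

Lemma euler_init d k t : 0 <= d -> t <= 0 -> euler w phi d k t = phi t.
Proof.
move=> d0 t0; elim: k => [|k IH] /=; first by rewrite min_l.
by rewrite (le_trans t0) ?mulr_ge0.
Qed.

(** The slope of an edge is the right-hand side at its left node, at most one step d earlier; hence
    the window in [approx_solution] that reaches back by d. *)
Lemma euler_approx d k : 0 < d -> approx_solution theta F w d 0 (k%:R * d) (euler w phi d k).
Proof.
have r0 := hr; move=> d0; elim: k => [|k IH] s s' e c s0 ss' s'b h.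
  have -> : s = s' by apply/eqP; rewrite eq_le ss' (le_trans s'b)// mul0r.
  by rewrite !subrr scale0r subr0 normr0 mulr0.
set kd := k%:R * d in IH *; have kd0 : 0 <= kd by rewrite mulr_ge0// ltW.
have kdS : k.+1%:R * d = kd + d by rewrite -natr1 mulrDl mul1r.
rewrite kdS in s'b.
have E1 u : u <= kd -> euler w phi d k.+1 u = euler w phi d k u.
  by move=> uk /=; rewrite -/kd uk.
have E2 u : kd <= u -> euler w phi d k.+1 u =
   euler w phi d k kd + (u - kd) *: rhs w (euler w phi d k) kd.
  move=> ku /=; rewrite -/kd; case: ifPn => // uk; have -> : u = kd by apply/eqP; rewrite eq_le uk ku.
  by rewrite subrr scale0r addr0.
have R1 u : u <= kd -> rhs w (euler w phi d k.+1) u = rhs w (euler w phi d k) u.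
  move=> uk; rewrite /delay_rhs; congr F; apply: segment_eq => v /andP[_ vu]; apply: E1.
  exact: le_trans uk.
have A1 q q' : 0 <= q -> q <= q' -> q' <= kd -> s - d <= q - d -> q' <= s' ->
    `|euler w phi d k.+1 q' - euler w phi d k.+1 q - (q' - q) *: c| <= e * (q' - q).
  move=> q0 qq qk h1 h2; rewrite !E1//; last exact: le_trans qk.
  apply: IH => // u u0 /andP[u1 u2]; rewrite -R1; last exact: le_trans qk.
  by apply: h => //; rewrite (le_trans h1)//= (le_trans u2).
have A2 q q' : kd <= q -> q <= q' -> s - d <= kd -> q' <= s' ->
    `|euler w phi d k.+1 q' - euler w phi d k.+1 q - (q' - q) *: c| <= e * (q' - q).
  move=> q0 qq h1 h2; rewrite !E2//; last exact: le_trans qq.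
  rewrite opprD addrACA subrr add0r -scalerBl opprB addrA subrK -scalerBr normrZ mulrC.
  rewrite ger0_norm ?subr_ge0//; apply: ler_wpM2r; first by rewrite subr_ge0.
  rewrite -R1//; apply: h => //; rewrite h1/=.
  by apply: le_trans h2; exact: le_trans qq.
have [s'k|s'k] := leP s' kd; first exact: A1.
have [ks|ks] := leP kd s; first by apply: A2 => //; lra.
have a1 := A1 s kd s0 (ltW ks) (lexx _) (lexx _) (ltW s'k).
have a2 : `|euler w phi d k.+1 s' - euler w phi d k.+1 kd - (s' - kd) *: c| <= e * (s' - kd).
  by apply: A2 => //; lra.
rewrite (_ : _ - _ - _ = (euler w phi d k.+1 s' - euler w phi d k.+1 kd - (s' - kd) *: c) +
  (euler w phi d k.+1 kd - euler w phi d k.+1 s - (kd - s) *: c)); last first.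
  by move: (euler _ _ _ _ s') (euler _ _ _ _ kd) (euler _ _ _ _ s) => X Y Z; apply/matrixP => i j; rewrite !mxE; ring.
apply: le_trans (ler_normD _ _) _; apply: le_trans (lerD a2 a1) _.
by rewrite -mulrDr addrA subrK.
Qed.

(** Existence in the manner of Peano, from continuity and a global bound, so that it also covers a
    truncated right-hand side that need not be of class C^1. *)
Lemma bounded_solution_exists : exists y, [/\ forall b, lipschitz_itv L (- r) b y,
  forall t, - r <= t <= 0 -> y t = phi t &
  forall t : R, 0 < t -> is_derive t 1 y (rhs w y t)].
Proof.
have r0 := hr.
have [U [UU nU]] := @ultraFilterLemma nat \oo _.
(* With step 1/(n+1), the (n+1)^2 edges reach time n + 1, so the step tends to 0 while the horizon
   tends to infinity. *)
pose ys n := euler w phi n.+1%:R^-1 (n.+1 * n.+1)%N.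
have d0 n : 0 < n.+1%:R^-1 :> R by rewrite invr_gt0.
have hys n b : lipschitz_itv L (- r) b (ys n) by apply: euler_lipschitz; exact: ltW.
have ys0 n t : t <= 0 -> ys n t = phi t by move=> t0; apply: euler_init => //; exact: ltW.
have ysa n : approx_solution theta F w n.+1%:R^-1 0 n.+1%:R (ys n).
  have := @euler_approx n.+1%:R^-1 (n.+1 * n.+1)%N (d0 n).
  by rewrite natrM mulfK// pnatr_eq0.
have lim t : exists l : 'cV[R]_m, ys n t @[n --> U] --> l.
  have [t0|t0] := leP t 0.
    by exists (phi t); apply: cvg_near_cst; apply: nearW => n; exact: ys0.
  apply: (@bounded_ultra_cvg _ _ _ _ UU _ (`|phi 0| + L * t)); apply: nearW => n.
  rewrite -(ys0 n 0 (lexx _)) -{1}(subrK (ys n 0) (ys n t)) addrC.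
  apply: le_trans (ler_normD _ _) _; rewrite lerD2l.
  have := hys n t t 0; rewrite subr0 (gtr0_norm t0); apply; apply/andP; split; lra.
have [y hy] := choice lim.
have PU : ProperFilter U by exact: ultra_proper.
have hysU b : \forall n \near U, lipschitz_itv L (0 - r) b (ys n).
  by apply: nearW => n; rewrite sub0r; exact: hys.
exists y; split.
- by move=> b; have := limit_lipschitz PU (hysU b) (fun s _ => hy s); rewrite sub0r.
- move=> t /andP[_ t0]; have h1 : ys n t @[n --> U] --> phi t.
    by apply: cvg_near_cst; apply: nearW => n; exact: ys0.
  by apply: cvg_unique (hy t) h1; exact: norm_hausdorff.
- move=> t t0.
  apply: (@limit_is_solution _ _ _ _ _ _ hr theta_flow Fcont _ _ PU (fun=> w) w ys y L 0 (t + 1)) => //.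
  + exact: cvg_cst.
  + move=> d dp.
    have n1 : \forall n \near U, n.+1%:R^-1 < d.
      by apply: nU; exact: (@near_infty_natSinv_lt R (PosNum dp)).
    have n2 : \forall n \near U, t + 1 <= n%:R by apply: nU; exact: nbhs_infty_ger.
    apply: filterS2 n1 n2 => n h1 h2 s s' e c s0 ss' s't h.
    apply: (ysa n) => //.
      by apply: le_trans s't (le_trans h2 _); rewrite ler_nat.
    move=> u u0 /andP[u1 u2]; apply: h => //; rewrite u2 andbT.
    by apply: le_trans u1; rewrite lerD2l lerN2 ltW.
  + by apply/andP; split; lra.
Qed.

End euler_polygons.

End orbits.

Lemma addKBB (V : zmodType) (a b c : V) : a + (b - a - c) = b - c.
Proof. by rewrite addrA [a + _]addrC subrK. Qed.

(** * Monotone sublinear dynamics *)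

Section monotone_sublinear.
Variables (R : realType) (r : R) (m : nat) (Omega : metricType R).
Variables (theta : R -> Omega -> Omega) (F : Omega -> hist r m -> 'cV[R]_m).
Variable B : 'M[R]_m.
Hypothesis hr : 0 < r.
Hypothesis theta_flow : continuous_flow theta.
Hypothesis Fcont : continuous (fun p : Omega * hist r m => F p.1 p.2).
Hypothesis F_C1 : C1_snd F.
Hypothesis FN : forall C : R, exists2 N : R, 0 <= N & forall w psi, `|psi| <= C -> `|F w psi| <= N.
Hypothesis hB : quasipositive B.
Hypothesis ha : forall w phi psi, Bcone_le B phi psi ->
    cvle (B *m (psi 0 - phi 0)) (F w psi - F w phi).
Hypothesis hb : forall w psi (l : R), Bcone_le B 0 psi -> 0 <= l <= 1 ->
    cvle (l *: F w psi) (F w (l *: psi)).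
Implicit Types (y v z : R -> 'cV[R]_m) (w : Omega).
Local Notation K := (@Kcone R r m B).
Local Notation Int := (interior (@Kcone_lip R r m B)).
Local Notation rhs := (delay_rhs theta F).
Local Notation orbit := (orbit theta F).
Local Notation entire_orbit := (entire_orbit theta F).

Lemma F0_ge0 w : cvle 0 (F w 0).
Proof.
have K0 : Bcone_le B 0 (0 : hist r m) by rewrite /Bcone_le subrr; exact: Kcone0.
have I0 : 0 <= (0 : R) <= 1 by rewrite lexx ler01.
by have := hb w K0 I0; rewrite !scale0r.
Qed.

(** By (b), a solution v that stays in the cone gives a subsolution l v for l in [0, 1]. *)
Lemma scaled_le w y v (l Ly Lv a b : R) : 0 <= l <= 1 ->
  lipschitz_itv Ly (a - r) b y -> lipschitz_itv Lv (a - r) b v ->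
  (forall t : R, a < t < b -> is_derive t 1 y (rhs w y t)) ->
  (forall t : R, a < t < b -> is_derive t 1 v (rhs w v t)) ->
  (forall t, a <= t <= b -> K (segment r v t)) ->
  K (segment r y a - l *: segment r v a) ->
  forall t, a <= t <= b -> K (segment r y t - l *: segment r v t).
Proof.
move=> l01 hy hv dy dv Kv Ka t tI.
have tI' : a - r + r <= t <= b by rewrite subrK.
have aI : a - r + r <= a <= b by rewrite subrK lexx; case/andP: tI; exact: le_trans.
have hlv : lipschitz_itv (`|l| * Lv) (a - r) b (fun u => l *: v u).
  exact: lipschitz_itvZ.
rewrite -(segmentZ l hv tI') -[K _]/(Bcone_le B _ _).
apply: (@subsolution_le _ _ _ _ theta F B hr theta_flow Fcont F_C1 hB ha w y
  (fun u => l *: v u) (fun u => l *: rhs w v u) _ _ a b hy hlv dy) => //.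
- by move=> u uI; exact: (is_deriveZ l (dv u uI)).
- move=> u /andP[au ub]; have uI : a <= u <= b by rewrite !ltW.
  rewrite /delay_rhs (segmentZ l hv) ?subrK//; apply: hb => //.
  by rewrite /Bcone_le subr0; exact: Kv.
- by rewrite /Bcone_le (segmentZ l hv aI).
Qed.

(** The zero function is a subsolution, by (b) with factor 0, and l z with l >= 1 is a
    supersolution, by (b) with factor 1/l applied to l z. *)
Lemma order_bounds w y z (l Ly Lz T : R) : 1 <= l ->
  lipschitz_itv Ly (- r) T y -> lipschitz_itv Lz (- r) T z ->
  (forall t : R, 0 < t < T -> is_derive t 1 y (rhs w y t)) ->
  (forall t : R, 0 < t < T -> is_derive t 1 z (rhs w z t)) ->
  (forall t, 0 <= t <= T -> K (segment r z t)) ->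
  K (segment r y 0) -> K (l *: segment r z 0 - segment r y 0) ->
  forall t, 0 <= t <= T -> K (segment r y t) /\ K (l *: segment r z t - segment r y t).
Proof.
move=> l1 hy hz dy dz Kz Ky Kzy t tI.
have l0 : 0 < l by exact: lt_le_trans l1.
have T0 : 0 <= T by case/andP: tI; exact: le_trans.
have hy' : lipschitz_itv Ly (0 - r) T y by rewrite sub0r.
have hz' : lipschitz_itv Lz (0 - r) T z by rewrite sub0r.
have tI' : 0 - r + r <= t <= T by rewrite subrK.
have aI : 0 - r + r <= 0 <= T by rewrite subrK lexx.
have h0 : lipschitz_itv 0 (0 - r) T (fun=> 0 : 'cV[R]_m).
  by move=> *; rewrite subrr normr0 mul0r.
have seg0 u : 0 <= u <= T -> segment r (fun=> 0 : 'cV[R]_m) u = 0.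
  move=> uI; apply: hist_ext => s sI; rewrite (segmentE h0) ?subrK//.
have hlz : lipschitz_itv (`|l| * Lz) (0 - r) T (fun u => l *: z u).
  exact: lipschitz_itvZ.
split.
  rewrite -[X in K X]subr0 -(seg0 t tI).
  apply: (@subsolution_le _ _ _ _ theta F B hr theta_flow Fcont F_C1 hB ha w y
    (fun=> 0) (fun=> 0) _ _ 0 T hy' h0 dy) => //.
  - move=> u /andP[u0 uT]; rewrite /delay_rhs seg0 ?ltW//; exact: F0_ge0.
  - by rewrite /Bcone_le seg0 ?lexx// subr0.
rewrite -(segmentZ l hz')//.
apply: (@supersolution_ge _ _ _ _ theta F B hr theta_flow Fcont F_C1 hB ha w y
    (fun u => l *: z u) (fun u => l *: rhs w z u) _ _ 0 T hy' hlz dy).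
- by move=> u uI; exact: (is_deriveZ l (dz u uI)).
- move=> u /andP[u0 uT]; have uI : 0 <= u <= T by rewrite !ltW.
  have uI' : 0 - r + r <= u <= T by rewrite subrK.
  have Kl : Bcone_le B 0 (l *: segment r z u).
    by rewrite /Bcone_le subr0; apply: KconeZ; [exact: ltW|exact: Kz].
  have li : 0 <= l^-1 <= 1 by rewrite invr_ge0 ltW//= invf_le1.
  have := hb (theta u w) Kl li; rewrite scalerA mulVf ?gt_eqF// scale1r => h i.
  have := h i; rewrite /delay_rhs (segmentZ l hz')// [X in X <= _]mxE [X in _ -> _ <= X]mxE.
  by rewrite ler_pdivrMl.
- by rewrite /Bcone_le (segmentZ l hz' aI).
- exact: tI.
Qed.

(* Radial truncation makes the right-hand side bounded. The order bounds show that the truncation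
   is never active along the solution. *)
Lemma orbit_exists w z (x : lip r m) (l L C : R) : 1 <= l -> 0 <= C ->
  orbit w 0 z L C -> (forall t, 0 <= t -> K (segment r z t)) ->
  K (lip_val x) -> K (l *: segment r z 0 - lip_val x) ->
  exists y, exists2 L', 0 <= L' & [/\ orbit w 0 y L' (l * C),
    forall t, - r <= t <= 0 -> y t = x t,
    forall t, 0 <= t -> K (segment r y t) &
    forall t, 0 <= t -> K (l *: segment r z t - segment r y t)].
Proof.
have r0 := hr; move=> l1 C0 [hz dz zC] Kz Kx Kzx.
have l0 : 0 < l by exact: lt_le_trans l1.
have lC0 : 0 <= l * C by rewrite mulr_ge0// ltW.
pose D := l * C + 1; have D0 : 0 < D by rewrite ltr_wpDl.
pose kap (psi : hist r m) : R := D / Num.max D `|psi|.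
have mx0 (psi : hist r m) : 0 < Num.max D `|psi| by rewrite lt_max D0.
have kap_le psi : `|kap psi *: psi| <= D.
  rewrite normrZ ger0_norm; last by rewrite divr_ge0// ltW.
  rewrite /kap mulrAC ler_pdivrMr// ler_wpM2l//; first exact: ltW.
  by rewrite le_max lexx orbT.
have kap1 (psi : hist r m) : `|psi| <= D -> kap psi *: psi = psi.
  by move=> pD; rewrite /kap max_l// divff ?scale1r// gt_eqF.
pose G w' (psi : hist r m) := F w' (kap psi *: psi).
have Gcont : continuous (fun p : Omega * hist r m => G p.1 p.2).
  move=> p; rewrite /G.
  apply: (@continuous_comp _ _ _ (fun p : Omega * hist r m => (p.1, kap p.2 *: p.2))
     (fun q : Omega * hist r m => F q.1 q.2)); last exact: Fcont.
  have c1 : (fun q : Omega * hist r m => q.1) @ p --> p.1 by exact: cvg_fst.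
  have c2 : (fun q : Omega * hist r m => q.2) @ p --> p.2 by exact: cvg_snd.
  have c3 : (fun q : Omega * hist r m => kap q.2) @ p --> kap p.2.
    apply: cvgM; first exact: cvg_cst.
    apply: cvgV; first by rewrite gt_eqF.
    have c4 : {for p, continuous ((fun=> D) \max (fun q : Omega * hist r m => `|q.2| : R^o))}.
      by apply: continuous_max; [exact: cvg_cst|exact: cvg_norm c2].
    exact: c4.
  exact: (cvg_pair c1 (cvgZ c3 c2)).
have [N N0 hN] := FN D.
pose L' := Num.max N `|x|.
have GL w' psi : `|G w' psi| <= L'.
  by rewrite /L' le_max hN.
have xL : lipschitz_itv L' (- r) 0 (lip_val x).
  move=> s t sI tI; apply: le_trans (lip_lipschitz x sI tI) _.
  by apply: ler_wpM2r => //; rewrite /L' le_max lexx orbT.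
have L'0 : 0 <= L' by rewrite /L' le_max N0.
have [y [hy yx dy]] := bounded_solution_exists hr theta_flow Gcont w GL xL.
have y0 : segment r y 0 = lip_val x.
  apply: hist_ext => s sI; rewrite (segmentE (hy 0)) ?add0r ?yx//.
  by rewrite addNr lexx.
pose h := (L' + 1)^-1; have h0 : 0 < h by rewrite invr_gt0 ltr_wpDl.
have z0C : `|segment r z 0| <= C.
  by apply: segment_norm_le => // s /andP[s0 _]; exact: zC.
have base t : - r <= t <= 0 -> `|y t| <= l * C.
  move=> tI; rewrite yx//; apply: le_trans (hist_eval_le _ _) _.
  apply: le_trans (Kcone_normal Kx Kzx) _; rewrite normrZ (gtr0_norm l0).
  by rewrite ler_pM2l.
have dyF T : (forall t, - r <= t <= T -> `|y t| <= D) ->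
    forall t, 0 < t < T -> is_derive t 1 y (rhs w y t).
  move=> yD t /andP[t0 tT]; have := dy t t0; rewrite /delay_rhs /G kap1//.
  apply: segment_norm_le; first exact: ltW.
  by move=> s /andP[? ?]; apply: yD; apply/andP; split; lra.
have hzT T : lipschitz_itv L (- r) T z by rewrite -[- r]add0r.
have bounds T : (forall t, - r <= t <= T -> `|y t| <= D) -> forall t, 0 <= t <= T ->
    K (segment r y t) /\ K (l *: segment r z t - segment r y t).
  move=> yD; apply: (order_bounds (w := w) l1 (hy T) (hzT T)); rewrite ?y0//.
  - exact: dyF.
  - by move=> t /andP[t0 _]; exact: dz.
  - by move=> t /andP[t0 _]; exact: Kz.
(* Bootstrap in steps of length h: from the bound l C at time n h, the solution moves by less than 1
   up to (n+1) h and so stays below D = l C + 1, where the truncation is the identity. Then the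
   order bounds hold there and restore l C. *)
have ylC n : forall t, - r <= t <= n%:R * h -> `|y t| <= l * C.
  elim: n => [|n IH]; first by rewrite mul0r.
  have nh0 : 0 <= n%:R * h by rewrite mulr_ge0// ltW.
  have yD t : - r <= t <= n.+1%:R * h -> `|y t| <= D.
    move=> /andP[t1 t2]; have [tn|tn] := leP t (n%:R * h).
      by rewrite /D; apply: (@le_trans _ _ (l * C)); [apply: IH; rewrite t1|rewrite lerDl].
    rewrite -(subrK (y (n%:R * h)) (y t)) addrC /D; apply: le_trans (ler_normD _ _) _.
    apply: lerD; first by apply: IH; rewrite lexx andbT; lra.
    apply: le_trans (hy t _ _ _ _) _; try by apply/andP; split; lra.
    rewrite gtr0_norm ?subr_gt0//.
    have th : t - n%:R * h <= h by move: t2; rewrite -natr1 mulrDl mul1r; lra.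
    apply: (@le_trans _ _ (L' * h)); first exact: ler_wpM2l.
    by rewrite ler_pdivrMr ?mul1r ?lerDl// ltr_wpDl.
  move=> t /andP[t1 t2]; have [tn|tn] := leP t 0; first by apply: base; rewrite t1.
  have tI : 0 <= t <= n.+1%:R * h by rewrite ltW.
  have [K1 K2] := bounds _ yD t tI.
  have <- : segment r y t 0 = y t.
    by apply: (segment0 hr (hy t)); rewrite addNr ltW/=.
  apply: le_trans (hist_eval_le _ _) _; apply: le_trans (Kcone_normal K1 K2) _.
  rewrite normrZ (gtr0_norm l0) ler_pM2l//; apply: segment_norm_le => // s /andP[s0 _].
  by apply: zC; lra.
have yall t : - r <= t -> `|y t| <= l * C.
  move=> t0; apply: (ylC (Num.bound `|t / h|)); rewrite t0/= -ler_pdivrMr//.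
  apply: le_trans (ler_norm _) _; apply: ltW; apply: archi_boundP; exact: normr_ge0.
have yallD T t : - r <= t <= T -> `|y t| <= D.
  by move=> /andP[t0 _]; rewrite /D (le_trans (yall t t0))// lerDl.
exists y; exists L' => //; split => //.
- split.
  + by move=> b; rewrite sub0r; exact: hy.
  + by move=> t t0; apply: (dyF (t + 1)); [exact: yallD|apply/andP; split; lra].
  + by move=> t; rewrite sub0r; exact: yall.
- by move=> t t0; apply: (bounds t _ t _).1; [exact: yallD|rewrite t0 lexx].
- by move=> t t0; apply: (bounds t _ t _).2; [exact: yallD|rewrite t0 lexx].
Qed.

(** The existence of y makes the choice behind [solution] a genuine solution, and uniqueness
    identifies its histories with those of y. Every computation with [sol_segment] goes through
    this. *)
Lemma sol_segmentE w y (x : lip r m) (L : R) :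
  (forall b, lipschitz_itv L (- r) b y) ->
  (forall t, - r <= t <= 0 -> y t = x t) ->
  (forall t : R, 0 < t -> is_derive t 1 y (rhs w y t)) ->
  forall t, 0 <= t -> sol_segment theta F t w x = segment r y t.
Proof.
move=> hy yx dy t t0.
have sy : solves theta F w x y by exact: (lipschitz_solves hr theta_flow Fcont hy yx dy).
have sv : solves theta F w x (solution theta F w x).
  by have := @xgetPex _ (fun=> 0) (solves theta F w x) (ex_intro _ y sy).
have [C C0 hC] := solves_bounded t sv.
have [N N0 hN] := FN C.
pose L' := Num.max N `|x|.
have hv : lipschitz_itv L' (- r) t (solution theta F w x).
  apply: (solves_lipschitz hr C0 _ hN _ sv hC); first by rewrite N0 /L' le_max lexx.
  move=> s s' sI sI'; apply: le_trans (lip_lipschitz x sI sI') _.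
  by apply: ler_wpM2r => //; rewrite /L' le_max lexx orbT.
rewrite /sol_segment; symmetry.
apply: (@solution_unique _ _ _ _ theta F B hr theta_flow Fcont F_C1 hB ha w y
   (solution theta F w x) L L' 0 t) => //.
- by rewrite sub0r.
- by rewrite sub0r.
- by move=> s /andP[s0 _]; exact: dy.
- by move=> s /andP[s0 _]; case: sv => _ _ _; apply.
- apply: segment_eq => s; rewrite sub0r => sI.
  have sI' : s \in `[- r, 0] by rewrite in_itv.
  by rewrite yx//; case: sv => _ h _ _; rewrite (h s sI').
- by rewrite t0 lexx.
Qed.

(** One interior point x bounds the histories from below at all times; this keeps the best factor in
    the uniqueness argument positive and survives limits. The constants may differ between the two
    orbits compared. *)
Definition persistent w y : Prop := exists L C (x : lip r m),
  [/\ 0 <= L, 0 <= C, entire_orbit w y L C, Int x &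
      forall t, K (segment r y t - lip_val x)].

Lemma persistent_shift w y s : persistent w y -> persistent (theta s w) (fun t => y (s + t)).
Proof.
move=> [L [C [x [L0 C0 ey ix Kx]]]]; exists L, C, x; split; [exact: L0|exact: C0| |exact: ix|].
  by move=> a; have := orbit_shift theta_flow s (ey (a + s)); rewrite addrK.
by move=> t; rewrite segment_shift; exact: Kx.
Qed.

Lemma persistent_Kcone w y t : persistent w y -> K (segment r y t).
Proof.
move=> [L [C [x [_ _ _ ix Kx]]]]; rewrite -(subrK (lip_val x) (segment r y t)).
by apply: KconeD => //; exact: int_KconeW.
Qed.

Lemma Kcone_cvg (I : Type) (U : set_system I) (PU : ProperFilter U)
    (xs : I -> lip r m) (x : lip r m) : xs @ U --> x ->
  (\forall i \near U, K (lip_val (xs i))) -> K (lip_val x).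
Proof.
move=> xsx hK; apply: Kcone_closed => e e0.
have /cvgrPdist_le/(_ _ e0) h := xsx.
have [i [Ki xi]] := filter_ex (filterI hK h).
exists (lip_val (xs i)) => //; apply: le_trans xi.
exact: (lip_sup_le hr (x - xs i)).
Qed.

Lemma entire_lip_segment w y L C t : 0 <= L -> 0 <= C -> entire_orbit w y L C ->
  lip_val (lip_segment r y t) = segment r y t /\ `|lip_segment r y t| <= C + L.
Proof.
move=> L0 C0 ey; have [h1 _ h3] := ey t.
have tI : t - r + r <= t <= t by rewrite subrK lexx.
split; first exact: lip_segmentE (h1 t) tI.
apply: (lip_segment_norm_le (h1 t) tI) => // s /andP[s0 _]; exact: h3.
Qed.

Variables (w1 : Omega) (t1 : R).
Hypothesis t1_gt0 : 0 < t1.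
Hypothesis hd : forall (psi : hist r m) (l : R), Bcone_ll B 0 psi -> 0 < l < 1 ->
      Bcone_ll B (l *: sol_segment theta F t1 w1 psi)
                 (sol_segment theta F t1 w1 (l *: psi)).

(** The orbit v that starts at l y_0 lies in between: v <= z by monotonicity, and v is strongly
    above l y at time t1 by (d). *)
Lemma strict_gap y z (l : R) : 0 < l < 1 -> persistent w1 y -> persistent w1 z ->
  K (segment r z 0 - l *: segment r y 0) ->
  Int (lip_segment r z t1 - l *: lip_segment r y t1).
Proof.
move=> l01 py pz Kzy.
have [Ly [Cy [xy [Ly0 Cy0 ey ixy Kxy]]]] := py.
have [Lz [Cz [xz [Lz0 Cz0 ez ixz Kxz]]]] := pz.
have ly t := (entire_lip_segment t Ly0 Cy0 ey).1.
have lz t := (entire_lip_segment t Lz0 Cz0 ez).1.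
have l0 : 0 < l by case/andP: l01.
have [v [Lv Lv0 [[hv dv vC] vx Kv Kzv]]] : exists y0, exists2 L', 0 <= L' &
   [/\ orbit w1 0 y0 L' (1 * Cz),
    forall t, - r <= t <= 0 -> y0 t = (l *: lip_segment r y 0 : lip r m) t,
    forall t, 0 <= t -> K (segment r y0 t) &
    forall t, 0 <= t -> K (1 *: segment r z t - segment r y0 t)].
  apply: (@orbit_exists w1 z _ 1 Lz Cz) => //.
  - by move=> t _; exact: persistent_Kcone pz.
  - rewrite -[X in K X]/(l *: lip_val (lip_segment r y 0)) ly.
    by apply: KconeZ; [exact: ltW|exact: persistent_Kcone py].
  - by rewrite -[X in _ - X]/(l *: lip_val (lip_segment r y 0)) ly scale1r.
have s1 : sol_segment theta F t1 w1 (segment r y 0) = segment r y t1.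
  rewrite -ly; have [h1 h2 _] := ey 0.
  apply: (@sol_segmentE _ _ _ Ly); last exact: ltW.
  - by move=> b; have := h1 b; rewrite sub0r.
  - move=> t tI; rewrite ly (segmentE (h1 0)) ?add0r// addNr lexx.
  - by [].
have s2 : sol_segment theta F t1 w1 (l *: segment r y 0) = segment r v t1.
  rewrite -ly -[l *: _]/(lip_val (l *: lip_segment r y 0)).
  apply: (@sol_segmentE _ _ _ Lv) => //; last exact: ltW.
  by move=> b; have := hv b; rewrite sub0r.
have iy : Bcone_ll B 0 (segment r y 0).
  apply/Bcone_ll0E; exists (lip_segment r y 0) => //.
  by apply: int_KconeD ixy _; rewrite ly.
have [eta ieta etaE] := hd iy l01.
apply: int_KconeD ieta _; rewrite etaE s1 s2.
have -> : lip_val (lip_segment r z t1 - l *: lip_segment r y t1) =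
   lip_val (lip_segment r z t1) - l *: lip_val (lip_segment r y t1) by [].
rewrite ly lz opprB addrA subrK.
by have := Kzv t1 (ltW t1_gt0); rewrite scale1r.
Qed.

Hypothesis recurrent : forall w, exists U : set_system R,
  [/\ UltraFilter U, -oo `<=` U & theta^~ w @ U --> w1].

Lemma persistent_le w y z t : persistent w y -> persistent w z ->
  K (segment r z t - segment r y t).
Proof.
move=> py pz.
have [Ly [Cy [xy [Ly0 Cy0 ey ixy Kxy]]]] := py.
have [Lz [Cz [xz [Lz0 Cz0 ez ixz Kxz]]]] := pz.
have ly s := (entire_lip_segment s Ly0 Cy0 ey).1.
have lz s := (entire_lip_segment s Lz0 Cz0 ez).1.
have lyn s := (entire_lip_segment s Ly0 Cy0 ey).2.
pose S := [set l : R | 0 <= l <= 1 /\ forall s, K (segment r z s - l *: segment r y s)].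
(* Every history of y has norm at most Cy + Ly in X_L, so a single c gives c y_s <= xz <= z_s at all
   times s. *)
have [c c0 hc] := int_absorb (Cy + Ly) ixz.
have Sc : S (Num.min c 1).
  split; first by rewrite le_min ler01 ltW//= ge_min lexx orbT.
  move=> s; rewrite -(subrK (lip_val xz) (segment r z s)) -addrA; apply: KconeD => //.
  rewrite -ly; apply: hc; first exact: lyn.
  by rewrite le_min ler01 ltW//= ge_min lexx.
have Sub : has_ubound S by exists 1 => l [/andP[]].
have S0 : S !=set0 by exists (Num.min c 1).
pose l := sup S.
have lpos : 0 < l.
  by apply: lt_le_trans (ub_le_sup Sub Sc); rewrite lt_min c0 ltr01.
have l1 : l <= 1 by apply: ge_sup => // q [/andP[]].
(* The supremum is attained, because the cone is closed and the histories of y are bounded. *)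
have Sl s : K (segment r z s - l *: segment r y s).
  apply: Kcone_closed => e e0; have CL0 : 0 < Cy + Ly + 1 by rewrite ltr_wpDl// addr_ge0.
  have el : l - e / (Cy + Ly + 1) < l by rewrite ltrBlDr ltrDl divr_gt0.
  have [q Sq ql] := sup_gt S0 el.
  exists (segment r z s - q *: segment r y s); first exact: Sq.2.
  have -> : segment r z s - l *: segment r y s - (segment r z s - q *: segment r y s) =
      (q - l) *: segment r y s.
    by rewrite scalerBl opprB addrC addrA subrK.
  have ql' : q <= l by exact: ub_le_sup.
  rewrite normrZ distrC ger0_norm ?subr_ge0//.
  apply: (@le_trans _ _ (e / (Cy + Ly + 1) * (Cy + Ly + 1))); last by rewrite divfK// gt_eqF.
  apply: ler_pM => //; first by rewrite subr_ge0.
    by rewrite lerBlDl -lerBlDr ltW.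
  rewrite -ly; apply: le_trans (lip_sup_le hr _) _; apply: le_trans (lyn s) _.
  by rewrite lerDl.
have [l1'|l1'] := leP 1 l.
  have le1 : l = 1 by apply/eqP; rewrite eq_le l1.
  by have := Sl t; rewrite le1 scale1r.
exfalso.
have l01 : 0 < l < 1 by rewrite lpos.
have [U [UU UNy Uw]] := recurrent w.
have PU : ProperFilter U by exact: ultra_proper.
have oy a : \forall s \near U, orbit (theta s w) a (fun t => y (s + t)) Ly Cy.
  by apply: nearW => s; have := orbit_shift theta_flow s (ey (a + s)); rewrite addrK.
have oz a : \forall s \near U, orbit (theta s w) a (fun t => z (s + t)) Lz Cz.
  by apply: nearW => s; have := orbit_shift theta_flow s (ez (a + s)); rewrite addrK.
have [y' ey' cy'] := orbit_limit hr theta_flow Fcont UU Ly0 Uw oy.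
have [z' ez' cz'] := orbit_limit hr theta_flow Fcont UU Lz0 Uw oz.
have lys s t' : lip_val (lip_segment r (fun u => y (s + u)) t') = segment r y (s + t').
  by rewrite /lip_segment segment_shift; exact: ly.
have lzs s t' : lip_val (lip_segment r (fun u => z (s + u)) t') = segment r z (s + t').
  by rewrite /lip_segment segment_shift; exact: lz.
have ly' s := (entire_lip_segment s Ly0 Cy0 ey').1.
have lz' s := (entire_lip_segment s Lz0 Cz0 ez').1.
have py' : persistent w1 y'.
  exists Ly, Cy, xy; split; [exact: Ly0|exact: Cy0|exact: ey'|exact: ixy|move=> s]; rewrite -ly'.
  apply: (@Kcone_cvg _ _ PU (fun i => lip_segment r (fun u => y (i + u)) s - xy) (lip_segment r y' s - xy)).
    by apply: cvgB; [exact: cy'|exact: cvg_cst].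
  apply: nearW => i.
  by rewrite -[lip_val _]/(lip_val (lip_segment r (fun u => y (i + u)) s) - lip_val xy) lys.
have pz' : persistent w1 z'.
  exists Lz, Cz, xz; split; [exact: Lz0|exact: Cz0|exact: ez'|exact: ixz|move=> s]; rewrite -lz'.
  apply: (@Kcone_cvg _ _ PU (fun i => lip_segment r (fun u => z (i + u)) s - xz) (lip_segment r z' s - xz)).
    by apply: cvgB; [exact: cz'|exact: cvg_cst].
  apply: nearW => i.
  by rewrite -[lip_val _]/(lip_val (lip_segment r (fun u => z (i + u)) s) - lip_val xz) lzs.
pose dif i s := lip_segment r (fun u => z (i + u)) s - l *: lip_segment r (fun u => y (i + u)) s.
have cdif s : dif i s @[i --> U] --> lip_segment r z' s - l *: lip_segment r y' s.
  apply: cvgB; first exact: cz'.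
  by apply: cvgZ; [exact: cvg_cst|exact: cy'].
have difE i s : lip_val (dif i s) = segment r z (i + s) - l *: segment r y (i + s).
  by rewrite -lys -lzs.
have Kzy' : K (segment r z' 0 - l *: segment r y' 0).
  rewrite -ly' -lz'; apply: (@Kcone_cvg _ _ PU (dif^~ 0) (lip_segment r z' 0 - l *: lip_segment r y' 0)).
    exact: cdif.
  by apply: nearW => i; rewrite difE.
have [e e0 he] := int_Kcone (strict_gap l01 py' pz' Kzy').
have CL0 : 0 < Cy + Ly + 1 by rewrite ltr_wpDl// addr_ge0.
(* The first bound keeps l + d in [0, 1]. By the second, d y at time t1 uses half of the interior
   radius e; the other half is left for the distance to the limit. *)
pose d := Num.min (1 - l) (e / 2 / (Cy + Ly + 1)).
have d0 : 0 < d by rewrite lt_min subr_gt0 l1' !divr_gt0.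
have e2 : 0 < e / 2 by rewrite divr_gt0.
have /cvgrPdist_le/(_ _ e2) near1 := cdif t1.
have gap : \forall i \near U, K (segment r z (i + t1) - (l + d) *: segment r y (i + t1)).
  apply: filterS near1 => i hi.
  pose g := lip_segment r z' t1 - l *: lip_segment r y' t1.
  pose u := (dif i t1 - g) - d *: lip_segment r (fun u => y (i + u)) t1.
  have ue : `|u| <= e.
    apply: le_trans (ler_normB _ _) _; rewrite (splitr e); apply: lerD.
      by rewrite distrC.
    rewrite normrZ gtr0_norm//.
    apply: (@le_trans _ _ (e / 2 / (Cy + Ly + 1) * (Cy + Ly + 1))); last by rewrite divfK// gt_eqF.
    apply: ler_pM => //; first exact: ltW.
      by rewrite /d ge_min lexx orbT.
    rewrite /lip_segment segment_shift; apply: le_trans (lyn _) _.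
    by rewrite lerDl.
  have Ku : K (lip_val (g + u)) by exact: he.
  have gu : g + u = dif i t1 - d *: lip_segment r (fun u => y (i + u)) t1.
    exact: addKBB.
  have E : lip_val (g + u) = lip_val (dif i t1) - d *: lip_val (lip_segment r (fun u => y (i + u)) t1).
    by rewrite gu.
  by move: Ku; rewrite E difE lys -addrA -opprD -scalerDl.
have ld1 : 0 <= l + d <= 1.
  have dl : d <= 1 - l by rewrite /d ge_min lexx.
  by apply/andP; split; [apply: addr_ge0; exact: ltW|rewrite addrC -lerBrDr].
have : S (l + d).
  split; [exact: ld1|move=> s].
  have near2 : \forall i \near U, i <= s - t1 by apply: UNy; apply: nbhs_ninfty_le; exact: num_real.
  have [i [hi is_]] := filter_ex (filterI gap near2).
  have iI : i + t1 <= s by rewrite -lerBrDr.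
  have [hy dy _] := ey (i + t1); have [hz dz _] := ez (i + t1).
  apply: (scaled_le ld1 (hz s) (hy s) _ _ _ hi).
  - by move=> q /andP[q0 _]; exact: dz.
  - by move=> q /andP[q0 _]; exact: dy.
  - by move=> q _; exact: persistent_Kcone py.
  - by rewrite iI lexx.
move=> /(ub_le_sup Sub); rewrite -/l; rewrite gerDl leNgt d0//.
Qed.

Lemma persistent_unique w y z t : persistent w y -> persistent w z ->
  segment r y t = segment r z t.
Proof.
move=> py pz; apply/eqP; rewrite -subr_eq0; apply/eqP; apply: (@Kcone_anti _ _ _ B).
  exact: persistent_le pz py.
by rewrite opprB; exact: persistent_le py pz.
Qed.

End monotone_sublinear.

(** * The minimal set *)

Section minimal_flow.
Variables (R : realType) (Omega : metricType R) (theta : R -> Omega -> Omega).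
Hypothesis Omega_compact : compact [set: Omega].
Hypothesis theta_flow : continuous_flow theta.
Hypothesis theta_minimal : minimal_set (flow_invariant theta) [set: Omega].

Lemma flow_continuous t : continuous (theta t).
Proof.
case: theta_flow => cth _ _ w.
apply: (@continuous_comp _ _ _ (fun w => (t, w)) (fun p : R * Omega => theta p.1 p.2)); last exact: cth.
have c1 : (fun w : Omega => t) @ w --> t by exact: cvg_cst.
have c2 : (fun w : Omega => w) @ w --> w by exact: cvg_id.
exact: (cvg_pair c1 c2).
Qed.

(* The limit set of an orbit along a translation-invariant filter is compact and invariant. *)
Lemma minimal_cluster (G : set_system R) (PG : ProperFilter G) (w w' : Omega) :
  (forall t A, G A -> G (fun s => A (s + t))) -> cluster (theta^~ w @ G) w'.
Proof.
case: (theta_flow) => _ th0 th Gt; pose Q := cluster (theta^~ w @ G).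
have Qt t q : Q q -> Q (theta t q).
  move=> Qq A V GA Vq.
  have GA' : (theta^~ w @ G) [set x | A (theta t x)].
    rewrite /fmap /=; have := Gt t _ GA; apply: filterS => s /=.
    by rewrite addrC th.
  have [x [Ax Vx]] := Qq _ _ GA' (flow_continuous Vq).
  by exists (theta t x).
have cQ : closed Q by rewrite /Q clusterE; apply: closed_bigI => A _; exact: closed_closure.
have QT : Q = [set: Omega].
  case: theta_minimal => _ _ _; apply => //.
  - have GT : (theta^~ w @ G) [set: Omega] by exact: filterT.
    by have [q [_ Qq]] := @Omega_compact (theta^~ w @ G) (fmap_proper_filter _ PG) GT; exists q.
  - exact: subclosed_compact cQ Omega_compact _.
  - move=> t; apply/seteqP; split=> [_ [q Qq <-]|q Qq]; first exact: Qt.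
    by exists (theta (- t) q); [exact: Qt|rewrite -th subrr th0].
by rewrite -[cluster _]/Q QT.
Qed.

Lemma recurrent_pinfty (w w' : Omega) : exists U : set_system R,
  [/\ UltraFilter U, +oo `<=` U & theta^~ w @ U --> w'].
Proof.
apply: cluster_ultra; apply: minimal_cluster => t A [M [_ MA]].
exists (M - t); split; first exact: num_real.
by move=> s; rewrite ltrBlDr => Ms; exact: MA.
Qed.

Lemma recurrent_ninfty (w w' : Omega) : exists U : set_system R,
  [/\ UltraFilter U, -oo `<=` U & theta^~ w @ U --> w'].
Proof.
apply: cluster_ultra; apply: minimal_cluster => t A [M [_ MA]].
exists (M - t); split; first exact: num_real.
by move=> s; rewrite ltrBrDr => Ms; exact: MA.
Qed.

End minimal_flow.

Lemma compact_ultra_limit (I : Type) (U : set_system I) (UU : UltraFilter U)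
    (S T : topologicalType) (A : set (S * T)) (f : I -> S) (g : I -> T) x y :
  hausdorff_space S -> hausdorff_space T -> compact A ->
  (\forall i \near U, A (f i, g i)) -> f @ U --> x -> g @ U --> y -> A (x, y).
Proof.
move=> hS hT cA hA fx gy.
have PU : ProperFilter U by exact: ultra_proper.
have [[x' y'] Al cl] := compact_ultra_cvg UU cA hA.
have f1 : f @ U --> x'.
  apply: (@cvg_comp _ _ _ (fun i => (f i, g i)) fst U _ _ cl); exact: cvg_fst.
have g1 : g @ U --> y'.
  apply: (@cvg_comp _ _ _ (fun i => (f i, g i)) snd U _ _ cl); exact: cvg_snd.
by rewrite (cvg_unique hS fx f1) (cvg_unique hT gy g1).
Qed.

(** * The base map, its graph and its attractivity *)

Section attractor.
Variables (R : realType) (r : R) (m : nat) (Omega : metricType R).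
Variables (theta : R -> Omega -> Omega) (F : Omega -> hist r m -> 'cV[R]_m).
Variable B : 'M[R]_m.
Hypothesis hr : 0 < r.
Hypothesis m_gt0 : (0 < m)%N.
Hypothesis Omega_compact : compact [set: Omega].
Hypothesis theta_flow : continuous_flow theta.
Hypothesis theta_minimal : minimal_set (flow_invariant theta) [set: Omega].
Hypothesis Fcont : continuous (fun p : Omega * hist r m => F p.1 p.2).
Hypothesis F_C1 : C1_snd F.
Hypothesis FN : forall C : R, exists2 N : R, 0 <= N & forall w psi, `|psi| <= C -> `|F w psi| <= N.
Hypothesis hB : quasipositive B.
Hypothesis ha : forall w phi psi, Bcone_le B phi psi ->
    cvle (B *m (psi 0 - phi 0)) (F w psi - F w phi).
Hypothesis hb : forall w psi (l : R), Bcone_le B 0 psi -> 0 <= l <= 1 ->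
    cvle (l *: F w psi) (F w (l *: psi)).
Implicit Types (y v z : R -> 'cV[R]_m) (w : Omega).
Local Notation K := (@Kcone R r m B).
Local Notation Int := (interior (@Kcone_lip R r m B)).
Local Notation entire_orbit := (entire_orbit theta F).
Local Notation persistent := (persistent theta F B).

(** The zero history is not interior: the constant history -c(1, ..., 1) is small in X_L and outside
    the cone, as there is at least one component. *)
Lemma Int_neq0 (x : lip r m) : Int x -> lip_val x <> 0.
Proof.
move=> /int_Kcone[e e0 he] x0.
pose one := (fun=> const_mx 1) : R -> 'cV[R]_m.
have h1 : lipschitz_itv 0 (- r) 0 one by move=> s t _ _; rewrite subrr normr0 mul0r.
have tI : - r + r <= 0 <= (0 : R) by rewrite addNr lexx.
pose u := lip_segment r one 0.
have uE : lip_val u = segment r one 0 by exact: lip_segmentE h1 tI.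
pose c := e / (`|u| + 1).
have u1 : 0 < `|u| + 1 by rewrite ltr_wpDl.
have c0 : 0 < c by rewrite divr_gt0.
have : `|- (c *: u)| <= e.
  rewrite normrN normrZ gtr0_norm// /c mulrAC ler_pdivrMr//.
  by apply: ler_wpM2l; [exact: ltW|rewrite lerDl].
move=> /he; rewrite x0 add0r => -[/(_ 0) h _].
have I0 : 0 \in `[- r, 0] by rewrite in_itv/= oppr_le0 ltW// lexx.
have : (0 : 'cV[R]_m) (Ordinal m_gt0) 0 <= (- (c *: lip_val u 0)) (Ordinal m_gt0) 0 by exact: (h I0).
have nI : - r <= 0 <= (0 : R) by rewrite oppr_le0 ltW//= lexx.
by rewrite uE (segmentE h1 tI nI) !mxE mulr1 oppr_ge0 leNgt c0.
Qed.

(* If no solution existed, [sol_segment] would be the junk value [0], which is not above [psi0]. *)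
Lemma persistent_exists (w0 : Omega) (phi0 : hist r m) :
  Bcone_ll B 0 phi0 ->
  bounded_set [set sol_segment theta F t w0 phi0 | t in [set t | 0 <= t]] ->
  (exists2 psi0 : hist r m, Bcone_ll B 0 psi0 &
          forall t, 0 <= t -> Bcone_le B psi0 (sol_segment theta F t w0 phi0)) ->
  exists L C (x : lip r m), [/\ 0 <= L, 0 <= C, Int x &
    forall w, exists y, entire_orbit w y L C /\ forall t, K (segment r y t - lip_val x)].
Proof.
have r0 := hr; move=> /Bcone_ll0E[p ip <-] [M [_ hM]] [psi0 /Bcone_ll0E[x ix <-] hx].
pose y := solution theta F w0 p.
have sy : solves theta F w0 p y.
  apply: contrapT => ns; apply: (Int_neq0 ix).
  have y0 : y = fun=> 0.
    by rewrite /y /solution xgetPN// => y' sy'; apply: ns; exact: (xgetPex (fun=> 0) (ex_intro _ y' sy')).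
  have := hx 0 (lexx _); rewrite /sol_segment -[solution _ _ _ _]/y y0.
  have -> : segment r (fun=> 0 : 'cV[R]_m) 0 = 0.
    have h0 : lipschitz_itv 0 (- r) 0 (fun=> 0 : 'cV[R]_m) by move=> s t _ _; rewrite subrr normr0 mul0r.
    by apply: hist_ext => s sI; rewrite (segmentE h0) ?addNr ?lexx.
  rewrite /Bcone_le sub0r => K2; apply: Kcone_anti K2; exact: int_KconeW.
(* The bound on y used here depends on t, which is enough to read off the values of the segment.
   Only then can the uniform bound on histories in (c) be transferred to y. *)
have segE t s : 0 <= t -> - r <= s <= 0 -> segment r y t s = y (t + s).
  move=> t0 sI; have [C C0 hC] := solves_bounded t sy.
  have [N N0 hN] := FN C; pose L' : R := Num.max N `|p|.
  have hv : lipschitz_itv L' (- r) t y.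
    apply: (solves_lipschitz hr C0 _ hN _ sy hC); first by rewrite N0 /L' le_max lexx.
    move=> s1 s2 sI1 sI2; apply: le_trans (lip_lipschitz p sI1 sI2) _.
    by apply: ler_wpM2r => //; rewrite /L' le_max lexx orbT.
  by rewrite (segmentE hv)// addNr t0 lexx.
pose C : R := `|M| + 1 + `|p|; have C0 : 0 <= C by apply: addr_ge0; [exact: addr_ge0|exact: normr_ge0].
have yC t : - r <= t -> `|y t| <= C.
  move=> tr; have [t0|t0] := leP 0 t.
    have <- : segment r y t 0 = y t by rewrite segE ?addr0// oppr_le0 ltW//= lexx.
    apply: le_trans (hist_eval_le _ _) _; apply: (@le_trans _ _ (`|M| + 1)).
      apply: (hM (`|M| + 1)); last by exists t.
      by apply: le_lt_trans (ler_norm M) _; rewrite ltrDl.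
    by rewrite /C lerDl.
  have tI : t \in `[- r, 0] by rewrite in_itv/= tr ltW.
  case: (sy) => _ /(_ t tI) -> _ _; apply: le_trans (hist_eval_le _ _) _.
  by apply: le_trans (lip_sup_le hr _) _; rewrite /C lerDr; exact: addr_ge0.
have [N N0 hN] := FN C; pose L : R := Num.max N `|p|.
have L0 : 0 <= L by rewrite /L le_max N0.
have hy b : lipschitz_itv L (- r) b y.
  apply: (solves_lipschitz hr C0 _ hN _ sy); first by rewrite N0 /L le_max lexx.
    move=> s1 s2 sI1 sI2; apply: le_trans (lip_lipschitz p sI1 sI2) _.
    by apply: ler_wpM2r => //; rewrite /L le_max lexx orbT.
  by move=> t /andP[tr _]; exact: yC.
have oy : orbit theta F w0 0 y L C.
  split; [by move=> b; rewrite sub0r; exact: hy|by case: sy|].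
  by move=> t; rewrite sub0r; exact: yC.
exists L, C, x; split; [exact: L0|exact: C0|exact: ix|move=> w].
have [U [UU Upi Uw]] := recurrent_pinfty Omega_compact theta_flow theta_minimal w0 w.
have PU : ProperFilter U by exact: ultra_proper.
have near_ge (a : R) : \forall s \near U, a <= s.
  by apply: Upi; apply: nbhs_pinfty_ge; exact: num_real.
have oU a : \forall s \near U, orbit theta F (theta s w0) a (fun t => y (s + t)) L C.
  apply: filterS (near_ge (- a)) => s sa.
  apply: (orbitW (a := 0 - s)); first by rewrite sub0r lerNl.
  exact: orbit_shift.
have [y' ey' cy'] := orbit_limit hr theta_flow Fcont UU L0 Uw oU.
exists y'; split; first exact: ey'.
move=> t; rewrite -(entire_lip_segment t L0 C0 ey').1.
apply: (@Kcone_cvg _ _ _ B hr _ _ PU (fun i => lip_segment r (fun u => y (i + u)) t - x) (lip_segment r y' t - x)).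
  by apply: cvgB; [exact: cy'|exact: cvg_cst].
apply: filterS (near_ge (- t)) => s st.
have st0 : 0 <= s + t by rewrite -lerBlDr sub0r.
have -> : lip_val (lip_segment r (fun u => y (s + u)) t - x) =
   lip_val (lip_segment r (fun u => y (s + u)) t) - lip_val x by [].
rewrite /lip_segment segment_shift (lip_segmentE (hy (s + t))) ?addNr ?st0 ?lexx//.
exact: hx.
Qed.

Variables (w1 : Omega) (t1 : R).
Hypothesis t1_gt0 : 0 < t1.
Hypothesis hd : forall (psi : hist r m) (l : R), Bcone_ll B 0 psi -> 0 < l < 1 ->
      Bcone_ll B (l *: sol_segment theta F t1 w1 psi)
                 (sol_segment theta F t1 w1 (l *: psi)).
Variables (L C : R) (x0 : lip r m) (ref : Omega -> R -> 'cV[R]_m).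
Hypothesis L_ge0 : 0 <= L.
Hypothesis C_ge0 : 0 <= C.
Hypothesis x0_Int : Int x0.
Hypothesis refP : forall w, entire_orbit w (ref w) L C /\ forall t, K (segment r (ref w) t - lip_val x0).

Definition base_map w : lip r m := lip_segment r (ref w) 0.
Local Notation b := base_map.

Let pref w : persistent w (ref w).
Proof. by case: (refP w) => h1 h2; exists L, C, x0; split. Qed.

(** Translation by t makes y an orbit over the shifted base point, where uniqueness compares it with
    the reference orbit at time 0. In particular the chosen reference orbits fit together along the
    flow. *)
Lemma persistent_base_map w y t : persistent w y -> lip_segment r y t = b (theta t w).
Proof.
move=> py; rewrite /base_map /lip_segment; congr insubd.
have -> : segment r y t = segment r (fun u => y (t + u)) 0 by rewrite segment_shift addr0.
apply: (persistent_unique hr theta_flow Fcont F_C1 FN hB ha hb t1_gt0 hd _ _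
  (persistent_shift theta_flow t py) (pref (theta t w))).
by move=> w'; exact: recurrent_ninfty.
Qed.

Lemma base_map_Int w : Int (b w).
Proof.
have [h1 h2] := refP w; apply: int_KconeD x0_Int _.
by rewrite (entire_lip_segment 0 L_ge0 C_ge0 h1).1.
Qed.

Let limit_base_map (I : Type) (U : set_system I) (UU : UltraFilter U)
    (ws : I -> Omega) w (ys : I -> R -> 'cV[R]_m) (L' C' : R) (x' : lip r m) :
  0 <= L' -> 0 <= C' -> Int x' -> ws @ U --> w ->
  (forall a, \forall i \near U, orbit theta F (ws i) a (ys i) L' C') ->
  (forall t, \forall i \near U, K (segment r (ys i) t - lip_val x')) ->
  lip_segment r (ys i) 0 @[i --> U] --> b w.
Proof.
move=> L'0 C'0 ix' wsw oU Kx'.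
have PU : ProperFilter U by exact: ultra_proper.
have [y' ey' cy'] := orbit_limit hr theta_flow Fcont UU L'0 wsw oU.
have py' : persistent w y'.
  exists L', C', x'; split; [exact: L'0|exact: C'0|exact: ey'|exact: ix'|move=> t].
  rewrite -(entire_lip_segment t L'0 C'0 ey').1.
  apply: (@Kcone_cvg _ _ _ B hr _ _ PU (fun i => lip_segment r (ys i) t - x') (lip_segment r y' t - x')).
    by apply: cvgB; [exact: cy'|exact: cvg_cst].
  apply: filterS2 (oU t) (Kx' t) => i [h1 _ _] h2.
  have -> : lip_val (lip_segment r (ys i) t - x') = lip_val (lip_segment r (ys i) t) - lip_val x' by [].
  by rewrite (lip_segmentE (h1 t)) ?subrK ?lexx.
case: (theta_flow) => _ th0 _.
by rewrite -[X in b X]th0 -(persistent_base_map 0 py').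
Qed.

Lemma base_map_continuous : continuous b.
Proof.
move=> w; apply: cvg_ultrafilters => U UU wU.
apply: (limit_base_map UU L_ge0 C_ge0 x0_Int wU).
- by move=> a; apply: nearW => w'; have [h _] := refP w'; exact: h.
- by move=> t; apply: nearW => w'; have [_ h] := refP w'; exact: h.
Qed.

Lemma base_map_invariant w t : 0 <= t -> sol_segment theta F t w (b w) = b (theta t w).
Proof.
move=> t0; have [h1 _] := refP w; have [hy dy _] := h1 0.
have hy' c : lipschitz_itv L (- r) c (ref w) by have := hy c; rewrite sub0r.
rewrite -(persistent_base_map t (pref w)) (entire_lip_segment t L_ge0 C_ge0 h1).1.
apply: (sol_segmentE hr theta_flow Fcont F_C1 FN hB ha hy') => // s sI.
by rewrite (entire_lip_segment 0 L_ge0 C_ge0 h1).1 (segmentE (hy' 0)) ?add0r// addNr lexx.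
Qed.

Lemma base_map_attracts w (phi : hist r m) : Bcone_ll B 0 phi ->
  exists2 u : R -> lip r m,
    forall t, 0 <= t -> lip_val (u t) = sol_segment theta F t w phi &
    `|u t - b (theta t w)| @[t --> +oo] --> (0 : R).
Proof.
move=> /Bcone_ll0E[x ix <-]; have [h1 h2] := refP w.
have bE : lip_val (b w) = segment r (ref w) 0 by exact: (entire_lip_segment 0 L_ge0 C_ge0 h1).1.
have Kref t : K (segment r (ref w) t) by exact: persistent_Kcone (pref w).
(* Two interior points bound each other up to factors: l b(w) <= x <= l'^{-1} b(w). The upper bound
   yields a global bounded orbit from x, the lower one keeps it above l x0. *)
have [c c0 hc] := int_absorb `|b w| ix.
have [c' c'0 hc'] := int_absorb `|x| (base_map_Int w).
pose l := Num.min c 1; pose l' := Num.min c' 1.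
have l0 : 0 < l by rewrite lt_min c0 ltr01.
have l'0 : 0 < l' by rewrite lt_min c'0 ltr01.
have l1 : l <= 1 by rewrite ge_min lexx orbT.
have l'1 : l' <= 1 by rewrite ge_min lexx orbT.
have Kl : K (lip_val x - l *: lip_val (b w)).
  by apply: hc => //; rewrite (ltW l0)/= ge_min lexx.
have Kl' : K (l'^-1 *: lip_val (b w) - lip_val x).
  have -> : l'^-1 *: lip_val (b w) - lip_val x = l'^-1 *: (lip_val (b w) - l' *: lip_val x).
    by rewrite scalerBr scalerA mulVf ?scale1r// gt_eqF.
  apply: KconeZ; first by rewrite invr_ge0 ltW.
  by apply: hc' => //; rewrite (ltW l'0)/= ge_min lexx.
have linv : 1 <= l'^-1 by rewrite invf_ge1.
have oref := h1 0.
have [y [L' L'0 [oy yx Ky Kzy]]] := @orbit_exists _ _ _ _ theta F B hr theta_flow Fcont F_C1 FN hB ha hb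
  w (ref w) x l'^-1 L C linv C_ge0 oref (fun t _ => Kref t) (int_KconeW ix) ltac:(rewrite -bE; exact: Kl').
have [hy dy yC] := oy.
have hy' c1 : lipschitz_itv L' (- r) c1 y by have := hy c1; rewrite sub0r.
have C'0 : 0 <= l'^-1 * C by rewrite mulr_ge0// invr_ge0 ltW.
have yE t : 0 <= t -> lip_val (lip_segment r y t) = segment r y t.
  by move=> t0; apply: lip_segmentE (hy' t) _; rewrite addNr t0 lexx.
have sE t : 0 <= t -> sol_segment theta F t w x = segment r y t.
  exact: (sol_segmentE hr theta_flow Fcont F_C1 FN hB ha hy').
exists (lip_segment r y) => [t t0|]; first by rewrite yE// sE.
have y0 : segment r y 0 = lip_val x.
  by apply: hist_ext => s sI; rewrite (segmentE (hy' 0)) ?add0r ?yx// addNr lexx.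
have yx0 t : 0 <= t -> K (segment r y t - l *: lip_val x0).
  move=> t0; have [hz dz _] := oref.
  have : K (segment r y t - l *: segment r (ref w) t).
    apply: (@scaled_le _ _ _ _ theta F B hr theta_flow Fcont F_C1 hB ha hb w y (ref w) l L' L 0 t).
    - by rewrite (ltW l0).
    - exact: hy.
    - exact: hz.
    - by move=> s /andP[s0 _]; exact: dy.
    - by move=> s /andP[s0 _]; exact: dz.
    - by move=> s _; exact: Kref.
    - by rewrite y0 -bE.
    - by rewrite t0 lexx.
  move=> K1; rewrite -(subrK (l *: segment r (ref w) t) (segment r y t)) -addrA.
  by apply: KconeD => //; rewrite -scalerBr; apply: KconeZ; [exact: ltW|exact: h2].
apply: cvg_ultrafilters => U UU Upi.
have PU : ProperFilter U by exact: ultra_proper.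
have near_ge (a : R) : \forall s \near U, a <= s.
  by apply: Upi; apply: nbhs_pinfty_ge; exact: num_real.
have [w' _ Uw] : exists2 w', [set: Omega] w' & theta^~ w @ U --> w'.
  by apply: compact_ultra_cvg Omega_compact _; apply: nearW.
have ix' : Int (l *: x0) by exact: int_KconeZ.
have oU a : \forall s \near U, orbit theta F (theta s w) a (fun t => y (s + t)) L' (l'^-1 * C).
  apply: filterS (near_ge (- a)) => s sa.
  apply: (orbitW (a := 0 - s)); first by rewrite sub0r lerNl.
  exact: orbit_shift.
have KU t : \forall s \near U, K (segment r (fun t => y (s + t)) t - lip_val (l *: x0)).
  apply: filterS (near_ge (- t)) => s st; rewrite segment_shift; apply: yx0.
  by rewrite -lerBlDr sub0r.
have c1 := limit_base_map UU L'0 C'0 ix' Uw oU KU.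
have c2 : b (theta s w) @[s --> U] --> b w'.
  by apply: (cvg_comp (theta^~ w) b Uw); exact: base_map_continuous.
have c3 : lip_segment r (fun t => y (s + t)) 0 - b (theta s w) @[s --> U] --> b w' - b w'.
  exact: cvgB.
have -> : (fun t => `|lip_segment r y t - b (theta t w)|) =
    (fun s => `|lip_segment r (fun t => y (s + t)) 0 - b (theta s w)|).
  by apply/funext => s; rewrite /lip_segment segment_shift addr0.
by have := cvg_norm c3; rewrite subrr normr0; apply.
Qed.

(** Forward translates of w accumulate at every w' by minimality of the base, b follows by
    continuity, and the compact set A keeps the limit. It serves both the minimality of the graph
    and its uniqueness. *)
Lemma graph_subset (A : set (Omega * lip r m)) w : compact A -> A (w, b w) ->
  (forall w' t, 0 <= t -> A (w', b w') -> A (theta t w', b (theta t w'))) ->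
  forall w', A (w', b w').
Proof.
move=> cA Aw At w'.
have [U [UU Upi Uw]] := recurrent_pinfty Omega_compact theta_flow theta_minimal w w'.
have hO : hausdorff_space Omega by exact: metric_hausdorff.
have hl : hausdorff_space (lip r m) by exact: norm_hausdorff.
apply: (@compact_ultra_limit _ U UU _ _ A (theta^~ w) (fun s => b (theta s w)) w' (b w') hO hl cA _ Uw).
  have n0 : \forall s \near U, 0 <= s by apply: Upi; apply: nbhs_pinfty_ge; exact: num_real.
  by apply: filterS n0 => s s0; exact: At.
by apply: (cvg_comp (theta^~ w) b Uw); exact: base_map_continuous.
Qed.

End attractor.

Unset Implicit Arguments.

Theorem theorem3p7 (R : realType) (r : R) (hr : 0 < r) (m : nat) (hm : (0 < m)%N)
  (Omega : metricType R) (theta : R -> Omega -> Omega)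
  (Omega_compact : compact [set: Omega])
  (theta_flow : continuous_flow theta)
  (theta_minimal : minimal_set (flow_invariant theta) [set: Omega])
  (B : 'M[R]_m) (hB : quasipositive B)
  (F : Omega -> hist r m -> 'cV[R]_m)
  (F_continuous : continuous (fun p : Omega * hist r m => F p.1 p.2))
  (F_C1 : C1_snd F)
  (F_bounded : forall X1 : set (hist r m), bounded_set X1 ->
    bounded_set [set F p.1 p.2 | p in [set: Omega] `*` X1])
  (ha : forall w phi psi, Bcone_le B phi psi ->
    cvle (B *m (psi 0 - phi 0)) (F w psi - F w phi))
  (hb : forall w psi (l : R), Bcone_le B 0 psi -> 0 <= l <= 1 ->
    cvle (l *: F w psi) (F w (l *: psi)))
  (hc : exists (w0 : Omega) (phi0 : hist r m),
    [/\ Bcone_ll B 0 phi0,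
        bounded_set [set sol_segment theta F t w0 phi0 | t in [set t | 0 <= t]] &
        exists2 psi0 : hist r m, Bcone_ll B 0 psi0 &
          forall t, 0 <= t -> Bcone_le B psi0 (sol_segment theta F t w0 phi0)])
  (hd : exists (w1 : Omega) (t1 : R), 0 < t1 /\
    forall (psi : hist r m) (l : R), Bcone_ll B 0 psi -> 0 < l < 1 ->
      Bcone_ll B (l *: sol_segment theta F t1 w1 psi)
                 (sol_segment theta F t1 w1 (l *: psi))) :
  exists M : set (Omega * lip r m),
    [/\ minimal_set (semiflow_invariant theta F) M,
        strongly_positive B M,
        forall M', minimal_set (semiflow_invariant theta F) M' ->
          strongly_positive B M' -> M' = M &
        exists b : Omega -> lip r m,
          [/\ continuous b,
              forall w, interior (Kcone_lip (r := r) B) (b w),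
              M = [set (w, b w) | w in [set: Omega]] &
              forall (w : Omega) (phi : hist r m), Bcone_ll B 0 phi ->
                exists2 u : R -> lip r m,
                  forall t, 0 <= t -> lip_val (u t) = sol_segment theta F t w phi &
                  `|u t - b (theta t w)| @[t --> +oo] --> (0 : R)]].
Proof.
have FN (C : R) : exists2 N : R, 0 <= N & forall w psi, `|psi| <= C -> `|F w psi| <= N.
  have bC : bounded_set [set psi : hist r m | `|psi| <= C].
    by exists C; split; [exact: num_real|move=> M CM psi /= /le_trans; apply; exact: ltW].
  have [M [_ hM]] := F_bounded _ bC.
  exists (`|M| + 1); first exact: addr_ge0.
  move=> w psi psiC; apply: (hM (`|M| + 1)).
    by apply: le_lt_trans (ler_norm M) _; rewrite ltrDl.
  by exists (w, psi).
have [w0 [phi0 [hc1 hc2 hc3]]] := hc.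
have [w1 [t1 [t1_gt0 hd1]]] := hd.
have [L [C [x0 [L0 C0 ix0 hp]]]] := persistent_exists hr hm Omega_compact theta_flow theta_minimal
  F_continuous FN hc1 hc2 hc3.
have [ref refP] := choice hp.
pose b := base_map r ref.
have b_cont : continuous b := base_map_continuous hr Omega_compact theta_flow theta_minimal
  F_continuous F_C1 FN hB ha hb t1_gt0 hd1 L0 C0 ix0 refP.
have b_int w : interior (@Kcone_lip R r m B) (b w) := base_map_Int L0 C0 ix0 refP w.
have b_inv w t : 0 <= t -> sol_segment theta F t w (b w) = b (theta t w) :=
  base_map_invariant hr Omega_compact theta_flow theta_minimal
  F_continuous F_C1 FN hB ha hb t1_gt0 hd1 L0 C0 ix0 refP w (t := t).
have b_attr := base_map_attracts hr Omega_compact theta_flow theta_minimal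
  F_continuous F_C1 FN hB ha hb t1_gt0 hd1 L0 C0 ix0 refP.
have graph_sub := graph_subset hr Omega_compact theta_flow theta_minimal
  F_continuous F_C1 FN hB ha hb t1_gt0 hd1 L0 C0 ix0 refP.
pose M := [set (w, b w) | w in [set: Omega]].
have th_inv t w : theta t (theta (- t) w) = w.
  by case: theta_flow => _ th0 th; rewrite -th subrr th0.
have MT w : M (w, b w) by exists w.
have M_compact : compact M.
  apply: continuous_compact Omega_compact; apply: continuous_subspaceT => w.
  have c1 : (fun w : Omega => w) @ w --> w by exact: cvg_id.
  exact: (cvg_pair c1 (b_cont w)).
have M_inv : semiflow_invariant theta F M.
  move=> t t0; apply/seteqP; split.
    move=> _ [_ [_ [w _ <-] <-] <-]; exists (theta t w, b (theta t w)) => //.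
    by rewrite /semiflow /lip_incl /= b_inv.
  move=> _ [_ [w _ <-] <-]; exists (lip_incl (theta (- t) w, b (theta (- t) w))).
    by exists (theta (- t) w, b (theta (- t) w)).
  by rewrite /semiflow /lip_incl /= b_inv// th_inv.
have graph_inv A : semiflow_invariant theta F A -> forall w t, 0 <= t -> A (w, b w) ->
    A (theta t w, b (theta t w)).
  move=> Ai w t t0 Aw.
  have : (@lip_incl R r m Omega @` A) (semiflow theta F t (lip_incl (w, b w))).
    by rewrite -(Ai t t0); exists (lip_incl (w, b w)) => //; exists (w, b w).
  move=> [[w' x'] Ax']; rewrite /semiflow /lip_incl /= b_inv// => -[<- xE].
  by rewrite -(val_inj xE).
have M_min : minimal_set (semiflow_invariant theta F) M.
  split => //.
    by exists (w0, b w0).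
  move=> A [a Aa] cA Ai AM; apply/seteqP; split => // _ [w _ <-].
  have [wa _ E] := AM _ Aa.
  apply: (graph_sub A wa cA); first by rewrite E.
  exact: graph_inv.
exists M; split => //.
- by move=> _ [w _ <-]; exact: b_int.
(* By minimality of M' it suffices that M is contained in M'. Start from any (w, x) in M':
   attraction brings the orbit of x to b while w returns to itself, so compactness puts (w, b w) in
   M', and [graph_sub] adds the rest of the graph. *)
- move=> M' [[[w x] M'wx] cM' iM' minM'] pM'; apply/esym/minM' => //.
    by exists (w0, b w0).
  have ix : Bcone_ll B 0 (lip_val x) by apply/Bcone_ll0E; exists x => //; exact: pM' M'wx.
  have [u uE uc] := b_attr w _ ix.
  have [U [UU Upi Uw]] := recurrent_pinfty Omega_compact theta_flow theta_minimal w w.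
  have PU : ProperFilter U by exact: ultra_proper.
  have M'w : M' (w, b w).
    have hO : hausdorff_space Omega by exact: metric_hausdorff.
    have hl : hausdorff_space (lip r m) by exact: norm_hausdorff.
    apply: (@compact_ultra_limit _ U UU _ _ M' (theta^~ w) u w (b w) hO hl cM' _ Uw).
      have n0 : \forall s \near U, 0 <= s by apply: Upi; apply: nbhs_pinfty_ge; exact: num_real.
      apply: filterS n0 => s s0.
      have : (@lip_incl R r m Omega @` M') (semiflow theta F s (lip_incl (w, x))).
        by rewrite -(iM' s s0); exists (lip_incl (w, x)) => //; exists (w, x).
      move=> [[w' x'] M'x']; rewrite /semiflow /lip_incl /= -uE// => -[<- xE].
      by rewrite -(val_inj xE).
    have c1 : b (theta s w) @[s --> U] --> b w by apply: (cvg_comp (theta^~ w) b Uw); exact: b_cont.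
    have c2 : u s - b (theta s w) @[s --> U] --> (0 : lip r m).
      apply/cvgr0Pnorm_lt => e e0; apply: Upi.
      have /cvgrPdist_lt/(_ _ e0) := uc.
      by apply: filterS => s; rewrite sub0r normrN normr_id.
    have c3 : (u s - b (theta s w)) + b (theta s w) @[s --> U] --> 0 + b w by exact: cvgD.
    rewrite (_ : u = fun s => (u s - b (theta s w)) + b (theta s w)); last first.
      by apply/funext => s; rewrite subrK.
    by rewrite add0r in c3.
  by move=> _ [w' _ <-]; apply: (graph_sub M' w cM' M'w); exact: graph_inv.
- by exists b; split.
Qed.
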